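(* Let $\gamma$ be a smooth and regular curve in the Minkowski plane $\mathbb{R}^2_1$. Suppose that $t_0$ (a non-lightlike point) is a vertex of order $2$ of $\gamma$ which is not an inflection. Then the evolute of $\gamma$ has an $E_6$ singularity at $t_0$, i.e. its germ at $t_0$ is $\mathcal{A}$-equivalent to $t\mapsto (t^3,t^4)$ at $t=0$. Moreover, if $\gamma_s$ is a generic $1$-parameter family of curves with $\gamma_0=\gamma$, then the evolutes of $\gamma_s$ undergo the swallowtail transition at $s=0$: near $t_0$, the evolute of $\gamma_s$ has two ordinary cusps and one self-intersection on one side of $s=0$, and is smooth on the other side. On one side of the transition $\gamma_s$ has, near $t_0$, exactly two vertices, one inward and one outward, and on the other side it has none.
   Context: $\mathbb{R}^2_1$ is $\mathbb{R}^2$ with $\langle u,v\rangle=-u_1v_1+u_2v_2$; a non-zero vector $u$ is spacelike, lightlike or timelike if $\langle u,u\rangle$ is $>0$, $=0$ or $<0$; $u^\perp=(u_2,u_1)$ and $\|u\|=|\langle u,u\rangle|^{1/2}$. A point $t$ of a regular curve $\gamma$ is lightlike if $\gamma'(t)$ is lightlike. At a non-lightlike point, $T=\gamma'/\|\gamma'\|$, $N=\pm\gamma'^\perp/\|\gamma'\|$ ($+$ if $\gamma'$ is timelike, $-$ if spacelike), and the curvature is $\kappa=\langle\gamma'',\gamma'^\perp\rangle/|\langle\gamma',\gamma'\rangle|^{3/2}$. Inflection: $\kappa(t_0)=0$. Ordinary vertex: $\kappa'(t_0)=0$, $\kappa''(t_0)\ne0$. Vertex of order $k\ge2$: $\kappa'(t_0)=\dots=\kappa^{(k)}(t_0)=0$,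 $\kappa^{(k+1)}(t_0)\ne 0$. An ordinary vertex is inward if $\kappa(t_0)\kappa''(t_0)>0$ and outward if $\kappa(t_0)\kappa''(t_0)<0$. The evolute, at a non-lightlike point that is not an inflection, is $e(t)=\gamma(t)-\frac{1}{\kappa(t)}N(t)$. Generic family: locally, up to an isometry of $\mathbb{R}^2_1$ and reparametrization, write $t_0=0$ and $\gamma_s(t)=(t,f_s(t))$ if $\gamma$ is timelike at $t_0$ (and $\gamma_s(t)=(f_s(t),t)$ if spacelike), with $f_0(0)=f_0'(0)=0$. The family of Monge-Taylor maps is $j^k\Phi(t,s)=(f_s'(t),\frac1{2!}f_s''(t),\dots,\frac1{k!}f_s^{(k)}(t))\in J^k(1,1)\cong\mathbb{R}^k$, with coordinates $(a_1,\dots,a_k)$. The vertex stratum $V(n)$ ($V=V(1)$) is given by $g=g'=\dots=g^{(n-1)}=0$, where $g=f'''(1-f'^2)+3f'f''^2$ is the numerator of $\kappa'$, expressed in jet coordinates by $f^{(i)}=i!\,a_i$. The family is generic if $j^k\Phi$ ($k$ large) is transverse at $(0,0)$ to the strata $V,V(2)$. *)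

(* Defs.v *)
(* Stdlib's real numbers, with Coquelicot for derivatives and germs *)
From Stdlib Require Import Reals Factorial.
From Coquelicot Require Import Coquelicot.
Open Scope R_scope.

(** * The Minkowski plane *)

Definition point : Type := (R * R)%type.

Definition mink (u v : point) : R := - (fst u * fst v) + snd u * snd v.
Definition vadd (u v : point) : point := (fst u + fst v, snd u + snd v).
Definition vscal (c : R) (u : point) : point := (c * fst u, c * snd u).
Definition vsub (u v : point) : point := (fst u - fst v, snd u - snd v).
Definition vperp (u : point) : point := (snd u, fst u).
Definition mnorm (u : point) : R := sqrt (Rabs (mink u u)).
Definition vdet (u v : point) : R := fst u * snd v - snd u * fst v.

Definition timelike (u : point) : Prop := mink u u < 0.
Definition spacelike (u : point) : Prop := mink u u > 0.

Definition isometry (A : point -> point) : Prop :=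
  forall p q, mink (vsub (A p) (A q)) (vsub (A p) (A q)) = mink (vsub p q) (vsub p q).

(** * Smooth germs and A-equivalence *)

(* The quantification over [n] is inside [locally]: all derivatives exist on one
   common neighbourhood. *)
Definition smooth1 (f : R -> R) (x : R) : Prop :=
  locally x (fun y => forall n, ex_derive_n f n y).

Definition smooth2 (F : R -> R -> R) (x y : R) : Prop :=
  locally_2d (fun u v => forall n, ex_diff_n F n u v) x y.

Definition smooth_curve (c : R -> point) (t : R) : Prop :=
  smooth1 (fun u => fst (c u)) t /\ smooth1 (fun u => snd (c u)) t.

Definition smooth_map (H : point -> point) (p : point) : Prop :=
  smooth2 (fun x y => fst (H (x, y))) (fst p) (snd p) /\
  smooth2 (fun x y => snd (H (x, y))) (fst p) (snd p).

Definition diffeo_germ1 (h : R -> R) (x y : R) : Prop :=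
  h x = y /\ smooth1 h x /\
  exists k : R -> R, k y = x /\ smooth1 k y /\
    locally x (fun u => k (h u) = u) /\ locally y (fun v => h (k v) = v).

Definition diffeo_germ2 (H : point -> point) (p q : point) : Prop :=
  H p = q /\ smooth_map H p /\
  exists K : point -> point, K q = p /\ smooth_map K q /\
    locally p (fun u => K (H u) = u) /\ locally q (fun v => H (K v) = v).

Definition A_equivalent (c : R -> point) (x : R) (d : R -> point) (y : R) : Prop :=
  exists (h : R -> R) (H : point -> point),
    diffeo_germ1 h x y /\ diffeo_germ2 H (c x) (d y) /\
    locally x (fun t => H (c t) = d (h t)).

Definition E6_singularity (c : R -> point) (t : R) : Prop :=
  A_equivalent c t (fun u => (u ^ 3, u ^ 4)) 0.

Definition ordinary_cusp (c : R -> point) (t : R) : Prop :=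
  A_equivalent c t (fun u => (u ^ 2, u ^ 3)) 0.

(** * Differential geometry of curves in the Minkowski plane *)

Definition vel (c : R -> point) (t : R) : point :=
  (Derive (fun u => fst (c u)) t, Derive (fun u => snd (c u)) t).

Definition acc (c : R -> point) (t : R) : point := vel (vel c) t.

Definition regular_at (c : R -> point) (t : R) : Prop := vel c t <> (0, 0).

Definition nonlightlike (c : R -> point) (t : R) : Prop :=
  mink (vel c t) (vel c t) <> 0.

Definition normal (c : R -> point) (t : R) : point :=
  let v := vel c t in
  if Rlt_dec (mink v v) 0
  then vscal (/ mnorm v) (vperp v)
  else vscal (- / mnorm v) (vperp v).

Definition curvature (c : R -> point) (t : R) : R :=
  mink (acc c t) (vperp (vel c t)) / Rpower (Rabs (mink (vel c t) (vel c t))) (3 / 2).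

Definition inflection (c : R -> point) (t : R) : Prop :=
  nonlightlike c t /\ curvature c t = 0.

Definition evolute (c : R -> point) (t : R) : point :=
  vsub (c t) (vscal (1 / curvature c t) (normal c t)).

Definition vertex (c : R -> point) (t : R) : Prop :=
  nonlightlike c t /\ Derive (curvature c) t = 0.

(* Order 1 is an ordinary vertex. *)
Definition vertex_of_order (k : nat) (c : R -> point) (t : R) : Prop :=
  nonlightlike c t /\
  (forall i, (1 <= i <= k)%nat -> Derive_n (curvature c) i t = 0) /\
  Derive_n (curvature c) (S k) t <> 0.

Definition inward_vertex (c : R -> point) (t : R) : Prop :=
  vertex_of_order 1 c t /\ curvature c t * Derive_n (curvature c) 2 t > 0.

Definition outward_vertex (c : R -> point) (t : R) : Prop :=
  vertex_of_order 1 c t /\ curvature c t * Derive_n (curvature c) 2 t < 0.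

(** * Jets, vertex strata and generic families *)

(* A point of J^k(1,1) = R^k is a function on [nat] of which only the
   coordinates a_1, ..., a_k are looked at. *)
Definition jet : Type := nat -> R.

Definition jet_poly (k : nat) (a : jet) (t : R) : R :=
  sum_n_m (fun i => a i * t ^ i) 1 k.

Definition vertex_num (f : R -> R) (t : R) : R :=
  Derive_n f 3 t * (1 - (Derive f t) ^ 2) + 3 * Derive f t * (Derive_n f 2 t) ^ 2.

(* g^(j) in jet coordinates: g^(j)(0) for the polynomial f = a_1 t + ... + a_k t^k,
   for which f^(i)(0) = i! a_i.  It involves a_1, ..., a_{j+3} only, so it is
   meaningful on k-jets when j + 3 <= k. *)
Definition jet_num (k j : nat) (a : jet) : R :=
  Derive_n (vertex_num (jet_poly k a)) j 0.

Definition stratum (k n : nat) (a : jet) : Prop :=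
  forall j, (j < n)%nat -> jet_num k j a = 0.

(* Common kernel of the differentials at [a] of the equations of V(n).  This is the
   tangent space because these are independent where a_1^2 <> 1: the derivative of
   the j-th one with respect to a_{j+3} is (j+3)! (1 - a_1^2), and a_{j+3} does not
   occur in the previous ones. *)
Definition stratum_tangent (k n : nat) (a v : jet) : Prop :=
  forall j, (j < n)%nat -> is_derive (fun h : R => jet_num k j (fun i => a i + h * v i)) 0 0.

Definition monge_taylor (f : R -> R -> R) (t s : R) : jet :=
  fun i => Derive_n (f s) i t / INR (fact i).

Definition transverse_to_stratum (k n : nat) (Phi : R -> R -> jet) (t s : R) : Prop :=
  stratum k n (Phi t s) ->
  forall w : jet, exists (p q : R) (v : jet),
    stratum_tangent k n (Phi t s) v /\
    forall i, (1 <= i <= k)%nat ->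
      w i = p * Derive (fun t' => Phi t' s i) t + q * Derive (fun s' => Phi t s' i) s + v i.

(* [Gam s] is the curve gamma_s, [f s] is f_s.  [A] is the isometry and [phi s] the
   change of parameter bringing gamma_s to Monge form, with t_0 = phi 0 0. *)
Definition monge_form (Gam : R -> R -> point) (t0 : R) (f : R -> R -> R) : Prop :=
  f 0 0 = 0 /\ Derive (f 0) 0 = 0 /\ smooth2 f 0 0 /\
  exists (A : point -> point) (phi : R -> R -> R),
    isometry A /\ smooth2 phi 0 0 /\ phi 0 0 = t0 /\ Derive (phi 0) 0 <> 0 /\
    (timelike (vel (Gam 0) t0) ->
       locally_2d (fun s u => A (Gam s (phi s u)) = (u, f s u)) 0 0) /\
    (spacelike (vel (Gam 0) t0) ->
       locally_2d (fun s u => A (Gam s (phi s u)) = (f s u, u)) 0 0).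

Definition generic_family (Gam : R -> R -> point) (t0 : R) : Prop :=
  exists (f : R -> R -> R) (k : nat),
    monge_form Gam t0 f /\ (4 <= k)%nat /\
    transverse_to_stratum k 1 (monge_taylor f) 0 0 /\
    transverse_to_stratum k 2 (monge_taylor f) 0 0.

(* Jointly smooth family of curves defined on the interval (a, b), for |s| < d. *)
Definition smooth_family (Gam : R -> R -> point) (a b : Rbar) (d : R) : Prop :=
  forall s t : R, Rabs s < d -> Rbar_lt a t -> Rbar_lt t b ->
    smooth2 (fun s' t' => fst (Gam s' t')) s t /\
    smooth2 (fun s' t' => snd (Gam s' t')) s t.

(** * The swallowtail transition *)

Definition near (t0 r t : R) : Prop := t0 - r < t < t0 + r.

Definition immersed (c : R -> point) (t : R) : Prop :=
  smooth_curve c t /\ regular_at c t.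

(* The branches crossing at the self-intersection are transverse, and the loop
   between them contains the two cusps. *)
Definition two_cusps_one_crossing (c : R -> point) (t0 r : R) : Prop :=
  exists c1 c2 t1 t2 : R,
    near t0 r t1 /\ near t0 r t2 /\ t1 < c1 /\ c1 < c2 /\ c2 < t2 /\
    ordinary_cusp c c1 /\ ordinary_cusp c c2 /\
    (forall t, near t0 r t -> t <> c1 -> t <> c2 -> immersed c t) /\
    c t1 = c t2 /\ vdet (vel c t1) (vel c t2) <> 0 /\
    (forall u v, near t0 r u -> near t0 r v -> u < v -> c u = c v -> u = t1 /\ v = t2).

Definition embedded_near (c : R -> point) (t0 r : R) : Prop :=
  (forall t, near t0 r t -> immersed c t) /\
  (forall u v, near t0 r u -> near t0 r v -> c u = c v -> u = v).

(* "Near t0, [P1 s] on one side of s = 0 and [P2 s] on the other side": for every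
   small radius r there is d > 0 such that, for 0 < |s| < d, [P1 s r] holds on the
   side sg * s > 0 and [P2 s r] on the side sg * s < 0, where sg = 1 or -1. *)
Definition on_sides (sg : R) (P1 P2 : R -> R -> Prop) : Prop :=
  exists r0 : R, 0 < r0 /\ forall r, 0 < r <= r0 ->
    exists d : R, 0 < d /\ forall s, Rabs s < d ->
      (0 < sg * s -> P1 s r) /\ (sg * s < 0 -> P2 s r).

Definition swallowtail_transition (E : R -> R -> point) (t0 sg : R) : Prop :=
  E6_singularity (E 0) t0 /\
  on_sides sg (fun s r => two_cusps_one_crossing (E s) t0 r)
              (fun s r => embedded_near (E s) t0 r).

Definition one_inward_one_outward (c : R -> point) (t0 r : R) : Prop :=
  exists v1 v2 : R,
    near t0 r v1 /\ near t0 r v2 /\ inward_vertex c v1 /\ outward_vertex c v2 /\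
    forall t, near t0 r t -> vertex c t -> t = v1 \/ t = v2.

Definition no_vertex (c : R -> point) (t0 r : R) : Prop :=
  forall t, near t0 r t -> ~ vertex c t.

Definition evolute_defined_near (c : R -> point) (t0 r : R) : Prop :=
  forall t, near t0 r t -> nonlightlike c t /\ ~ inflection c t.

(* Main.v *)
(** Let v = (a, b) be the velocity of the curve, q = <v, v> and P = <acceleration, v^perp>.  The
    evolute is gamma + (q / P) v^perp and its derivative is - (G / P^2) v^perp with
    G = P' q - (3/2) P q', while the curvature has derivative G / (q |q|^(3/2)).  Hence vertices of
    the curve and singular points of the evolute are both the zeros of G, and in suitable linear
    coordinates the evolute is a front X' = mu, Y' = theta mu with theta' <> 0.

    A simple (double) zero of mu gives (t^2 u, t^3 w) (resp. (t^3 u, t^4 w)) with u, w units.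
    Reparametrizing so that the first component is t^p, the second one becomes t^(p+1) W(t); the
    decomposition W = W_0(t^p) + t W_1(t^p) + ... (proved from Borel's lemma and the smoothness of
    F(x^(1/p)) for flat F) makes it a function of t^p and t^(p+1) which is linear or quadratic in
    the latter, hence explicitly invertible.  For p = 3 the single gap t^5 is removed beforehand by
    a shear.

    In a generic family G vanishes with G_t at (0, t0) while G_tt and G_s do not, so G has two
    simple zeros c1 < c2 on one side of s = 0 and none on the other.  With theta increasing and mu
    of signs +, -, + the three branches X -> Y of the front have increasing slopes, so only
    the first and the last can meet, and they meet exactly once. *)

Require Import Defs.
From Stdlib Require Import Reals.
From Coquelicot Require Import Coquelicot.
From Stdlib Require Import Arith Ranalysis5 Lra Lia ClassicalEpsilon.
Open Scope R_scope.

(** Equivalence is up to smooth changes of coordinates, so leading terms do not suffice: all of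
    t^(p+1) W(t) must become a smooth function of x = t^p and y = t^(p+1). For p = 2 it is y W_0(x)
    + x^2 W_1(x). For p = 3 it is y W_0(x) + t^5 W_1(x) + x^2 W_2(x); if W'(0) = 0 then W_1 = x V
    and the middle term is y^2 V(x). Inverting the plane map then means solving a quadratic equation
    in y with parameter x. In the family, apart from G = G_t = 0, everything known at (0, t0) is an
    open sign condition. All of them hold on one square in (s, t), and the rest is a sign argument
    on that square, uniform in s. G_s is non-zero by transversality: an isometry and a
    reparametrization phi multiply G by det phi'^6, and V is a hypersurface, so when the
    t-derivative of its equation vanishes the s-derivative cannot. One vertex is inward and one
    outward because curvature * curvature'' has the sign of P q G', where P q keeps its sign and G'
    has opposite signs at the two zeros. *)

(** * Functions of class C^n on open subsets of the plane *)

Definition open2 (U : R -> R -> Prop) : Prop := forall x y, U x y -> locally_2d U x y.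

Lemma locally_2d_imp (P Q : R -> R -> Prop) x y :
  (forall u v, P u v -> Q u v) -> locally_2d P x y -> locally_2d Q x y.
Proof. intros H. now apply locally_2d_impl, locally_2d_forall. Qed.

Lemma Rmult_neq_0 (x y : R) : x <> 0 -> y <> 0 -> x * y <> 0.
Proof. apply Rmult_integral_contrapositive_currified. Qed.

Lemma is_derive_Rconst (c x : R) : is_derive (fun _ => c) x 0.
Proof. apply (is_derive_const (K := R_AbsRing) (V := R_NormedModule)). Qed.

Lemma is_derive_Rid (x : R) : is_derive (fun u => u) x 1.
Proof. apply (is_derive_id (K := R_AbsRing)). Qed.

Lemma is_derive_Rplus (f g : R -> R) x df dg : is_derive f x df -> is_derive g x dg ->
  is_derive (fun z => f z + g z) x (df + dg).
Proof. apply (is_derive_plus (K := R_AbsRing) (V := R_NormedModule)). Qed.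

(** Class C^n on U. The partial derivatives are existential witnesses rather than [Derive] terms, so
    that the sum, product and chain rules go by induction on n with explicit formulas. *)
Fixpoint C2 (U : R -> R -> Prop) (n : nat) (F : R -> R -> R) : Prop :=
  (forall x y, U x y -> continuity_2d_pt F x y) /\
  match n with
  | O => True
  | S m => exists Fx Fy : R -> R -> R,
      (forall x y, U x y -> is_derive (fun z => F z y) x (Fx x y)) /\
      (forall x y, U x y -> is_derive (fun z => F x z) y (Fy x y)) /\
      C2 U m Fx /\ C2 U m Fy
  end.

Lemma C2_continuity U n F x y : C2 U n F -> U x y -> continuity_2d_pt F x y.
Proof. destruct n; intros [H _]; auto. Qed.

Lemma C2_sub (U V : R -> R -> Prop) n F :
  (forall x y, V x y -> U x y) -> C2 U n F -> C2 V n F.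
Proof.
  intros HUV; revert F; induction n; intros F.
  - intros [H _]; split; auto.
  - intros [H [Fx [Fy [Hx [Hy [Hcx Hcy]]]]]]; split; [auto|].
    exists Fx, Fy; split; [|split; [|split]]; auto.
Qed.

Lemma C2_S U n F : C2 U (S n) F -> C2 U n F.
Proof.
  revert F; induction n; intros F.
  - intros [H _]; split; auto.
  - intros [H [Fx [Fy [Hx [Hy [Hcx Hcy]]]]]]; split; [auto|].
    exists Fx, Fy; split; [|split; [|split]]; auto.
Qed.

Lemma C2_ext U n F G : open2 U -> (forall x y, U x y -> F x y = G x y) ->
  C2 U n F -> C2 U n G.
Proof.
  intros HU HFG H.
  assert (Hc : forall x y, U x y -> continuity_2d_pt G x y).
  { intros x y Hxy. apply (continuity_2d_pt_ext_loc F).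
    - apply locally_2d_impl with (2 := HU _ _ Hxy).
      apply locally_2d_forall; auto.
    - eapply C2_continuity; eauto. }
  destruct n; (split; [exact Hc|]); [exact I|].
  destruct H as [_ [Fx [Fy [Hx [Hy Hr]]]]].
  exists Fx, Fy; split; [|split; [|exact Hr]]; intros x y Hxy.
  - apply (is_derive_ext_loc (fun z => F z y)); [|auto].
    apply filter_imp with (2 := locally_2d_1d_const_y _ _ _ (HU _ _ Hxy)); auto.
  - apply (is_derive_ext_loc (fun z => F x z)); [|auto].
    apply filter_imp with (2 := locally_2d_1d_const_x _ _ _ (HU _ _ Hxy)); auto.
Qed.

Lemma C2_const U n c : C2 U n (fun _ _ => c).
Proof.
  revert c; induction n; intros c;
    (split; [intros; apply continuity_2d_pt_const|]); [exact I|].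
  exists (fun _ _ => 0), (fun _ _ => 0); split; [|split; [|split]]; auto; intros;
    apply is_derive_Rconst.
Qed.

Lemma C2_id1 U n : C2 U n (fun x _ => x).
Proof.
  destruct n; (split; [intros; apply continuity_2d_pt_id1|]); [exact I|].
  exists (fun _ _ => 1), (fun _ _ => 0); split; [|split; [|split]]; try apply C2_const; intros.
  - apply is_derive_Rid.
  - apply is_derive_Rconst.
Qed.

Lemma C2_id2 U n : C2 U n (fun _ y => y).
Proof.
  destruct n; (split; [intros; apply continuity_2d_pt_id2|]); [exact I|].
  exists (fun _ _ => 0), (fun _ _ => 1); split; [|split; [|split]]; try apply C2_const; intros.
  - apply is_derive_Rconst.
  - apply is_derive_Rid.
Qed.

Lemma C2_plus U n F G : C2 U n F -> C2 U n G -> C2 U n (fun x y => F x y + G x y).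
Proof.
  revert F G; induction n; intros F G HF HG;
    (split; [intros x y Hxy; apply continuity_2d_pt_plus; eapply C2_continuity; eauto|]);
    [exact I|].
  destruct HF as [_ [Fx [Fy [H1 [H2 [H3 H4]]]]]].
  destruct HG as [_ [Gx [Gy [H5 [H6 [H7 H8]]]]]].
  exists (fun x y => Fx x y + Gx x y), (fun x y => Fy x y + Gy x y).
  split; [|split; [|split]]; auto; intros x y Hxy.
  - apply (is_derive_Rplus); auto.
  - apply (is_derive_Rplus); auto.
Qed.

Lemma is_derive_Rmult (f g : R -> R) x df dg :
  is_derive f x df -> is_derive g x dg ->
  is_derive (fun z => f z * g z) x (df * g x + f x * dg).
Proof.
  intros Hf Hg. apply (is_derive_mult f g x df dg Hf Hg).
  intros; apply Rmult_comm.
Qed.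

Lemma is_derive_Rcomp (f g : R -> R) x df dg :
  is_derive f (g x) df -> is_derive g x dg ->
  is_derive (fun z => f (g z)) x (df * dg).
Proof.
  intros Hf Hg. rewrite Rmult_comm. apply (is_derive_comp f g x df dg Hf Hg).
Qed.

Lemma C2_mult U n F G : C2 U n F -> C2 U n G -> C2 U n (fun x y => F x y * G x y).
Proof.
  revert F G; induction n; intros F G HF HG;
    (split; [intros x y Hxy; apply continuity_2d_pt_mult; eapply C2_continuity; eauto|]);
    [exact I|].
  pose proof (C2_S _ _ _ HF) as HF'; pose proof (C2_S _ _ _ HG) as HG'.
  destruct HF as [_ [Fx [Fy [H1 [H2 [H3 H4]]]]]].
  destruct HG as [_ [Gx [Gy [H5 [H6 [H7 H8]]]]]].
  exists (fun x y => Fx x y * G x y + F x y * Gx x y),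
    (fun x y => Fy x y * G x y + F x y * Gy x y).
  split; [|split; [|split]]; try (apply C2_plus; apply IHn; auto); intros x y Hxy.
  - apply (is_derive_Rmult (fun z => F z y) (fun z => G z y)); auto.
  - apply (is_derive_Rmult (fun z => F x z) (fun z => G x z)); auto.
Qed.

Lemma differentiable_pt_lim_partials F Fx dy x y :
  locally_2d (fun u v => is_derive (fun z => F z v) u (Fx u v)) x y ->
  is_derive (fun z => F x z) y dy -> continuity_2d_pt Fx x y ->
  differentiable_pt_lim F x y (Fx x y) dy.
Proof.
  intros H1 H2 H3. apply filterdiff_differentiable_pt_lim.
  apply (is_derive_filterdiff F x y Fx dy).
  - apply locally_2d_locally in H1. exact H1.
  - exact H2.
  - apply continuity_2d_pt_filterlim in H3. exact H3.
Qed.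

Lemma is_derive_comp_2d (F : R -> R -> R) Fx dy (g h : R -> R) t dg dh :
  locally_2d (fun u v => is_derive (fun z => F z v) u (Fx u v)) (g t) (h t) ->
  is_derive (fun z => F (g t) z) (h t) dy -> continuity_2d_pt Fx (g t) (h t) ->
  is_derive g t dg -> is_derive h t dh ->
  is_derive (fun z => F (g z) (h z)) t (Fx (g t) (h t) * dg + dy * dh).
Proof.
  intros H1 H2 H3 Hg Hh. apply is_derive_Reals.
  apply derivable_pt_lim_comp_2d; try now apply is_derive_Reals.
  now apply differentiable_pt_lim_partials.
Qed.

Lemma continuity_2d_pt_comp2 F G H x y :
  continuity_2d_pt F (G x y) (H x y) -> continuity_2d_pt G x y ->
  continuity_2d_pt H x y -> continuity_2d_pt (fun u v => F (G u v) (H u v)) x y.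
Proof.
  intros HF HG HH eps. destruct (HF eps) as [d Hd].
  generalize (locally_2d_and _ _ _ _ (HG d) (HH d)).
  apply locally_2d_imp. intros u v [A B]; auto.
Qed.

Lemma C2_comp U V n F G H : open2 V ->
  (forall x y, U x y -> V (G x y) (H x y)) ->
  C2 V n F -> C2 U n G -> C2 U n H -> C2 U n (fun x y => F (G x y) (H x y)).
Proof.
  intros HV HUV; revert F G H HUV; induction n; intros F G H HUV HF HG HH;
    (split; [intros x y Hxy; apply continuity_2d_pt_comp2; eapply C2_continuity; eauto|]);
    [exact I|].
  pose proof (C2_S _ _ _ HG) as HG'; pose proof (C2_S _ _ _ HH) as HH'.
  destruct HF as [_ [Fx [Fy [F1 [F2 [F3 F4]]]]]].
  destruct HG as [_ [Gx [Gy [G1 [G2 [G3 G4]]]]]].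
  destruct HH as [_ [Hx [Hy [H1 [H2 [H3 H4]]]]]].
  exists (fun x y => Fx (G x y) (H x y) * Gx x y + Fy (G x y) (H x y) * Hx x y),
    (fun x y => Fx (G x y) (H x y) * Gy x y + Fy (G x y) (H x y) * Hy x y).
  assert (HFl : forall x y, U x y -> locally_2d (fun u v => is_derive (fun z => F z v) u (Fx u v)) (G x y) (H x y)).
  { intros x y Hxy. generalize (HV _ _ (HUV _ _ Hxy)).
    apply locally_2d_imp; auto. }
  split; [|split; [|split]]; try (apply C2_plus; apply C2_mult; auto); intros x y Hxy.
  - apply (is_derive_comp_2d F Fx _ (fun z => G z y) (fun z => H z y)); auto.
    eapply C2_continuity; eauto.
  - apply (is_derive_comp_2d F Fx _ (fun z => G x z) (fun z => H x z)); auto.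
    eapply C2_continuity; eauto.
Qed.

Lemma C2_partial_x U n F : open2 U -> C2 U (S n) F ->
  C2 U n (fun x y => Derive (fun z => F z y) x).
Proof.
  intros HU [_ [Fx [Fy [H1 [H2 [H3 H4]]]]]].
  apply (C2_ext U n Fx); auto. intros x y Hxy.
  symmetry; apply is_derive_unique; auto.
Qed.

Lemma C2_partial_y U n F : open2 U -> C2 U (S n) F ->
  C2 U n (fun x y => Derive (fun z => F x z) y).
Proof.
  intros HU [_ [Fx [Fy [H1 [H2 [H3 H4]]]]]].
  apply (C2_ext U n Fy); auto. intros x y Hxy.
  symmetry; apply is_derive_unique; auto.
Qed.

(** Openness of U makes the witnesses agree with [Derive] near each point, so the existential form
    and Coquelicot's pointwise one coincide. *)
Lemma C2_ex_diff_n U n F : open2 U ->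
  (C2 U n F <-> forall x y, U x y -> ex_diff_n F n x y).
Proof.
  intros HU; revert F; induction n; intros F; split.
  - intros [H _] x y Hxy; split; auto.
  - intros H; split; [|exact I]. intros x y Hxy; now apply H.
  - intros H x y Hxy.
    pose proof (C2_partial_x _ _ _ HU H) as Hpx.
    pose proof (C2_partial_y _ _ _ HU H) as Hpy.
    apply IHn with (x := x) (y := y) in Hpx; auto.
    apply IHn with (x := x) (y := y) in Hpy; auto.
    destruct H as [Hc [Fx [Fy [H1 [H2 _]]]]].
    split; [auto|split; [|split; [|split]]]; auto; eexists; [apply H1|apply H2]; auto.
  - intros H; split; [intros x y Hxy; now apply (H x y)|].
    exists (fun x y => Derive (fun z => F z y) x), (fun x y => Derive (fun z => F x z) y).
    split; [|split; [|split]].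
    + intros x y Hxy; apply Derive_correct; now apply (H x y).
    + intros x y Hxy; apply Derive_correct; now apply (H x y).
    + apply IHn. intros x y Hxy; now apply (H x y).
    + apply IHn. intros x y Hxy; now apply (H x y).
Qed.

(** * Germs of smooth functions *)

Lemma open2_locally (P : R -> R -> Prop) x y : locally_2d P x y ->
  exists U, open2 U /\ U x y /\ forall u v, U u v -> P u v.
Proof.
  intros [d Hd]. exists (fun u v => Rabs (u - x) < d /\ Rabs (v - y) < d).
  split; [|split].
  - intros u v [Hu Hv].
    assert (He : 0 < Rmin (d - Rabs (u - x)) (d - Rabs (v - y))) by (apply Rmin_pos; lra).
    exists (mkposreal _ He). simpl. intros u' v' Hu' Hv'.
    pose proof (Rmin_l (d - Rabs (u - x)) (d - Rabs (v - y))).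
    pose proof (Rmin_r (d - Rabs (u - x)) (d - Rabs (v - y))).
    split; [replace (u' - x) with ((u' - u) + (u - x)) by ring
           |replace (v' - y) with ((v' - v) + (v - y)) by ring];
      eapply Rle_lt_trans; try apply Rabs_triang; lra.
  - rewrite !Rminus_diag, Rabs_R0. split; apply cond_pos.
  - intros u v [Hu Hv]; auto.
Qed.

Lemma smooth2_C2 F x y : smooth2 F x y <->
  exists U, open2 U /\ U x y /\ forall n, C2 U n F.
Proof.
  split.
  - intros H. destruct (open2_locally _ _ _ H) as [U [HU [Hxy HUP]]].
    exists U; repeat split; auto. intros n. apply C2_ex_diff_n; auto.
  - intros [U [HU [Hxy Hn]]]. generalize (HU _ _ Hxy).
    apply locally_2d_imp. intros u v Huv n.
    eapply C2_ex_diff_n; eauto.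
Qed.

Lemma open2_and (U V : R -> R -> Prop) :
  open2 U -> open2 V -> open2 (fun x y => U x y /\ V x y).
Proof. intros HU HV x y [A B]. apply locally_2d_and; auto. Qed.

Lemma smooth2_binop (op : (R -> R -> R) -> (R -> R -> R) -> R -> R -> R) F G x y :
  (forall U n F G, C2 U n F -> C2 U n G -> C2 U n (op F G)) ->
  smooth2 F x y -> smooth2 G x y -> smooth2 (op F G) x y.
Proof.
  intros Hop HF HG. apply smooth2_C2 in HF as [U [HU [HUx HF]]].
  apply smooth2_C2 in HG as [V [HV [HVx HG]]].
  apply smooth2_C2. exists (fun x y => U x y /\ V x y).
  repeat split; auto using open2_and. intros n. apply Hop.
  - eapply C2_sub; [|apply HF]; simpl; tauto.
  - eapply C2_sub; [|apply HG]; simpl; tauto.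
Qed.

Lemma smooth2_plus F G x y : smooth2 F x y -> smooth2 G x y ->
  smooth2 (fun u v => F u v + G u v) x y.
Proof. apply smooth2_binop with (op := fun F G u v => F u v + G u v), C2_plus. Qed.

Lemma smooth2_mult F G x y : smooth2 F x y -> smooth2 G x y ->
  smooth2 (fun u v => F u v * G u v) x y.
Proof. apply smooth2_binop with (op := fun F G u v => F u v * G u v), C2_mult. Qed.

Lemma smooth2_const c x y : smooth2 (fun _ _ => c) x y.
Proof.
  apply smooth2_C2. exists (fun _ _ => True); repeat split.
  - intros u v _; now apply locally_2d_forall.
  - intros; apply C2_const.
Qed.

Lemma smooth2_id1 x y : smooth2 (fun u _ => u) x y.
Proof.
  apply smooth2_C2. exists (fun _ _ => True); repeat split.
  - intros u v _; now apply locally_2d_forall.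
  - intros; apply C2_id1.
Qed.

Lemma smooth2_id2 x y : smooth2 (fun _ v => v) x y.
Proof.
  apply smooth2_C2. exists (fun _ _ => True); repeat split.
  - intros u v _; now apply locally_2d_forall.
  - intros; apply C2_id2.
Qed.

Lemma smooth2_continuity F x y : smooth2 F x y -> continuity_2d_pt F x y.
Proof.
  intros H; apply smooth2_C2 in H as [U [HU [HUx HF]]].
  apply (C2_continuity U 0); auto.
Qed.

Lemma smooth2_locally F x y : smooth2 F x y -> locally_2d (smooth2 F) x y.
Proof.
  intros H; apply smooth2_C2 in H as [U [HU [HUx HF]]].
  generalize (HU _ _ HUx). apply locally_2d_imp.
  intros u v Huv. apply smooth2_C2. exists U; auto.
Qed.

Lemma smooth2_comp F G H x y : smooth2 F (G x y) (H x y) ->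
  smooth2 G x y -> smooth2 H x y -> smooth2 (fun u v => F (G u v) (H u v)) x y.
Proof.
  intros HF HG HH. apply smooth2_C2 in HF as [U [HU [HUx HF]]].
  assert (Hl : locally_2d (fun u v => smooth2 G u v /\ smooth2 H u v /\ U (G u v) (H u v)) x y).
  { destruct (HU _ _ HUx) as [d Hd].
    pose proof (smooth2_continuity _ _ _ HG d) as K1.
    pose proof (smooth2_continuity _ _ _ HH d) as K2.
    generalize (locally_2d_and _ _ _ _ (locally_2d_and _ _ _ _ K1 K2)
      (locally_2d_and _ _ _ _ (smooth2_locally _ _ _ HG) (smooth2_locally _ _ _ HH))).
    apply locally_2d_imp. intros u v [[A B] [C D]]; auto. }
  apply open2_locally in Hl as [W [HW [HWx HWP]]].
  apply smooth2_C2. exists W; repeat split; auto. intros n.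
  apply (C2_comp W U); auto.
  - intros u v Huv; now apply HWP.
  - apply C2_ex_diff_n; auto. intros u v Huv.
    apply HWP in Huv as [A _]. now apply locally_2d_singleton in A.
  - apply C2_ex_diff_n; auto. intros u v Huv.
    apply HWP in Huv as [_ [A _]]. now apply locally_2d_singleton in A.
Qed.

Lemma smooth2_ext F G x y : locally_2d (fun u v => F u v = G u v) x y ->
  smooth2 F x y -> smooth2 G x y.
Proof.
  intros HFG HF. assert (Hl := locally_2d_and _ _ _ _ HFG HF).
  apply open2_locally in Hl as [W [HW [HWx HWP]]].
  apply smooth2_C2. exists W; repeat split; auto. intros n.
  apply (C2_ext W n F); auto.
  - intros u v Huv; now apply HWP.
  - apply C2_ex_diff_n; auto. intros u v Huv; now apply HWP.
Qed.

Lemma smooth2_partial_x F x y : smooth2 F x y ->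
  smooth2 (fun u v => Derive (fun z => F z v) u) x y.
Proof.
  intros H; apply smooth2_C2 in H as [U [HU [HUx HF]]].
  apply smooth2_C2. exists U; repeat split; auto. intros n; now apply C2_partial_x.
Qed.

Lemma smooth2_partial_y F x y : smooth2 F x y ->
  smooth2 (fun u v => Derive (fun z => F u z) v) x y.
Proof.
  intros H; apply smooth2_C2 in H as [U [HU [HUx HF]]].
  apply smooth2_C2. exists U; repeat split; auto. intros n; now apply C2_partial_y.
Qed.

Lemma smooth2_is_derive_x F x y : smooth2 F x y ->
  is_derive (fun z => F z y) x (Derive (fun z => F z y) x).
Proof. intros H. apply locally_2d_singleton in H. apply Derive_correct, (H 1%nat). Qed.

Lemma smooth2_is_derive_y F x y : smooth2 F x y ->
  is_derive (fun z => F x z) y (Derive (fun z => F x z) y).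
Proof. intros H. apply locally_2d_singleton in H. apply Derive_correct, (H 1%nat). Qed.

Lemma Derive_n_S (f : R -> R) n : Derive_n (Derive f) n = Derive_n f (S n).
Proof.
  induction n; [reflexivity|]. cbn [Derive_n] in *. now rewrite IHn.
Qed.

Lemma C2_ex_derive_n U n (f : R -> R) : open2 U -> C2 U n (fun u _ => f u) ->
  forall x y, U x y -> ex_derive_n f n x.
Proof.
  intros HU; revert f; induction n; intros f Hf x y Hxy; [exact I|].
  pose proof (C2_partial_x _ _ _ HU Hf) as Hp.
  pose proof (IHn (Derive f) Hp x y Hxy) as H.
  destruct n; [|change (ex_derive (Derive_n (Derive f) n) x) in H; rewrite Derive_n_S in H; exact H].
  destruct Hf as [_ [Fx [Fy [H1 _]]]]. exists (Fx x y). now apply H1.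
Qed.

(** A function of one variable is treated as one of two variables that ignores the second; all
    closure properties of [smooth1] are then inherited from the plane. *)
Lemma smooth1_smooth2 f x y : smooth1 f x <-> smooth2 (fun u _ => f u) x y.
Proof.
  split.
  - intros [d Hd]. apply smooth2_C2.
    exists (fun u _ => Rabs (u - x) < d). split; [|split].
    + intros u v Hu. assert (He : 0 < d - Rabs (u - x)) by lra.
      exists (mkposreal _ He). simpl. intros u' v' Hu' _.
      replace (u' - x) with ((u' - u) + (u - x)) by ring.
      eapply Rle_lt_trans; [apply Rabs_triang|lra].
    + rewrite Rminus_diag, Rabs_R0. apply cond_pos.
    + assert (K : forall n k, C2 (fun u _ => Rabs (u - x) < d) n (fun u _ => Derive_n f k u)).
      { assert (D : forall u k, Rabs (u - x) < d -> is_derive (Derive_n f k) u (Derive_n f (S k) u)).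
        { intros u k Hu. apply Derive_correct, (Hd u Hu (S k)). }
        induction n; intros k;
        (split; [intros u v Hu; apply (continuity_1d_2d_pt_comp (Derive_n f k) (fun u _ => u));
           [apply derivable_continuous_pt; exists (Derive_n f (S k) u); apply is_derive_Reals; auto|apply continuity_2d_pt_id1]|]);
        [exact I|].
        exists (fun u _ => Derive_n f (S k) u), (fun _ _ => 0).
        split; [|split; [|split]]; auto using C2_const.
        intros u v _; apply is_derive_Rconst. }
      intros n. apply (K n O).
  - intros H; apply smooth2_C2 in H as [U [HU [HUx HF]]].
    apply filter_imp with (2 := locally_2d_1d_const_y _ _ _ (HU _ _ HUx)).
    intros u Hu n. now apply (C2_ex_derive_n U n f HU (HF n) u y).
Qed.

Lemma smooth2_comp1 f G x y : smooth1 f (G x y) -> smooth2 G x y ->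
  smooth2 (fun u v => f (G u v)) x y.
Proof.
  intros Hf HG. apply (smooth2_comp (fun u _ => f u) G (fun _ _ => 0)); auto.
  - now apply smooth1_smooth2.
  - apply smooth2_const.
Qed.

Lemma smooth1_comp_2d F g h t : smooth2 F (g t) (h t) -> smooth1 g t -> smooth1 h t ->
  smooth1 (fun u => F (g u) (h u)) t.
Proof.
  intros HF Hg Hh. apply smooth1_smooth2 with (y := 0).
  apply (smooth2_comp F (fun u _ => g u) (fun u _ => h u)); auto;
    now apply smooth1_smooth2.
Qed.

Lemma smooth1_comp f g t : smooth1 f (g t) -> smooth1 g t -> smooth1 (fun u => f (g u)) t.
Proof.
  intros Hf Hg. apply smooth1_smooth2 with (y := 0).
  apply (smooth2_comp1 f (fun u _ => g u)); auto. now apply smooth1_smooth2.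
Qed.

Lemma smooth1_const c t : smooth1 (fun _ => c) t.
Proof. apply smooth1_smooth2 with (y := 0), smooth2_const. Qed.

Lemma smooth1_id t : smooth1 (fun u => u) t.
Proof. apply smooth1_smooth2 with (y := 0), smooth2_id1. Qed.

Lemma smooth1_plus f g t : smooth1 f t -> smooth1 g t -> smooth1 (fun u => f u + g u) t.
Proof.
  intros Hf Hg. apply smooth1_smooth2 with (y := 0).
  apply (smooth2_plus (fun u _ => f u) (fun u _ => g u)); now apply smooth1_smooth2.
Qed.

Lemma smooth1_mult f g t : smooth1 f t -> smooth1 g t -> smooth1 (fun u => f u * g u) t.
Proof.
  intros Hf Hg. apply smooth1_smooth2 with (y := 0).
  apply (smooth2_mult (fun u _ => f u) (fun u _ => g u)); now apply smooth1_smooth2.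
Qed.

Lemma smooth1_slice_y F x y : smooth2 F x y -> smooth1 (F x) y.
Proof.
  intros H. apply (smooth1_comp_2d F (fun _ => x) (fun v => v)); auto using smooth1_const, smooth1_id.
Qed.

Lemma smooth1_slice_x F x y : smooth2 F x y -> smooth1 (fun z => F z y) x.
Proof.
  intros H. apply (smooth1_comp_2d F (fun v => v) (fun _ => y)); auto using smooth1_const, smooth1_id.
Qed.

Lemma smooth1_ext f g t : locally t (fun u => f u = g u) -> smooth1 f t -> smooth1 g t.
Proof.
  unfold smooth1. intros Hfg Hf. apply locally_locally in Hfg.
  generalize (filter_and _ _ Hfg Hf). apply filter_imp.
  intros u [A B] n. now apply (ex_derive_n_ext_loc f g n u).
Qed.

Lemma smooth1_locally f t : smooth1 f t -> locally t (smooth1 f).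
Proof. unfold smooth1. apply locally_locally. Qed.

Lemma smooth1_Derive f t : smooth1 f t -> smooth1 (Derive f) t.
Proof.
  unfold smooth1. apply filter_imp. intros u H n. destruct n; [exact I|].
  change (ex_derive (Derive_n (Derive f) n) u). rewrite Derive_n_S. apply (H (S (S n))).
Qed.

Lemma smooth1_is_derive f t : smooth1 f t -> is_derive f t (Derive f t).
Proof. intros H. apply locally_singleton in H. apply Derive_correct, (H 1%nat). Qed.

Lemma smooth1_continuity f t : smooth1 f t -> continuity_pt f t.
Proof.
  intros H. apply derivable_continuous_pt. exists (Derive f t).
  now apply is_derive_Reals, smooth1_is_derive.
Qed.

Lemma smooth1_continuous f t : smooth1 f t -> continuous f t.
Proof. intros H. now apply continuity_pt_filterlim, smooth1_continuity. Qed.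

(** A class of functions closed under derivation on U consists of smooth functions. This settles the
    cases where no derivative is simpler than the function, but all have a common shape: integrals
    with a parameter, exp(-1/x), series, and functions of x^(1/p). *)
Lemma smooth1_coind (P : (R -> R) -> Prop) (U : R -> Prop) :
  open U ->
  (forall f, P f -> exists g, P g /\ forall x, U x -> is_derive f x (g x)) ->
  forall f, P f -> forall x, U x -> smooth1 f x.
Proof.
  intros HU HP.
  assert (K : forall n f, P f -> exists g, P g /\ forall x, U x -> Derive_n f n x = g x).
  { induction n; intros f Hf.
    - exists f; auto.
    - destruct (IHn f Hf) as [g [Hg Hfg]]. destruct (HP g Hg) as [h [Hh Hgh]].
      exists h; split; auto. intros x Hx. simpl.
      rewrite (Derive_ext_loc _ g); [now apply is_derive_unique, Hgh|].
      apply filter_imp with (2 := HU x Hx); auto. }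
  intros f Hf x Hx. apply filter_imp with (2 := HU x Hx). intros u Hu n.
  destruct n; [exact I|]. destruct (K n f Hf) as [g [Hg Hfg]].
  destruct (HP g Hg) as [h [Hh Hgh]].
  exists (h u). apply (is_derive_ext_loc g); [|auto].
  apply filter_imp with (2 := HU u Hu). intros; symmetry; auto.
Qed.

Lemma smooth1_inv x : x <> 0 -> smooth1 Rinv x.
Proof.
  intros Hx. apply smooth1_smooth2 with (y := 0). apply smooth2_C2.
  exists (fun u _ => u <> 0).
  assert (HU : open2 (fun u _ => u <> 0)).
  { intros u v Hu. apply continuity_2d_pt_neq_0; auto. apply continuity_2d_pt_id1. }
  split; [exact HU|split; [exact Hx|]].
  induction n; (split; [intros u v Hu; apply (continuity_2d_pt_inv (fun u _ => u)); auto; apply continuity_2d_pt_id1|]);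
    [exact I|].
  (* The derivative is a product of copies of the function itself, so the induction hypothesis
     applies to it. *)
  exists (fun u _ => (-1) * (/ u * / u)), (fun _ _ => 0).
  split; [|split; [|split]]; auto using C2_const.
  - intros u v Hu. auto_derive; auto. field; auto.
  - intros; apply is_derive_Rconst.
  - apply C2_mult; [apply C2_const|]. now apply C2_mult.
Qed.

Lemma smooth1_exp x : smooth1 exp x.
Proof.
  apply (smooth1_coind (fun f => f = exp) (fun _ => True)); auto.
  - apply open_true.
  - intros f ->. exists exp; split; auto. intros; apply is_derive_exp.
Qed.

Lemma smooth1_ln x : 0 < x -> smooth1 ln x.
Proof.
  intros Hx. apply smooth1_smooth2 with (y := 0). apply smooth2_C2.
  exists (fun u _ => 0 < u).
  assert (HU : open2 (fun u _ => 0 < u)).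
  { intros u v Hu. exists (mkposreal _ Hu). simpl; intros u' v' Hu' _.
    apply Rabs_lt_between in Hu'; lra. }
  split; [exact HU|split; [exact Hx|]].
  intros n; destruct n; (split; [intros u v Hu; apply (continuity_1d_2d_pt_comp ln (fun u _ => u)); [|apply continuity_2d_pt_id1];
     apply derivable_continuous_pt; exists (/ u); now apply derivable_pt_lim_ln|]); [exact I|].
  exists (fun u _ => / u), (fun _ _ => 0).
  split; [|split; [|split]]; auto using C2_const.
  - intros u v Hu. now apply is_derive_Reals, derivable_pt_lim_ln.
  - intros; apply is_derive_Rconst.
  - apply C2_ex_diff_n; auto. intros u v Hu.
    assert (Hu' : u <> 0) by lra.
    pose proof (smooth1_inv u Hu') as K. apply (smooth1_smooth2 _ _ v) in K.
    now apply locally_2d_singleton in K.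
Qed.

Lemma smooth1_opp f t : smooth1 f t -> smooth1 (fun u => - f u) t.
Proof.
  intros H. apply (smooth1_ext (fun u => (-1) * f u)).
  - apply filter_forall; intros; ring.
  - apply smooth1_mult; auto using smooth1_const.
Qed.

Lemma smooth1_minus f g t : smooth1 f t -> smooth1 g t -> smooth1 (fun u => f u - g u) t.
Proof. intros Hf Hg. apply smooth1_plus; auto using smooth1_opp. Qed.

Lemma smooth1_div f g t : smooth1 f t -> smooth1 g t -> g t <> 0 -> smooth1 (fun u => f u / g u) t.
Proof.
  intros Hf Hg H. apply smooth1_mult; auto.
  apply (smooth1_comp Rinv); auto using smooth1_inv.
Qed.

Lemma smooth1_pow f n t : smooth1 f t -> smooth1 (fun u => f u ^ n) t.
Proof.
  intros Hf; induction n; simpl; auto using smooth1_const, smooth1_mult.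
Qed.

Lemma smooth1_Rpower a x : 0 < x -> smooth1 (fun u => Rpower u a) x.
Proof.
  intros Hx. unfold Rpower. apply (smooth1_comp exp); [apply smooth1_exp|].
  apply smooth1_mult; auto using smooth1_const, smooth1_ln.
Qed.

Lemma smooth1_sqrt x : 0 < x -> smooth1 sqrt x.
Proof.
  intros Hx. apply (smooth1_ext (fun u => Rpower u (/ 2))); [|now apply smooth1_Rpower].
  exists (mkposreal _ Hx). intros u Hu. apply Rpower_sqrt.
  apply Rabs_lt_between in Hu. simpl in Hu. unfold minus, plus, opp in Hu; simpl in Hu. lra.
Qed.

Lemma smooth2_opp F x y : smooth2 F x y -> smooth2 (fun u v => - F u v) x y.
Proof.
  intros H. apply (smooth2_ext (fun u v => (-1) * F u v)).
  - apply locally_2d_forall; intros; ring.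
  - apply smooth2_mult; auto using smooth2_const.
Qed.

Lemma smooth2_minus F G x y : smooth2 F x y -> smooth2 G x y -> smooth2 (fun u v => F u v - G u v) x y.
Proof. intros Hf Hg. apply smooth2_plus; auto using smooth2_opp. Qed.

Lemma smooth2_div F G x y : smooth2 F x y -> smooth2 G x y -> G x y <> 0 -> smooth2 (fun u v => F u v / G u v) x y.
Proof.
  intros Hf Hg H. apply smooth2_mult; auto.
  apply (smooth2_comp1 Rinv); auto using smooth1_inv.
Qed.

Lemma smooth2_pow F n x y : smooth2 F x y -> smooth2 (fun u v => F u v ^ n) x y.
Proof.
  intros Hf; induction n; simpl; auto using smooth2_const, smooth2_mult.
Qed.

Create HintDb smooth.
#[export] Hint Resolve smooth1_const smooth1_id smooth1_plus smooth1_mult smooth1_opp smooth1_minus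
  smooth1_div smooth1_pow smooth2_const smooth2_id1 smooth2_id2 smooth2_plus smooth2_mult
  smooth2_opp smooth2_minus smooth2_div smooth2_pow : smooth.

(** * Hadamard's lemma with weights *)

(** Integral form of a quotient: if f'(t) = t^k g(t), then f(t) - f(0) is t^(k+1) times this
    integral. *)
Definition had (k : nat) (g : R -> R) (t : R) : R := RInt (fun u => u ^ k * g (u * t)) 0 1.

Lemma had_arg u t d : 0 <= u <= 1 -> Rabs t < d -> Rabs (u * t) < d.
Proof.
  intros Hu Ht. rewrite Rabs_mult, (Rabs_pos_eq u) by lra.
  pose proof (Rabs_pos t). nra.
Qed.

Lemma had_ex_RInt k g d t : (forall t, Rabs t < d -> smooth1 g t) -> Rabs t < d ->
  ex_RInt (fun u => u ^ k * g (u * t)) 0 1.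
Proof.
  intros Hg Ht. apply (ex_RInt_continuous (V := R_CompleteNormedModule)).
  intros u Hu. rewrite Rmin_left, Rmax_right in Hu by lra.
  apply smooth1_continuous. apply smooth1_mult; [auto with smooth|].
  apply (smooth1_comp g); auto with smooth. apply Hg. now apply had_arg.
Qed.

(** Differentiation under the integral sign brings down one factor u, so the functions [had k g]
    form a class closed under derivation, as [smooth1_coind] requires. *)
Lemma is_derive_had k g d t : (forall t, Rabs t < d -> smooth1 g t) -> Rabs t < d ->
  is_derive (had k g) t (had (S k) (Derive g) t).
Proof.
  intros Hg Ht.
  assert (Hl : locally t (fun y => Rabs y < d)).
  { apply (locally_open (fun y => Rabs y < d) (fun y => Rabs y < d)); auto.
    apply (open_comp Rabs (fun y => y < d)); [|apply open_lt].
    intros; apply continuous_Rabs. }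
  assert (Hd : forall y u, Rabs y < d -> 0 <= u <= 1 ->
    is_derive (fun z => u ^ k * g (u * z)) y (u ^ S k * Derive g (u * y))).
  { intros y u Hy Hu. pose proof (smooth1_is_derive g (u * y) (Hg _ (had_arg _ _ _ Hu Hy))) as HD.
    evar_last. apply is_derive_scal.
    apply (is_derive_Rcomp g (fun z => u * z)); [exact HD|].
    apply (is_derive_scal (fun z => z)), is_derive_Rid.
    unfold scal; simpl; unfold mult, one; simpl; ring. }
  evar_last.
  - apply (is_derive_RInt_param (fun t u => u ^ k * g (u * t)) 0 1 t).
    + apply filter_imp with (2 := Hl). intros y Hy u Hu.
      rewrite Rmin_left, Rmax_right in Hu by lra.
      eexists; now apply Hd.
    + intros u Hu. rewrite Rmin_left, Rmax_right in Hu by lra.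
      apply (continuity_2d_pt_ext_loc (fun y v => v ^ S k * Derive g (v * y))).
      * assert (HS : smooth2 (fun y v => g (v * y)) t u).
        { apply (smooth2_comp1 g (fun y v => v * y)); auto with smooth.
          apply Hg, had_arg; auto. }
        generalize (smooth2_locally _ _ _ HS). apply locally_2d_impl.
        assert (HS2 : smooth2 (fun y v => Derive g (v * y)) t u).
        { apply (smooth2_comp1 (Derive g) (fun y v => v * y)); auto with smooth.
          apply smooth1_Derive, Hg, had_arg; auto. }
        assert (HG : locally_2d (fun y v => smooth1 g (v * y)) t u).
        { assert (HG1 := smooth1_locally _ _ (Hg _ (had_arg _ _ _ Hu Ht))).
          destruct HG1 as [e He].
          assert (C : continuity_2d_pt (fun y v => v * y) t u)
            by (apply smooth2_continuity; auto with smooth).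
          generalize (C e). apply locally_2d_imp.
          intros; now apply He. }
        generalize HG; apply locally_2d_imp.
        intros y v Hs _. symmetry. apply is_derive_unique.
        evar_last. apply is_derive_scal.
        apply (is_derive_Rcomp g (fun z => v * z)); [now apply smooth1_is_derive|].
        apply (is_derive_scal (fun z => z)), is_derive_Rid.
        unfold scal; simpl; unfold mult, one; simpl; ring.
      * apply smooth2_continuity. apply smooth2_mult; [auto with smooth|].
        apply (smooth2_comp1 (Derive g) (fun y v => v * y)); auto with smooth.
        apply smooth1_Derive, Hg, had_arg; auto.
    + apply filter_imp with (2 := Hl). intros y Hy. now apply (had_ex_RInt k g d).
  - apply RInt_ext. intros u Hu. rewrite Rmin_left, Rmax_right in Hu by lra.
    apply is_derive_unique, Hd; auto; lra.
Qed.

Lemma smooth1_had k g d t : (forall t, Rabs t < d -> smooth1 g t) -> Rabs t < d ->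
  smooth1 (had k g) t.
Proof.
  intros Hg. revert t.
  apply (smooth1_coind (fun f => exists k g, f = had k g /\ forall t, Rabs t < d -> smooth1 g t)
    (fun t => Rabs t < d)); [| |now exists k, g].
  - apply (open_comp Rabs (fun y => y < d)); [|apply open_lt].
    intros; apply continuous_Rabs.
  - intros f [k' [g' [-> Hg']]]. exists (had (S k') (Derive g')). split.
    + exists (S k'), (Derive g'); split; auto. intros; apply smooth1_Derive; auto.
    + intros; eapply is_derive_had; eauto.
Qed.

(** Besides a smooth quotient, the value h(0) is recorded: it provides the leading coefficients of
    the two components of the evolute at a vertex. *)
Lemma hadamard k (f g : R -> R) : smooth1 g 0 ->
  locally 0 (fun t => is_derive f t (t ^ k * g t)) ->
  exists h, smooth1 h 0 /\ h 0 = g 0 / INR (S k) /\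
    locally 0 (fun t => f t = f 0 + t ^ S k * h t).
Proof.
  intros Hg Hf. apply smooth1_locally in Hg.
  destruct (filter_and _ _ Hg Hf) as [d Hd].
  assert (Hd' : forall t, Rabs t < d -> smooth1 g t /\ is_derive f t (t ^ k * g t)).
  { intros t Ht. apply Hd. unfold ball; simpl; unfold AbsRing_ball, abs, minus, plus, opp; simpl.
    now rewrite Ropp_0, Rplus_0_r. }
  assert (Hs : forall t, Rabs t < d -> smooth1 g t) by (intros; now apply Hd').
  exists (had k g). split; [|split].
  - apply (smooth1_had k g d); auto. rewrite Rabs_R0; apply cond_pos.
  - unfold had. rewrite (RInt_ext (V := R_CompleteNormedModule) _ (fun u => scal (g 0) (u ^ k))).
    2:{ intros; unfold scal; simpl; unfold mult; simpl. rewrite Rmult_0_r; ring. }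
    rewrite (RInt_scal (V := R_CompleteNormedModule)).
    2:{ apply (ex_RInt_continuous (V := R_CompleteNormedModule)). intros; apply smooth1_continuous; auto with smooth. }
    unfold scal; simpl; unfold mult; simpl.
    replace (RInt (fun u => u ^ k) 0 1) with (/ INR (S k)); [reflexivity|].
    symmetry. apply is_RInt_unique. evar_last.
    + apply (is_RInt_derive (fun u => u ^ S k / INR (S k)) (fun u => u ^ k)).
      * intros u _. apply (is_derive_ext (fun u => / INR (S k) * u ^ S k)); [intros; apply Rmult_comm|].
        evar_last. apply is_derive_scal, (is_derive_pow (fun u => u)), is_derive_Rid.
        change (@one R_AbsRing) with 1. cbn [pred]. field. apply not_0_INR; lia.
      * intros; apply smooth1_continuous; auto with smooth.
    + rewrite pow1, pow_i by lia. change (1 / INR (S k) + - (0 / INR (S k)) = / INR (S k)).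
      field. apply not_0_INR; lia.
  - exists d. intros t Ht.
    assert (Ht' : Rabs t < d).
    { unfold ball in Ht; simpl in Ht; unfold AbsRing_ball, abs, minus, plus, opp in Ht; simpl in Ht.
      now rewrite Ropp_0, Rplus_0_r in Ht. }
    unfold had. rewrite <- (RInt_scal (V := R_CompleteNormedModule)) by (now apply (had_ex_RInt k g d)).
    (* The derivative of f(u t) in u is t f'(u t) = t^(k+1) u^k g(u t). *)
    assert (HI : is_RInt (fun u => scal (t ^ S k) (u ^ k * g (u * t))) 0 1 (minus (f (1 * t)) (f (0 * t)))).
    { apply (is_RInt_derive (fun u => f (u * t))).
      - intros u Hu. rewrite Rmin_left, Rmax_right in Hu by lra.
        evar_last. apply (is_derive_Rcomp f (fun u => u * t)).
        apply Hd', had_arg; auto.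
        auto_derive; auto. unfold scal; simpl; unfold mult; simpl.
        rewrite Rpow_mult_distr. ring.
      - intros u Hu. rewrite Rmin_left, Rmax_right in Hu by lra.
        apply smooth1_continuous. unfold scal; simpl; unfold mult; simpl.
        assert (smooth1 (fun u => g (u * t)) u).
        { apply (smooth1_comp g); auto with smooth. apply Hs, had_arg; auto. }
        auto 10 with smooth. }
    apply (is_RInt_unique (V := R_CompleteNormedModule)) in HI.
    rewrite Rmult_1_l, Rmult_0_l in HI.
    rewrite (Rplus_comm (f 0)). apply Rminus_eq_reg_r with (f 0).
    rewrite Rplus_minus_r. symmetry. exact HI.
Qed.

Lemma hadamard0 (f : R -> R) : smooth1 f 0 ->
  exists h, smooth1 h 0 /\ h 0 = Derive f 0 /\ locally 0 (fun t => f t = f 0 + t * h t).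
Proof.
  intros Hf. destruct (hadamard 0 f (Derive f)) as [h [H1 [H2 H3]]].
  - now apply smooth1_Derive.
  - generalize (smooth1_locally _ _ Hf). apply filter_imp.
    intros t Ht. rewrite pow_O, Rmult_1_l. now apply smooth1_is_derive.
  - exists h; split; [|split]; auto.
    + rewrite H2. simpl; field.
    + generalize H3; apply filter_imp. intros t ->; ring.
Qed.

Lemma locally_abs (x : R) (d : R) (P : R -> Prop) :
  0 < d -> (forall y, Rabs (y - x) < d -> P y) -> locally x P.
Proof. intros Hd H. exists (mkposreal d Hd). intros y Hy. apply H. exact Hy. Qed.

(** A quadratic error bound is convenient at the junction point of piecewise definitions and for
    series, where such bounds can be summed. *)
Lemma is_derive_quadratic (F : R -> R) x l C :
  locally x (fun y => Rabs (F y - F x - (y - x) * l) <= C * (y - x) ^ 2) ->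
  is_derive F x l.
Proof.
  intros [d Hd]. apply is_derive_Reals. intros eps Heps.
  assert (HC : 0 < Rabs C + 1) by (pose proof (Rabs_pos C); lra).
  assert (Hm : 0 < Rmin d (eps / (Rabs C + 1))).
  { apply Rmin_pos; [apply cond_pos|]. now apply Rdiv_lt_0_compat. }
  exists (mkposreal _ Hm). simpl. intros h Hh Hhd.
  assert (H1 : Rabs h < d) by (eapply Rlt_le_trans; [exact Hhd|apply Rmin_l]).
  assert (H2 : Rabs h < eps / (Rabs C + 1)) by (eapply Rlt_le_trans; [exact Hhd|apply Rmin_r]).
  assert (H3 := Hd (x + h)).
  replace (x + h - x) with h in H3 by ring.
  assert (H4 : Rabs (F (x + h) - F x - h * l) <= C * h ^ 2).
  { apply H3. unfold ball; simpl; unfold AbsRing_ball, abs, minus, plus, opp; simpl.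
    now replace (x + h + - x) with h by ring. }
  replace ((F (x + h) - F x) / h - l) with ((F (x + h) - F x - h * l) * / h) by (field; auto).
  rewrite Rabs_mult, Rabs_inv.
  assert (Hh' : 0 < Rabs h) by now apply Rabs_pos_lt.
  apply (Rmult_lt_reg_r (Rabs h)); auto.
  rewrite Rmult_assoc, Rinv_l, Rmult_1_r by lra.
  eapply Rle_lt_trans; [exact H4|].
  rewrite <- (pow2_abs h).
  assert (C <= Rabs C) by apply Rle_abs.
  apply (Rmult_lt_compat_r (Rabs C + 1)) in H2; auto.
  unfold Rdiv in H2. rewrite Rmult_assoc, Rinv_l, Rmult_1_r in H2 by lra.
  nra.
Qed.

(** * A smooth bump function *)

(** The powers of 1/x are included because derivatives of exp(-1/x) produce them. *)
Definition expinv (k : nat) (x : R) : R :=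
  if Rlt_dec 0 x then (/ x) ^ k * exp (- / x) else 0.

Lemma expinv_pos k x : 0 < x -> expinv k x = (/ x) ^ k * exp (- / x).
Proof. intros H; unfold expinv; destruct (Rlt_dec 0 x); tauto. Qed.

Lemma expinv_neg k x : x <= 0 -> expinv k x = 0.
Proof. intros H; unfold expinv; destruct (Rlt_dec 0 x); auto; lra. Qed.

(** y^n / n! is a single term of the exponential series, all of whose terms are nonnegative. *)
Lemma pow_exp_bound n y : 0 <= y -> y ^ n <= INR (fact n) * exp y.
Proof.
  intros Hy. pose proof (exp_ge_taylor y n Hy) as H.
  assert (Hf : 0 < INR (fact n)) by apply INR_fact_lt_0.
  assert (H1 : y ^ n / INR (fact n) <= exp y).
  { eapply Rle_trans; [|exact H]. destruct n; [simpl; lra|].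
    rewrite tech5.
    assert (0 <= sum_f_R0 (fun k => y ^ k / INR (fact k)) n); [|lra].
    apply cond_pos_sum. intros k. apply Rdiv_le_0_compat; [now apply pow_le|apply INR_fact_lt_0]. }
  apply (Rmult_le_compat_l (INR (fact n))) in H1; [|lra].
  field_simplify in H1; lra.
Qed.

(** The bound y^(k+2) <= (k+2)! exp(y) at y = 1/x; the two extra powers become x^2, which is what
    differentiability at 0 needs. *)
Lemma expinv_bound k x : Rabs (expinv k x) <= INR (fact (k + 2)) * x ^ 2.
Proof.
  assert (Hf : 0 < INR (fact (k + 2))) by apply INR_fact_lt_0.
  destruct (Rlt_dec 0 x) as [Hx|Hx].
  - rewrite expinv_pos by auto. assert (Hi : 0 < / x) by now apply Rinv_0_lt_compat.
    rewrite Rabs_pos_eq.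
    2:{ apply Rmult_le_pos; [apply pow_le; lra|left; apply exp_pos]. }
    pose proof (pow_exp_bound (k + 2) (/ x) (Rlt_le _ _ Hi)) as H.
    rewrite exp_Ropp. rewrite pow_add in H.
    pose proof (exp_pos (/ x)) as He.
    replace ((/ x) ^ k * / exp (/ x)) with (((/ x) ^ k * (/ x) ^ 2) * (x ^ 2 / exp (/ x))) by (field; lra).
    apply Rle_trans with (INR (fact (k + 2)) * exp (/ x) * (x ^ 2 / exp (/ x))).
    + apply Rmult_le_compat_r; auto. apply Rdiv_le_0_compat; [nra|auto].
    + right; field; lra.
  - rewrite expinv_neg by lra. rewrite Rabs_R0. nra.
Qed.

Lemma is_derive_expinv k x : is_derive (expinv k) x (- INR k * expinv (S k) x + expinv (S (S k)) x).
Proof.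
  destruct (Rtotal_order x 0) as [Hx|[->|Hx]].
  - rewrite !expinv_neg by lra.
    apply (is_derive_ext_loc (fun _ => 0)).
    + apply (locally_abs x (- x)); [lra|]. intros y Hy. apply Rabs_lt_between in Hy.
      rewrite expinv_neg; lra.
    + evar_last. apply is_derive_Rconst.
      simpl; change (@zero R_NormedModule) with 0; ring.
  - rewrite !expinv_neg by lra. apply is_derive_quadratic with (INR (fact (k + 2))).
    apply filter_forall. intros y. rewrite (expinv_neg k 0) by lra.
    replace (expinv k y - 0 - (y - 0) * (- INR k * 0 + 0)) with (expinv k y) by ring.
    rewrite Rminus_0_r. apply expinv_bound.
  - rewrite !expinv_pos by auto.
    apply (is_derive_ext_loc (fun x => (/ x) ^ k * exp (- / x))).
    + apply (locally_abs x x); [lra|]. intros y Hy. apply Rabs_lt_between in Hy.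
      rewrite expinv_pos; lra.
    + assert (D : is_derive (fun x => / x) x (- / x * / x)).
      { auto_derive; [lra|]. field; lra. }
      evar_last. apply (is_derive_Rmult (fun x => (/ x) ^ k) (fun x => exp (- / x))).
      * apply (is_derive_pow (fun x => / x)), D.
      * apply (is_derive_Rcomp exp (fun x => - / x)); [apply is_derive_exp|].
        apply (is_derive_opp (fun x => / x)), D.
      * change (@opp R_NormedModule (- / x * / x)) with (- (- / x * / x)).
        destruct k; simpl pred; simpl pow; [simpl INR|]; ring.
Qed.

Inductive expinv_span : (R -> R) -> Prop :=
| span_expinv k : expinv_span (expinv k)
| span_lin a f g : expinv_span f -> expinv_span g -> expinv_span (fun x => a * f x + g x).

Lemma smooth1_expinv k x : smooth1 (expinv k) x.
Proof.
  apply (smooth1_coind expinv_span (fun _ => True)); auto using open_true, span_expinv.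
  induction 1 as [j|a f g Hf [f' [Hf1 Hf2]] Hg [g' [Hg1 Hg2]]].
  - exists (fun x => - INR j * expinv (S j) x + expinv (S (S j)) x). split.
    + apply span_lin; constructor.
    + intros; apply is_derive_expinv.
  - exists (fun x => a * f' x + g' x). split; [now constructor|].
    intros y _. apply (is_derive_Rplus (fun x => a * f x) g); auto.
    apply (is_derive_scal f); auto.
Qed.

Definition bump (x : R) : R :=
  expinv 0 (2 - x ^ 2) / (expinv 0 (2 - x ^ 2) + expinv 0 (x ^ 2 - 1)).

Lemma expinv0_pos x : 0 < x -> 0 < expinv 0 x.
Proof. intros H. rewrite expinv_pos by auto. simpl. rewrite Rmult_1_l. apply exp_pos. Qed.

Lemma expinv0_nonneg x : 0 <= expinv 0 x.
Proof.
  destruct (Rlt_dec 0 x); [left; now apply expinv0_pos|]. rewrite expinv_neg; lra.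
Qed.

(** The two arguments 2 - x^2 and x^2 - 1 add up to 1, so one of them is positive. *)
Lemma bump_denominator x : 0 < expinv 0 (2 - x ^ 2) + expinv 0 (x ^ 2 - 1).
Proof.
  pose proof (expinv0_nonneg (2 - x ^ 2)). pose proof (expinv0_nonneg (x ^ 2 - 1)).
  destruct (Rlt_dec 0 (2 - x ^ 2)) as [H1|H1].
  - pose proof (expinv0_pos _ H1); lra.
  - assert (H2 : 0 < x ^ 2 - 1) by lra. pose proof (expinv0_pos _ H2); lra.
Qed.

Lemma smooth1_bump x : smooth1 bump x.
Proof.
  assert (H1 : smooth1 (fun x => expinv 0 (2 - x ^ 2)) x).
  { apply (smooth1_comp (expinv 0)); [apply smooth1_expinv|auto with smooth]. }
  assert (H2 : smooth1 (fun x => expinv 0 (x ^ 2 - 1)) x).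
  { apply (smooth1_comp (expinv 0)); [apply smooth1_expinv|auto with smooth]. }
  apply smooth1_div; auto with smooth. pose proof (bump_denominator x); lra.
Qed.

Lemma bump_one x : Rabs x <= 1 -> bump x = 1.
Proof.
  intros Hx. assert (Hx2 : x ^ 2 <= 1) by (rewrite <- pow2_abs; pose proof (Rabs_pos x); nra).
  pose proof (bump_denominator x) as H.
  unfold bump in *. rewrite (expinv_neg 0 (x ^ 2 - 1)) in * by lra. field. lra.
Qed.

Lemma bump_zero x : 2 <= Rabs x -> bump x = 0.
Proof.
  intros Hx. assert (Hx2 : 2 <= x ^ 2) by (rewrite <- pow2_abs; nra).
  unfold bump. rewrite (expinv_neg 0 (2 - x ^ 2)) by lra. unfold Rdiv; ring.
Qed.

Lemma smooth1_ex_derive_n f n : (forall x, smooth1 f x) -> forall x, ex_derive_n f n x.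
Proof. intros H x. now apply (locally_singleton _ _ (H x)). Qed.

Lemma smooth1_Derive_n f n x : smooth1 f x -> smooth1 (Derive_n f n) x.
Proof. intros H; induction n; simpl; auto using smooth1_Derive. Qed.

Lemma compact_support_bound f : (forall x, continuity_pt f x) ->
  (forall x, 3 <= Rabs x -> f x = 0) -> exists M, 0 <= M /\ forall x, Rabs (f x) <= M.
Proof.
  intros Hc H0.
  destruct (continuity_ab_maj (fun x => Rabs (f x)) (-3) 3) as [m [Hm _]]; [lra| |].
  { intros c _. apply (continuity_pt_comp f Rabs); auto. apply Rcontinuity_abs. }
  exists (Rabs (f m)). split; [apply Rabs_pos|]. intros x.
  destruct (Rle_dec 3 (Rabs x)) as [H|H].
  - rewrite H0, Rabs_R0 by auto. apply Rabs_pos.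
  - apply Hm. apply Rnot_le_lt, Rabs_lt_between in H. lra.
Qed.

Lemma pow_bump_bound n k : exists M, 0 <= M /\
  forall x, Rabs (Derive_n (fun x => x ^ n * bump x) k x) <= M.
Proof.
  apply compact_support_bound.
  - intros x. apply smooth1_continuity, smooth1_Derive_n.
    apply smooth1_mult; auto with smooth. apply smooth1_bump.
  (* The bump vanishes for |y| >= 2; the bound 3 leaves a unit interval around x on which the
     function is 0, hence all its derivatives are. *)
  - intros x Hx. rewrite (Derive_n_ext_loc _ (fun _ => 0)).
    + destruct k; [reflexivity|apply Derive_n_const].
    + apply (locally_abs x 1); [lra|]. intros y Hy.
      rewrite bump_zero; [ring|]. pose proof (Rabs_triang (y - x) (x - y)) as T.
      pose proof (Rabs_triang_inv x (x - y)) as T2.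
      replace (x - (x - y)) with y in T2 by ring.
      rewrite Rabs_minus_sym in Hy. lra.
Qed.

(** * Borel's lemma and Taylor expansion with smooth remainder *)

Lemma ex_series_geom_bound (v : nat -> R) C : (forall n, Rabs (v n) <= C * (/ 2) ^ n) ->
  ex_series (fun n => Rabs (v n)).
Proof.
  intros H. apply (ex_series_le (K := R_AbsRing) (V := R_CompleteNormedModule) _ (fun n => C * (/ 2) ^ n)).
  - intros n. change (Rabs (Rabs (v n)) <= C * (/ 2) ^ n). now rewrite Rabs_Rabsolu.
  - apply (ex_series_scal_l C (fun n => (/ 2) ^ n)). apply ex_series_geom.
    rewrite Rabs_pos_eq; lra.
Qed.

Lemma Series_geom_bound (v : nat -> R) C : (forall n, Rabs (v n) <= C * (/ 2) ^ n) ->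
  Rabs (Series v) <= 2 * C.
Proof.
  intros H. pose proof (ex_series_geom_bound v C H) as Hex.
  eapply Rle_trans; [now apply Series_Rabs|].
  eapply Rle_trans.
  - apply (Series_le (fun n => Rabs (v n)) (fun n => C * (/ 2) ^ n)).
    + intros n; split; [apply Rabs_pos|apply H].
    + apply (ex_series_scal_l C (fun n => (/ 2) ^ n)). apply ex_series_geom.
      rewrite Rabs_pos_eq; lra.
  - rewrite Series_scal_l, Series_geom by (rewrite Rabs_pos_eq; lra). lra.
Qed.

(** The first-order Taylor errors of the terms are summed: being quadratic with geometric constants,
    they give a quadratic error for the sum. *)
Lemma is_derive_Series (v v' : nat -> R -> R) x C :
  (forall n y, Rabs (v n y) <= C * (/ 2) ^ n) ->
  (forall n, Rabs (v' n x) <= C * (/ 2) ^ n) ->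
  (forall n y, Rabs (v n y - v n x - (y - x) * v' n x) <= C * (y - x) ^ 2 * (/ 2) ^ n) ->
  is_derive (fun y => Series (fun n => v n y)) x (Series (fun n => v' n x)).
Proof.
  intros H1 H2 H3. apply is_derive_quadratic with (2 * C).
  apply filter_forall. intros y.
  assert (E1 : forall z, ex_series (fun n => v n z)).
  { intros z. apply ex_series_Rabs. apply (ex_series_geom_bound _ C); auto. }
  assert (E2 : ex_series (fun n => v' n x)).
  { apply ex_series_Rabs. apply (ex_series_geom_bound _ C); auto. }
  assert (E3 : ex_series (fun n => v n y - v n x)).
  { apply (ex_series_minus (fun n => v n y) (fun n => v n x)); auto. }
  assert (E4 : ex_series (fun n => (y - x) * v' n x)).
  { apply (ex_series_scal_l (y - x) (fun n => v' n x)); auto. }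
  rewrite <- Series_minus by auto. rewrite <- Series_scal_l.
  rewrite <- Series_minus by auto.
  eapply Rle_trans; [apply Series_geom_bound with (C := C * (y - x) ^ 2); auto|].
  right; ring.
Qed.

(** Two uses of the mean value theorem; the constant is C instead of C/2, which suffices. *)
Lemma taylor1_bound (f f1 f2 : R -> R) C x y :
  (forall z, is_derive f z (f1 z)) -> (forall z, is_derive f1 z (f2 z)) ->
  (forall z, Rabs (f2 z) <= C) -> Rabs (f y - f x - (y - x) * f1 x) <= C * (y - x) ^ 2.
Proof.
  intros H1 H2 H3.
  assert (Hc : forall g g1 z, (forall z : R, is_derive g z (g1 z)) -> continuity_pt g z).
  { intros g g1 z H. apply derivable_continuous_pt. exists (g1 z). now apply is_derive_Reals. }
  destruct (MVT_gen f x y f1) as [c [Hc1 Hc2]]; eauto.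
  destruct (MVT_gen f1 x c f2) as [e [He1 He2]]; eauto.
  rewrite Hc2. replace (f1 c * (y - x) - (y - x) * f1 x) with ((f1 c - f1 x) * (y - x)) by ring.
  rewrite He2, !Rabs_mult. rewrite <- (pow2_abs (y - x)).
  assert (Rabs (c - x) <= Rabs (y - x)).
  { destruct (Rle_dec x y) as [L|L].
    - rewrite Rmin_left, Rmax_right in Hc1 by lra. rewrite !Rabs_pos_eq; lra.
    - rewrite Rmin_right, Rmax_left in Hc1 by lra. rewrite !Rabs_left1; lra. }
  pose proof (H3 e) as He. pose proof (Rabs_pos (f2 e)). pose proof (Rabs_pos (c - x)).
  replace (C * Rabs (y - x) ^ 2) with (C * Rabs (y - x) * Rabs (y - x)) by ring.
  apply Rmult_le_compat_r; [apply Rabs_pos|]. apply Rmult_le_compat; auto.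
Qed.

Lemma finite_bound (b : nat -> R) K : exists C, 1 <= C /\ forall k, (k < K)%nat -> b k <= C.
Proof.
  induction K as [|K [C [HC IH]]].
  - exists 1; split; [lra|]. intros; lia.
  - exists (Rmax C (b K)). split; [eapply Rle_trans; [exact HC|apply Rmax_l]|].
    intros k Hk. destruct (Nat.eq_dec k K) as [->|]; [apply Rmax_r|].
    eapply Rle_trans; [apply IH; lia|apply Rmax_l].
Qed.

(** This is a x^n bump(l x), written through l x so that the k-th derivative is visibly of size
    l^(k-n): for k < n a large l makes it small. *)
Definition cut_monomial (a : R) (l : R) (n : nat) (x : R) : R :=
  a * (/ l) ^ n * ((l * x) ^ n * bump (l * x)).

Lemma smooth1_cut_monomial a l n x : smooth1 (cut_monomial a l n) x.
Proof.
  apply smooth1_mult; [auto with smooth|].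
  apply smooth1_mult; [auto with smooth|]. apply (smooth1_comp bump); auto using smooth1_bump with smooth.
Qed.

Lemma Derive_n_cut_monomial a l n k x :
  Derive_n (cut_monomial a l n) k x =
  a * (/ l) ^ n * (l ^ k * Derive_n (fun y => y ^ n * bump y) k (l * x)).
Proof.
  unfold cut_monomial. rewrite (Derive_n_scal_l (fun x => (l * x) ^ n * bump (l * x))). f_equal.
  apply (Derive_n_comp_scal (fun y => y ^ n * bump y)).
  apply filter_forall. intros y j _. apply smooth1_ex_derive_n.
  intros z. apply smooth1_mult; auto using smooth1_bump with smooth.
Qed.

Lemma Derive_n_cut_monomial_0 a l n k : 1 <= l ->
  Derive_n (cut_monomial a l n) k 0 = if Nat.eq_dec k n then INR (fact k) * a else 0.
Proof.
  intros Hl.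
  assert (HD : forall k, locally 0 (fun x => Derive_n (cut_monomial a l n) k x =
     if le_dec k n then a * (INR (fact n) / INR (fact (n - k)) * x ^ (n - k)) else 0)).
  { assert (Hl0 : 0 < / l) by (apply Rinv_0_lt_compat; lra).
    intros j. apply (locally_abs 0 (/ l)); [auto|]. intros y Hy.
    rewrite Rminus_0_r in Hy.
    rewrite (Derive_n_ext_loc _ (fun x => a * x ^ n)).
    2:{ apply (locally_abs y (/ l - Rabs y)); [lra|]. intros z Hz. unfold cut_monomial.
        rewrite bump_one.
        - rewrite Rpow_mult_distr, pow_inv. field; try split; try apply pow_nonzero; lra.
        - rewrite Rabs_mult, (Rabs_pos_eq l) by lra.
          assert (Rabs z <= / l).
          { replace z with ((z - y) + y) by ring. eapply Rle_trans; [apply Rabs_triang|lra]. }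
          apply (Rmult_le_compat_l l) in H; [|lra]. rewrite Rinv_r in H; lra. }
    rewrite Derive_n_scal_l. destruct (le_dec j n) as [Hj|Hj].
    - rewrite Derive_n_pow_smalli by lia. ring.
    - rewrite Derive_n_pow_bigi by lia. ring. }
  rewrite (locally_singleton _ _ (HD k)).
  destruct (le_dec k n), (Nat.eq_dec k n); try lia; auto.
  - subst. rewrite Nat.sub_diag. simpl. field.
  - rewrite pow_i by lia. ring.
Qed.

(** The function is the sum of the monomials a_n x^n, the n-th cut off at scale 1/l_n, with l_n so
    large that every differentiated series is dominated by a geometric one. *)
Theorem borel (a : nat -> R) : exists G : R -> R,
  (forall x, smooth1 G x) /\ forall k, Derive_n G k 0 = INR (fact k) * a k.
Proof.
  destruct (choice (fun (nk : nat * nat) M => 0 <= M /\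
    forall x, Rabs (Derive_n (fun x => x ^ fst nk * bump x) (snd nk) x) <= M)) as [M HM].
  { intros [n k]; apply pow_bump_bound. }
  (* Only orders k < n are constrained here; they are finitely many, so one l_n serves them all. *)
  destruct (choice (fun n l => 1 <= l /\ forall k, (k < n)%nat ->
     Rabs (a n) * M (n, k) <= l * (/ 2) ^ n)) as [l Hl].
  { intros n. destruct (finite_bound (fun k => Rabs (a n) * M (n, k) * 2 ^ n) n) as [C [HC1 HC2]].
    exists C; split; auto. intros k Hk. specialize (HC2 k Hk).
    assert (H2 : 0 < 2 ^ n) by (apply pow_lt; lra).
    apply (Rmult_le_compat_r ((/ 2) ^ n)) in HC2; [|apply pow_le; lra].
    rewrite Rmult_assoc, <- Rpow_mult_distr, Rinv_r, pow1, Rmult_1_r in HC2 by lra. exact HC2. }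
  set (u := fun n => cut_monomial (a n) (l n) n).
  (* For fixed k the finitely many terms n <= k are absorbed into C; for n > k the choice of l_n
     gives the bound 2^(-n). *)
  assert (HB : forall k, exists C, forall n x, Rabs (Derive_n (u n) k x) <= C * (/ 2) ^ n).
  { intros k.
    destruct (finite_bound (fun n => Rabs (a n) * (/ l n) ^ n * (l n ^ k * M (n, k)) * 2 ^ n) (S k)) as [C [HC1 HC2]].
    exists C. intros n x. unfold u. rewrite Derive_n_cut_monomial.
    destruct (Hl n) as [Hl1 Hl2]. destruct (HM (n, k)) as [HM1 HM2]. simpl in HM2.
    specialize (HM2 (l n * x)).
    assert (Hli : 0 < / l n) by (apply Rinv_0_lt_compat; lra).
    assert (HP : 0 <= (/ l n) ^ n) by (apply pow_le; lra).
    assert (HP2 : 0 <= l n ^ k) by (apply pow_le; lra).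
    rewrite !Rabs_mult, (Rabs_pos_eq _ HP), (Rabs_pos_eq _ HP2).
    apply Rle_trans with (Rabs (a n) * (/ l n) ^ n * (l n ^ k * M (n, k))).
    { apply Rmult_le_compat_l; [apply Rmult_le_pos; auto using Rabs_pos|].
      now apply Rmult_le_compat_l. }
    destruct (le_lt_dec n k) as [Hnk|Hnk].
    - assert (Hn : (n < S k)%nat) by lia. specialize (HC2 n Hn).
      apply (Rmult_le_compat_r ((/ 2) ^ n)) in HC2; [|apply pow_le; lra].
      rewrite (Rmult_assoc _ (2 ^ n)), <- Rpow_mult_distr, Rinv_r, pow1, Rmult_1_r in HC2 by lra.
      exact HC2.
    - specialize (Hl2 k Hnk).
      apply Rle_trans with (Rabs (a n) * M (n, k) * / l n).
      (* For n > k the factor l^(k-n) is at most 1/l, since l >= 1. *)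
      + assert (HE : (/ l n) ^ n = (/ l n) ^ (n - k - 1) * ((/ l n) ^ k * / l n)).
        { transitivity ((/ l n) ^ ((n - k - 1) + (k + 1))); [f_equal; lia|].
          now rewrite !pow_add, pow_1. }
        rewrite HE.
        assert (H1 : (/ l n) ^ (n - k - 1) <= 1).
        { rewrite <- (pow1 (n - k - 1)). apply pow_incr. split; [lra|].
          rewrite <- Rinv_1. apply Rinv_le_contravar; lra. }
        assert (H2 : (/ l n) ^ k * l n ^ k = 1).
        { rewrite <- Rpow_mult_distr, Rinv_l, pow1; lra. }
        replace (Rabs (a n) * ((/ l n) ^ (n - k - 1) * ((/ l n) ^ k * / l n)) * (l n ^ k * M (n, k)))
          with ((/ l n) ^ (n - k - 1) * (Rabs (a n) * M (n, k) * / l n * ((/ l n) ^ k * l n ^ k))) by ring.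
        rewrite H2, Rmult_1_r. rewrite <- Rmult_1_l. apply Rmult_le_compat_r; auto.
        apply Rmult_le_pos; [|lra]. apply Rmult_le_pos; auto using Rabs_pos.
      + apply (Rmult_le_compat_r (/ l n)) in Hl2; [|lra].
        replace (l n * (/ 2) ^ n * / l n) with ((/ 2) ^ n) in Hl2 by (field; lra).
        eapply Rle_trans; [exact Hl2|].
        rewrite <- (Rmult_1_l ((/ 2) ^ n)) at 1. apply Rmult_le_compat_r; [apply pow_le; lra|auto]. }
  set (G := fun k x => Series (fun n => Derive_n (u n) k x)).
  assert (Hu : forall n k x, is_derive (Derive_n (u n) k) x (Derive_n (u n) (S k) x)).
  { intros n k x. apply smooth1_is_derive, smooth1_Derive_n, smooth1_cut_monomial. }
  assert (HG : forall k x, is_derive (G k) x (G (S k) x)).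
  { intros k x. destruct (HB k) as [C0 HC0], (HB (S k)) as [C1 HC1], (HB (S (S k))) as [C2 HC2].
    assert (Hp : forall n, 0 <= (/ 2) ^ n) by (intros; apply pow_le; lra).
    set (C := Rmax C0 (Rmax C1 C2)).
    assert (K0 : C0 <= C) by apply Rmax_l.
    assert (K1 : C1 <= C) by (eapply Rle_trans; [apply Rmax_l|apply Rmax_r]).
    assert (K2 : C2 <= C) by (eapply Rle_trans; [apply Rmax_r|apply Rmax_r]).
    apply (is_derive_Series (fun n => Derive_n (u n) k) (fun n => Derive_n (u n) (S k)) x C).
    - intros n y. eapply Rle_trans; [apply HC0|]. now apply Rmult_le_compat_r.
    - intros n. eapply Rle_trans; [apply HC1|]. now apply Rmult_le_compat_r.
    - intros n y. eapply Rle_trans.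
      + apply (taylor1_bound (Derive_n (u n) k) (Derive_n (u n) (S k)) (Derive_n (u n) (S (S k))) (C2 * (/ 2) ^ n)); auto.
      + replace (C * (y - x) ^ 2 * (/ 2) ^ n) with (C * (/ 2) ^ n * (y - x) ^ 2) by ring.
        apply Rmult_le_compat_r; [apply pow2_ge_0|]. now apply Rmult_le_compat_r. }
  exists (G O). split.
  - intros x. apply (smooth1_coind (fun f => exists k, f = G k) (fun _ => True)); auto using open_true; [|now exists O].
    intros f [k ->]. exists (G (S k)). split; [now exists (S k)|]. auto.
  - intros k.
    assert (HDG : forall x, Derive_n (G O) k x = G k x).
    { induction k; intros x; [reflexivity|]. simpl.
      rewrite (Derive_ext _ (G k)) by auto. now apply is_derive_unique. }
    rewrite HDG. unfold G.
    rewrite (Series_ext _ (fun n => if Nat.eq_dec n k then INR (fact k) * a k else 0)).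
    2:{ intros n. unfold u. rewrite Derive_n_cut_monomial_0 by apply Hl.
        destruct (Nat.eq_dec k n), (Nat.eq_dec n k); try lia; congruence. }
    apply is_series_unique.
    (* At 0 only the term n = k survives, so the partial sums are constant from index k on. *)
    assert (HL : is_lim_seq (sum_n (fun n => if Nat.eq_dec n k then INR (fact k) * a k else 0)) (INR (fact k) * a k)); [|exact HL].
    apply (is_lim_seq_ext_loc (fun _ => INR (fact k) * a k)); [|apply is_lim_seq_const].
    exists k. intros n Hn. symmetry.
    induction Hn as [|n Hn IH].
    + clear. destruct k; [rewrite sum_O; simpl; reflexivity|].
      rewrite sum_Sn, sum_n_ext_loc with (b := fun _ => 0).
      * rewrite sum_n_const, Rmult_0_r. destruct (Nat.eq_dec (S k) (S k)); [|lia].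
        unfold plus; simpl; ring.
      * intros j Hj. destruct (Nat.eq_dec j (S k)); [lia|auto].
    + rewrite sum_Sn, IH. destruct (Nat.eq_dec (S n) k); [lia|]. unfold plus; simpl; ring.
Qed.

Fixpoint psum (c : nat -> R) (n : nat) (x : R) : R :=
  match n with O => 0 | S m => psum c m x + c m * x ^ m end.

Lemma psum_0 c n : psum c (S n) 0 = c O.
Proof.
  induction n; [simpl; ring|]. change (psum c (S n) 0 + c (S n) * 0 ^ S n = c O).
  rewrite IHn, pow_i by lia. ring.
Qed.

Lemma psum_ext c d n x : (forall k, c k = d k) -> psum c n x = psum d n x.
Proof. intros H; induction n; simpl; congruence. Qed.

Lemma is_derive_psum c n x :
  is_derive (psum c (S n)) x (psum (fun k => INR (S k) * c (S k)) n x).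
Proof.
  induction n.
  - apply (is_derive_ext (fun _ => c O)); [intros; simpl; ring|].
    apply is_derive_Rconst.
  - apply (is_derive_Rplus (psum c (S n)) (fun x => c (S n) * x ^ S n)); auto.
    evar_last. apply is_derive_scal, (is_derive_pow (fun u => u)), is_derive_Rid.
    change (@one R_AbsRing) with 1. cbn [pred]. ring.
Qed.

(** Induction on N through f', followed by Hadamard's lemma. The remainder is a smooth multiple of
    x^N, not just a small quantity, so it can be differentiated and composed. *)
Lemma taylor_smooth N f : smooth1 f 0 -> exists r, smooth1 r 0 /\
  locally 0 (fun x => f x = psum (fun k => Derive_n f k 0 / INR (fact k)) N x + x ^ N * r x).
Proof.
  revert f; induction N; intros f Hf.
  - exists f; split; auto. apply filter_forall. intros; simpl; ring.
  - destruct (IHN (Derive f) (smooth1_Derive _ _ Hf)) as [r [Hr1 Hr2]].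
    set (c := fun k => Derive_n f k 0 / INR (fact k)).
    destruct (hadamard N (fun x => f x - psum c (S N) x) r) as [h [Hh1 [_ Hh2]]]; auto.
    + generalize (filter_and _ _ (smooth1_locally _ _ Hf) Hr2). apply filter_imp.
      intros x [Hx1 Hx2].
      evar_last. apply (is_derive_minus f (psum c (S N))); [now apply smooth1_is_derive|apply is_derive_psum].
      unfold minus, plus, opp; simpl. rewrite Hx2.
      rewrite (psum_ext (fun k => INR (S k) * c (S k)) (fun k => Derive_n (Derive f) k 0 / INR (fact k))); [ring|].
      intros k. unfold c. rewrite Derive_n_S, fact_simpl, mult_INR.
      pose proof (INR_fact_neq_0 k). pose proof (not_0_INR (S k) (Nat.neq_succ_0 k)).
      field; auto.
    + exists h; split; auto. revert Hh2; apply filter_imp. intros x Hx.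
      rewrite psum_0 in Hx. unfold c at 2 in Hx. simpl in Hx |- *. fold c. lra.
Qed.

(** * Flat functions *)

(** Vanishing of the whole Taylor series, phrased as divisibility by every power with a smooth
    quotient; this form passes easily to derivatives and to quotients by t^k. *)
Definition flat (F : R -> R) : Prop :=
  smooth1 F 0 /\ forall N, exists r, smooth1 r 0 /\ locally 0 (fun t => F t = t ^ N * r t).

Lemma flat_Derive F : flat F -> flat (Derive F).
Proof.
  intros [H1 H2]; split; [now apply smooth1_Derive|]. intros N.
  destruct (H2 (S N)) as [r [Hr1 Hr2]].
  exists (fun t => INR (S N) * r t + t * Derive r t). split.
  - pose proof (smooth1_Derive _ _ Hr1); auto with smooth.
  - apply locally_locally in Hr2. generalize (filter_and _ _ (smooth1_locally _ _ Hr1) Hr2).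
    apply filter_imp. intros t [A B]. rewrite (Derive_ext_loc _ _ _ B).
    apply is_derive_unique. evar_last.
    + apply (is_derive_Rmult (fun t => t ^ S N) r); [|now apply smooth1_is_derive].
      apply (is_derive_pow (fun u => u)), is_derive_Rid.
    + change (@one R_AbsRing) with 1. cbn [pred]. simpl pow. ring.
Qed.

(** The value 0 at 0 is the smooth continuation when F is flat. *)
Definition divpow (k : nat) (F : R -> R) (t : R) : R :=
  if Req_EM_T t 0 then 0 else F t / t ^ k.

Lemma flat_divpow k F : flat F -> flat (divpow k F).
Proof.
  intros [H1 H2].
  assert (K : forall N, exists r, smooth1 r 0 /\ locally 0 (fun t => divpow k F t = t ^ N * (t * r t))).
  { intros N. destruct (H2 (N + 1 + k)%nat) as [r [Hr1 Hr2]]. exists r; split; auto.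
    revert Hr2; apply filter_imp. intros t Ht. unfold divpow.
    destruct (Req_EM_T t 0) as [->|Ht0]; [ring|].
    rewrite Ht, !pow_add, pow_1. field. now apply pow_nonzero. }
  split.
  - destruct (K O) as [r [Hr1 Hr2]]. apply (smooth1_ext (fun t => t ^ 0 * (t * r t))).
    + revert Hr2; apply filter_imp; auto.
    + auto with smooth.
  - intros N. destruct (K N) as [r [Hr1 Hr2]]. exists (fun t => t * r t); split; auto with smooth.
Qed.

Lemma divpow_mult k F t : F 0 = 0 -> (0 < k)%nat -> t ^ k * divpow k F t = F t.
Proof.
  intros H0 Hk. unfold divpow. destruct (Req_EM_T t 0) as [->|Ht].
  - rewrite pow_i by auto. lra.
  - field. now apply pow_nonzero.
Qed.

Lemma locally_opp P : locally 0 P -> locally 0 (fun t => P (- t)).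
Proof.
  intros [d Hd]. apply (locally_abs 0 d); [apply cond_pos|]. intros y Hy. apply Hd.
  unfold ball; simpl; unfold AbsRing_ball, abs, minus, plus, opp; simpl.
  rewrite Rminus_0_r in Hy. now rewrite Ropp_0, Rplus_0_r, Rabs_Ropp.
Qed.

Lemma smooth1_comp_opp f t : smooth1 f (- t) -> smooth1 (fun u => f (- u)) t.
Proof. intros H. apply (smooth1_comp f); auto with smooth. Qed.

Lemma flat_opp F : flat F -> flat (fun t => F (- t)).
Proof.
  intros [H1 H2]; split.
  - apply smooth1_comp_opp. now rewrite Ropp_0.
  - intros N. destruct (H2 N) as [r [Hr1 Hr2]]. exists (fun t => (-1) ^ N * r (- t)). split.
    + apply smooth1_mult; auto with smooth. apply smooth1_comp_opp. now rewrite Ropp_0.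
    + generalize (locally_opp _ Hr2). apply filter_imp. intros t ->.
      rewrite <- Rmult_assoc, <- Rpow_mult_distr. do 2 f_equal. ring.
Qed.

Lemma flat_0 F : flat F -> F 0 = 0.
Proof.
  intros [_ H]. destruct (H 1%nat) as [r [_ Hr]]. apply locally_singleton in Hr.
  rewrite Hr. ring.
Qed.

Section Root.

Variable p : nat.
Hypothesis Hp : (0 < p)%nat.

Definition proot (x : R) : R := Rpower x (/ INR p).

(** F(x^(1/p)) on the positive half-line, continued by 0, which is smooth for flat F. *)
Definition root_fun (F : R -> R) (x : R) : R := if Rlt_dec 0 x then F (proot x) else 0.

Lemma INR_p : 0 < INR p.
Proof. now apply lt_0_INR. Qed.

Lemma proot_pos x : 0 < proot x.
Proof. apply exp_pos. Qed.

Lemma proot_pow x : 0 < x -> proot x ^ p = x.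
Proof.
  intros Hx. pose proof INR_p. rewrite <- Rpower_pow by apply proot_pos.
  unfold proot. rewrite Rpower_mult, Rinv_l by lra. now apply Rpower_1.
Qed.

Lemma pow_proot t : 0 < t -> proot (t ^ p) = t.
Proof.
  intros Ht. pose proof INR_p. unfold proot. rewrite <- Rpower_pow by auto.
  rewrite Rpower_mult, Rinv_r by lra. now apply Rpower_1.
Qed.

Lemma proot_lt x d : 0 < x -> 0 < d -> x < d ^ p -> proot x < d.
Proof.
  intros Hx Hd H. apply Rnot_le_lt. intros K.
  assert (d ^ p <= proot x ^ p) by (apply pow_incr; lra).
  rewrite proot_pow in *; lra.
Qed.

Lemma is_derive_proot x : 0 < x -> is_derive proot x (/ INR p * / proot x ^ (p - 1)).
Proof.
  intros Hx. evar_last. apply is_derive_Reals, derivable_pt_lim_power; auto.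
  f_equal. apply Rmult_eq_reg_r with (proot x ^ (p - 1)).
  2:{ apply pow_nonzero. pose proof (proot_pos x); lra. }
  rewrite Rinv_l by (apply pow_nonzero; pose proof (proot_pos x); lra).
  rewrite <- Rpower_pow by apply proot_pos. unfold proot.
  rewrite Rpower_mult, <- Rpower_plus. rewrite minus_INR by lia. simpl INR.
  replace (/ INR p - 1 + / INR p * (INR p - 1)) with 0.
  - now apply Rpower_O.
  - field. pose proof INR_p; lra.
Qed.

(** The derivative of F(x^(1/p)) is F1(x^(1/p)) with F1(t) = F'(t) / (p t^(p-1)), and F1 is flat
    again: flatness absorbs the singularity of the root, and the class is closed under
    derivation. *)
Lemma smooth1_root_fun F : flat F -> smooth1 (root_fun F) 0.
Proof.
  intros HF. pose proof INR_p as HpR. destruct (smooth1_locally _ _ (proj1 HF)) as [d Hd].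
  assert (Hs : forall t, Rabs t < d -> smooth1 F t).
  { intros t Ht. apply Hd. unfold ball; simpl; unfold AbsRing_ball, abs, minus, plus, opp; simpl.
    now rewrite Ropp_0, Rplus_0_r. }
  clear Hd. pose proof (cond_pos d) as Hdp.
  apply (smooth1_coind (fun f => exists F, f = root_fun F /\ flat F /\ forall t, Rabs t < d -> smooth1 F t)
    (fun x => x < d ^ p)).
  - apply open_lt.
  - clear F HF Hs. intros f [F [-> [HF Hs]]].
    set (F1 := fun t => / INR p * divpow (p - 1) (Derive F) t).
    exists (root_fun F1). split.
    + exists F1. split; [reflexivity|]. split.
      * pose proof (flat_divpow (p - 1) _ (flat_Derive _ HF)) as [K1 K2]. split.
        -- apply smooth1_mult; auto with smooth.
        -- intros N. destruct (K2 N) as [r [Hr1 Hr2]]. exists (fun t => / INR p * r t).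
           split; auto with smooth. revert Hr2; apply filter_imp. intros t Ht.
           unfold F1; rewrite Ht; ring.
      * intros t Ht. apply smooth1_mult; [auto with smooth|].
        destruct (Req_EM_T t 0) as [->|Ht0].
        -- apply flat_divpow, flat_Derive, HF.
        -- apply (smooth1_ext (fun t => Derive F t / t ^ (p - 1))).
           ++ apply (locally_abs t (Rabs t)); [now apply Rabs_pos_lt|].
              intros y Hy. unfold divpow. destruct (Req_EM_T y 0) as [->|]; auto.
              rewrite Rminus_0_l, Rabs_Ropp in Hy. lra.
           ++ apply smooth1_div; auto using smooth1_Derive with smooth. now apply pow_nonzero.
    + intros x Hx. destruct (Rtotal_order x 0) as [Hx0|[->|Hx0]].
      * replace (root_fun F1 x) with 0.
        2:{ unfold root_fun; destruct (Rlt_dec 0 x); auto; lra. }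
        apply (is_derive_ext_loc (fun _ => 0)).
        -- apply (locally_abs x (- x)); [lra|]. intros y Hy. apply Rabs_lt_between in Hy.
           unfold root_fun; destruct (Rlt_dec 0 y); auto; lra.
        -- apply is_derive_Rconst.
      (* Order 2p is taken because t^(2p) = x^2 for t = x^(1/p): this is the quadratic bound giving
         derivative 0 at 0. *)
      * destruct (proj2 HF (2 * p)%nat) as [r [Hr1 Hr2]].
        assert (Hrb : locally 0 (fun t => Rabs (r t) < Rabs (r 0) + 1)).
        { destruct (smooth1_continuity _ _ Hr1 1) as [e [He1 He2]]; [lra|].
          apply (locally_abs 0 e); auto. intros y Hy.
          destruct (Req_EM_T y 0) as [->|Hy0]; [lra|].
          assert (Rabs (r y - r 0) < 1).
          { apply He2; repeat split; auto. }
          replace (r y) with ((r y - r 0) + r 0) by ring.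
          eapply Rle_lt_trans; [apply Rabs_triang|lra]. }
        destruct (filter_and _ _ Hr2 Hrb) as [e He].
        apply is_derive_quadratic with (Rabs (r 0) + 1).
        assert (Hep : 0 < e ^ p) by (apply pow_lt, cond_pos).
        apply (locally_abs 0 (e ^ p)); auto. intros y Hy. rewrite Rminus_0_r in Hy.
        assert (H00 : forall G, root_fun G 0 = 0).
        { intros; unfold root_fun; destruct (Rlt_dec 0 0); auto; lra. }
        rewrite !H00, !Rminus_0_r, Rmult_0_r, Rminus_0_r.
        unfold root_fun. destruct (Rlt_dec 0 y) as [Hy0|Hy0].
        -- pose proof (proot_pos y) as Hpp.
           destruct (He (proot y)) as [A B].
           { change (Rabs (proot y - 0) < e). rewrite Rminus_0_r, Rabs_pos_eq by lra.
             apply proot_lt; auto using cond_pos. rewrite Rabs_pos_eq in Hy; lra. }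
           rewrite A, Nat.mul_comm, pow_mult, proot_pow by auto.
           rewrite Rabs_mult, (Rabs_pos_eq (y ^ 2)) by apply pow2_ge_0.
           rewrite Rmult_comm. apply Rmult_le_compat_r; [apply pow2_ge_0|lra].
        -- rewrite Rabs_R0. apply Rmult_le_pos; [pose proof (Rabs_pos (r 0)); lra|apply pow2_ge_0].
      * replace (root_fun F1 x) with (F1 (proot x)).
        2:{ unfold root_fun; destruct (Rlt_dec 0 x); auto; lra. }
        apply (is_derive_ext_loc (fun x => F (proot x))).
        -- apply (locally_abs x x); [lra|]. intros y Hy. apply Rabs_lt_between in Hy.
           unfold root_fun; destruct (Rlt_dec 0 y); auto; lra.
        -- pose proof (proot_pos x) as Hpp. evar_last.
           ++ apply (is_derive_Rcomp F proot); [apply smooth1_is_derive|now apply is_derive_proot].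
              apply Hs. rewrite Rabs_pos_eq by lra. now apply proot_lt.
           ++ unfold F1, divpow. destruct (Req_EM_T (proot x) 0); [lra|].
              unfold Rdiv. ring.
  - exists F; auto.
  - now apply pow_lt.
Qed.

Lemma root_fun_pow F t : 0 < t -> root_fun F (t ^ p) = F t.
Proof.
  intros Ht. unfold root_fun. rewrite pow_proot by auto.
  destruct (Rlt_dec 0 (t ^ p)) as [|K]; auto. now destruct K; apply pow_lt.
Qed.

Lemma root_fun_neg F x : x <= 0 -> root_fun F x = 0.
Proof. intros H; unfold root_fun; destruct (Rlt_dec 0 x); auto; lra. Qed.

End Root.

Lemma locally_comp (f : R -> R) x P : smooth1 f x -> locally (f x) P -> locally x (fun t => P (f t)).
Proof. intros Hf HP. apply (smooth1_continuous f x Hf P HP). Qed.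

Lemma locally_pow p P : (0 < p)%nat -> locally 0 P -> locally 0 (fun t => P (t ^ p)).
Proof.
  intros Hp HP. apply (locally_comp (fun t => t ^ p)); auto with smooth. now rewrite pow_i.
Qed.

Lemma smooth1_comp_pow p f : (0 < p)%nat -> smooth1 f 0 -> smooth1 (fun t => f (t ^ p)) 0.
Proof.
  intros Hp Hf. apply (smooth1_comp f); auto with smooth. now rewrite pow_i.
Qed.

Lemma borel_psum (c : nat -> R) : exists G : R -> R, smooth1 G 0 /\
  forall N, exists r, smooth1 r 0 /\ locally 0 (fun x => G x = psum c N x + x ^ N * r x).
Proof.
  destruct (borel c) as [G [HG1 HG2]]. exists G; split; auto. intros N.
  destruct (taylor_smooth N G (HG1 0)) as [r [Hr1 Hr2]]. exists r; split; auto.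
  revert Hr2; apply filter_imp. intros x ->.
  f_equal. apply psum_ext. intros k. rewrite HG2. field. apply INR_fact_neq_0.
Qed.

Lemma flat_of_pow p F : (0 < p)%nat -> smooth1 F 0 ->
  (forall N, exists r, smooth1 r 0 /\ locally 0 (fun t => F t = t ^ (p * N) * r t)) -> flat F.
Proof.
  intros Hp HF H. split; auto. intros N. destruct (H N) as [r [Hr1 Hr2]].
  exists (fun t => t ^ (p * N - N) * r t). split; auto with smooth.
  revert Hr2; apply filter_imp. intros t ->.
  replace (p * N)%nat with (N + (p * N - N))%nat at 1 by nia. rewrite pow_add. ring.
Qed.

(** * Whitney decomposition *)

(** f0 comes from the even part of F and f1 from the even part of F(t)/t. Both are functions of t^2
    built from F and F(-t) on t > 0, smooth by flatness. *)
Lemma flat_whitney2 F : flat F -> exists f0 f1, smooth1 f0 0 /\ smooth1 f1 0 /\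
  forall t, F t = f0 (t ^ 2) + t * f1 (t ^ 2).
Proof.
  intros HF. assert (Hp : (0 < 2)%nat) by lia.
  set (F1 := divpow 1 F). assert (HF1 : flat F1) by now apply flat_divpow.
  set (Fm := fun t => F (- t)). assert (HFm : flat Fm) by now apply flat_opp.
  set (F1m := fun t => F1 (- t)). assert (HF1m : flat F1m) by now apply flat_opp.
  exists (fun x => / 2 * (root_fun 2 F x + root_fun 2 Fm x)),
    (fun x => / 2 * (root_fun 2 F1 x + root_fun 2 F1m x)).
  split; [|split].
  - auto using smooth1_root_fun with smooth.
  - auto using smooth1_root_fun with smooth.
  - assert (HE : forall t, t * F1 t = F t).
    { intros t. unfold F1. rewrite <- (divpow_mult 1 F t); [now rewrite pow_1|now apply flat_0|lia]. }
    intros t. destruct (Rtotal_order t 0) as [Ht|[->|Ht]].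
    + replace (t ^ 2) with ((- t) ^ 2) by ring. rewrite !root_fun_pow by (auto; lra).
      unfold Fm, F1m. rewrite Ropp_involutive.
      pose proof (HE t). pose proof (HE (- t)). nra.
    + rewrite pow_i by lia. rewrite !root_fun_neg by lra. rewrite (flat_0 F) by auto. ring.
    + rewrite !root_fun_pow by (auto; lra). unfold Fm, F1m.
      pose proof (HE t). pose proof (HE (- t)). nra.
Qed.

(** The cube root is a bijection of the line, so a flat F is a smooth function of t^3 alone; its two
    half-lines are treated separately. *)
Lemma flat_whitney3 F : flat F -> exists f0, smooth1 f0 0 /\ forall t, F t = f0 (t ^ 3).
Proof.
  intros HF. assert (Hp : (0 < 3)%nat) by lia.
  set (Fm := fun t => F (- t)). assert (HFm : flat Fm) by now apply flat_opp.
  exists (fun x => root_fun 3 F x + root_fun 3 Fm (- x)). split.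
  - apply smooth1_plus; [now apply smooth1_root_fun|].
    apply smooth1_comp_opp. rewrite Ropp_0. now apply smooth1_root_fun.
  - intros t. destruct (Rtotal_order t 0) as [Ht|[->|Ht]].
    + assert (0 < (- t) ^ 3) by (apply pow_lt; lra).
      replace (- t ^ 3) with ((- t) ^ 3) by ring. rewrite (root_fun_pow 3 Hp Fm (- t)) by lra.
      rewrite root_fun_neg by nra. unfold Fm. rewrite Ropp_involutive; ring.
    + rewrite pow_i by lia. rewrite !root_fun_neg by lra. rewrite (flat_0 F) by auto. ring.
    + assert (0 < t ^ 3) by (apply pow_lt; lra).
      rewrite root_fun_pow by (auto; lra). rewrite root_fun_neg by lra. ring.
Qed.

Lemma psum_split2 c N t :
  psum c (2 * N) t = psum (fun k => c (2 * k)%nat) N (t ^ 2)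
    + t * psum (fun k => c (2 * k + 1)%nat) N (t ^ 2).
Proof.
  induction N; [simpl; ring|].
  replace (2 * S N)%nat with (S (S (2 * N))) by lia.
  change (psum c (S (S (2 * N))) t) with
    (psum c (2 * N) t + c (2 * N)%nat * t ^ (2 * N) + c (S (2 * N)) * t ^ (S (2 * N))).
  rewrite IHN. cbn [psum].
  replace (S (2 * N)) with (2 * N + 1)%nat by lia.
  rewrite !pow_add, pow_1, !pow_mult. ring.
Qed.

Lemma psum_split3 c N t :
  psum c (3 * N) t = psum (fun k => c (3 * k)%nat) N (t ^ 3)
    + t * psum (fun k => c (3 * k + 1)%nat) N (t ^ 3)
    + t ^ 2 * psum (fun k => c (3 * k + 2)%nat) N (t ^ 3).
Proof.
  induction N; [simpl; ring|].
  replace (3 * S N)%nat with (S (S (S (3 * N)))) by lia.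
  change (psum c (S (S (S (3 * N)))) t) with
    (psum c (3 * N) t + c (3 * N)%nat * t ^ (3 * N) + c (S (3 * N)) * t ^ (S (3 * N))
      + c (S (S (3 * N))) * t ^ (S (S (3 * N)))).
  rewrite IHN. cbn [psum].
  replace (S (S (3 * N))) with (3 * N + 2)%nat by lia.
  replace (S (3 * N)) with (3 * N + 1)%nat by lia.
  rewrite !pow_add, pow_1, !pow_mult. ring.
Qed.

(** Borel's lemma realizes the even and the odd Taylor coefficients by G0 and G1. What remains of g
    is flat and is decomposed by [flat_whitney2]. *)
Lemma whitney2 g : smooth1 g 0 -> exists g0 g1, smooth1 g0 0 /\ smooth1 g1 0 /\
  locally 0 (fun t => g t = g0 (t ^ 2) + t * g1 (t ^ 2)).
Proof.
  intros Hg. set (c := fun k => Derive_n g k 0 / INR (fact k)).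
  assert (Hp : (0 < 2)%nat) by lia.
  destruct (borel_psum (fun k => c (2 * k)%nat)) as [G0 [HG0 HR0]].
  destruct (borel_psum (fun k => c (2 * k + 1)%nat)) as [G1 [HG1 HR1]].
  pose proof (smooth1_comp_pow 2 _ Hp HG0) as S0.
  pose proof (smooth1_comp_pow 2 _ Hp HG1) as S1.
  assert (HF : flat (fun t => g t - (G0 (t ^ 2) + t * G1 (t ^ 2)))).
  { apply (flat_of_pow 2); [lia|auto 10 with smooth|]. intros N.
    destruct (taylor_smooth (2 * N) g Hg) as [r [Hr Er]].
    destruct (HR0 N) as [r0 [Hr0 Er0]]. destruct (HR1 N) as [r1 [Hr1 Er1]].
    exists (fun t => r t - (r0 (t ^ 2) + t * r1 (t ^ 2))). split.
    - pose proof (smooth1_comp_pow 2 _ Hp Hr0). pose proof (smooth1_comp_pow 2 _ Hp Hr1).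
      auto 10 with smooth.
    - generalize (filter_and _ _ Er (filter_and _ _ (locally_pow 2 _ Hp Er0) (locally_pow 2 _ Hp Er1))).
      apply filter_imp. intros t [E [E0 E1]].
      rewrite E, E0, E1. fold c. rewrite psum_split2, !pow_mult. ring. }
  destruct (flat_whitney2 _ HF) as [f0 [f1 [H0 [H1 HE]]]].
  exists (fun x => G0 x + f0 x), (fun x => G1 x + f1 x). split; [|split]; auto with smooth.
  apply filter_forall. intros t. specialize (HE t). simpl in *. lra.
Qed.

(** As for p = 2, with Taylor coefficients sorted modulo 3; here the flat remainder goes entirely
    into g0. *)
Lemma whitney3 g : smooth1 g 0 -> exists g0 g1 g2, smooth1 g0 0 /\ smooth1 g1 0 /\ smooth1 g2 0 /\
  locally 0 (fun t => g t = g0 (t ^ 3) + t * g1 (t ^ 3) + t ^ 2 * g2 (t ^ 3)).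
Proof.
  intros Hg. set (c := fun k => Derive_n g k 0 / INR (fact k)).
  assert (Hp : (0 < 3)%nat) by lia.
  destruct (borel_psum (fun k => c (3 * k)%nat)) as [G0 [HG0 HR0]].
  destruct (borel_psum (fun k => c (3 * k + 1)%nat)) as [G1 [HG1 HR1]].
  destruct (borel_psum (fun k => c (3 * k + 2)%nat)) as [G2 [HG2 HR2]].
  pose proof (smooth1_comp_pow 3 _ Hp HG0) as S0.
  pose proof (smooth1_comp_pow 3 _ Hp HG1) as S1.
  pose proof (smooth1_comp_pow 3 _ Hp HG2) as S2.
  assert (HF : flat (fun t => g t - (G0 (t ^ 3) + t * G1 (t ^ 3) + t ^ 2 * G2 (t ^ 3)))).
  { apply (flat_of_pow 3); [lia|auto 10 with smooth|]. intros N.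
    destruct (taylor_smooth (3 * N) g Hg) as [r [Hr Er]].
    destruct (HR0 N) as [r0 [Hr0 Er0]]. destruct (HR1 N) as [r1 [Hr1 Er1]].
    destruct (HR2 N) as [r2 [Hr2 Er2]].
    exists (fun t => r t - (r0 (t ^ 3) + t * r1 (t ^ 3) + t ^ 2 * r2 (t ^ 3))). split.
    - pose proof (smooth1_comp_pow 3 _ Hp Hr0). pose proof (smooth1_comp_pow 3 _ Hp Hr1).
      pose proof (smooth1_comp_pow 3 _ Hp Hr2). auto 10 with smooth.
    - generalize (filter_and _ _ (filter_and _ _ Er (locally_pow 3 _ Hp Er2))
        (filter_and _ _ (locally_pow 3 _ Hp Er0) (locally_pow 3 _ Hp Er1))).
      apply filter_imp. intros t [[E E2] [E0 E1]].
      rewrite E, E0, E1, E2. fold c. rewrite psum_split3, !pow_mult. ring. }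
  destruct (flat_whitney3 _ HF) as [f0 [H0 HE]].
  exists (fun x => G0 x + f0 x), G1, G2. split; [|split; [|split]]; auto with smooth.
  apply filter_forall. intros t. specialize (HE t). cbv beta in *. lra.
Qed.

(** Restates an equality over a Coquelicot carrier as one in R, so that [ring] recognizes it. *)
Ltac R_eq := match goal with |- @eq _ ?a ?b => change (@eq R a b) end.

(** * Inverse functions of one variable *)

Lemma smooth1_neq_0 f x : smooth1 f x -> f x <> 0 -> locally x (fun t => f t <> 0).
Proof.
  intros Hf H0. apply (smooth1_smooth2 f x 0) in Hf.
  exact (locally_2d_1d_const_y _ _ _ (continuity_2d_pt_neq_0 _ _ _ (smooth2_continuity _ _ _ Hf) H0)).
Qed.

Lemma locally_radius (x : R) (P : R -> Prop) : locally x P ->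
  exists d, 0 < d /\ forall y, Rabs (y - x) <= d -> P y.
Proof.
  intros [d Hd]. exists (d / 2). pose proof (cond_pos d). split; [lra|].
  intros y Hy. apply Hd. change (Rabs (y - x) < d). lra.
Qed.

Lemma continuity_pt_pos f x : continuity_pt f x -> 0 < f x -> locally x (fun y => 0 < f y).
Proof.
  intros Hc Hf. apply continuity_pt_filterlim in Hc.
  apply (Hc (fun y => 0 < y)). now apply (locally_open (fun y => 0 < y) (fun y => 0 < y) (open_gt 0)).
Qed.

Lemma increasing_inverse (f : R -> R) lb ub : lb < ub ->
  (forall u v, lb <= u -> u < v -> v <= ub -> f u < f v) ->
  (forall t, lb <= t <= ub -> continuity_pt f t) ->
  exists k : R -> R, (forall y, f lb <= y <= f ub -> lb <= k y <= ub /\ f (k y) = y) /\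
    forall y, f lb < y < f ub -> continuity_pt k y.
Proof.
  intros Hlu Hinc Hc.
  destruct (choice (fun y t => f lb <= y <= f ub -> lb <= t <= ub /\ f t = y)) as [k Hk].
  { intros y. destruct (classic (f lb <= y <= f ub)) as [Hy|Hy].
    - destruct (f_interv_is_interv f lb ub y Hlu Hy Hc) as [t Ht]. exists t; auto.
    - exists lb; tauto. }
  exists k; split; auto.
  apply (continuity_pt_recip_interv f k lb ub Hlu); auto; intros y H1 H2; now apply Hk.
Qed.

(** On an interval where h' > 0 the function is strictly increasing and has a continuous inverse;
    smoothness of the inverse is then bootstrapped from the formula for its derivative. *)
Lemma diffeo_germ1_of_derivative h x : smooth1 h x -> 0 < Derive h x -> diffeo_germ1 h x (h x).
Proof.
  intros Hh Hpos.
  assert (Hl : locally x (fun t => smooth1 h t /\ 0 < Derive h t)).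
  { apply filter_and; [now apply smooth1_locally|].
    apply continuity_pt_pos; auto. now apply smooth1_continuity, smooth1_Derive. }
  apply locally_radius in Hl as [d [Hd Hl]].
  set (lb := x - d). set (ub := x + d).
  assert (Hlu : lb < ub) by (unfold lb, ub; lra).
  assert (Hsm : forall t, lb <= t <= ub -> smooth1 h t /\ 0 < Derive h t).
  { intros t Ht. apply Hl. apply Rabs_le. unfold lb, ub in Ht; lra. }
  assert (Hinc : forall u v, lb <= u -> u < v -> v <= ub -> h u < h v).
  { intros u v Hu Huv Hv. destruct (MVT_gen h u v (Derive h)) as [c [Hc1 Hc2]].
    - intros t Ht. rewrite Rmin_left, Rmax_right in Ht by lra. apply smooth1_is_derive, Hsm; lra.
    - intros t Ht. rewrite Rmin_left, Rmax_right in Ht by lra. apply smooth1_continuity, Hsm; lra.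
    - rewrite Rmin_left, Rmax_right in Hc1 by lra.
      assert (0 < Derive h c) by (apply Hsm; lra). nra. }
  assert (Hinj : forall u v, lb <= u <= ub -> lb <= v <= ub -> h u = h v -> u = v).
  { intros u v Hu Hv E. destruct (Rtotal_order u v) as [L|[L|L]]; auto;
      [pose proof (Hinc u v)|pose proof (Hinc v u)]; lra. }
  destruct (increasing_inverse h lb ub Hlu Hinc) as [k [Hk Hkc]].
  { intros t Ht. apply smooth1_continuity, Hsm; auto. }
  assert (Hko : forall y, h lb < y < h ub -> lb < k y < ub).
  { intros y Hy. destruct (Hk y) as [K1 K2]; [lra|].
    split; apply Rnot_le_lt; intros K.
    - replace (k y) with lb in K2 by lra. lra.
    - replace (k y) with ub in K2 by lra. lra. }
  assert (Hkd : forall y, h lb < y < h ub -> is_derive k y (/ Derive h (k y))).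
  { intros y Hy.
    assert (Hpr : forall t, lb <= t <= ub -> derivable_pt_lim h t (Derive h t)).
    { intros t Ht. apply is_derive_Reals, smooth1_is_derive, Hsm; auto. }
    assert (Klb : k (h lb) = lb).
    { apply Hinj; try lra; apply Hk; pose proof (Hinc lb ub); lra. }
    assert (Kub : k (h ub) = ub).
    { apply Hinj; try lra; apply Hk; pose proof (Hinc lb ub); lra. }
    assert (Prf : forall a, k (h lb) <= a <= k (h ub) -> derivable_pt h a).
    { intros t Ht. exists (Derive h t). apply Hpr; lra. }
    assert (Prg : k (h lb) <= k y <= k (h ub)) by (pose proof (Hko y Hy); lra).
    assert (HE : derive_pt h (k y) (Prf (k y) Prg) = Derive h (k y)).
    { apply derive_pt_eq_0, Hpr. lra. }
    pose proof (derivable_pt_lim_recip_interv h k (h lb) (h ub) y Prf (Hkc y Hy)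
      ltac:(lra) Hy Prg ltac:(intros z Hz; now apply Hk)) as L.
    rewrite HE in L. unfold Rdiv in L. rewrite Rmult_1_l in L. apply is_derive_Reals, L.
    destruct (Hsm (k y)); lra. }
  assert (Hx : h lb < h x < h ub) by (unfold lb, ub in *; split; apply Hinc; lra).
  split; [reflexivity|]. split; [auto|].
  exists k. split; [|split; [|split]].
  - apply Hinj; [apply Hk; lra|unfold lb, ub; lra|apply Hk; lra].
  - apply smooth1_smooth2 with (y := 0). apply smooth2_C2.
    exists (fun y _ => h lb < y < h ub).
    assert (HU : forall a b, open2 (fun y _ => a < y < b)).
    { intros a b u v Hu. assert (He : 0 < Rmin (u - a) (b - u)) by (apply Rmin_pos; lra).
      exists (mkposreal _ He). simpl. intros u' v' Hu' _.
      pose proof (Rmin_l (u - a) (b - u)). pose proof (Rmin_r (u - a) (b - u)).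
      apply Rabs_lt_between in Hu'. lra. }
    split; [apply HU|split; [exact Hx|]].
    assert (Hc : forall u v, h lb < u < h ub -> continuity_2d_pt (fun y _ => k y) u v).
    { intros u v Hu. apply (continuity_1d_2d_pt_comp k (fun y _ => y)); auto.
      apply continuity_2d_pt_id1. }
    (* Since k' = 1 / h'(k), class C^n of k gives class C^n of k', hence class C^(n+1) of k. *)
    induction n; (split; [exact Hc|]); [exact I|].
    exists (fun y _ => / Derive h (k y)), (fun _ _ => 0).
    split; [|split; [|split]]; auto using C2_const.
    + intros; apply is_derive_Rconst.
    + apply (C2_comp (fun y _ => h lb < y < h ub) (fun t _ => lb < t < ub) n
        (fun t _ => / Derive h t) (fun y _ => k y) (fun _ _ => 0)); auto using C2_const.
      apply C2_ex_diff_n; auto. intros u v Hu.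
      assert (K : smooth1 (fun t => / Derive h t) u).
      { destruct (Hsm u) as [K1 K2]; [lra|].
        apply (smooth1_comp Rinv); [apply smooth1_inv; lra|now apply smooth1_Derive]. }
      apply (smooth1_smooth2 _ _ v) in K. now apply locally_2d_singleton in K.
  - apply (locally_abs x d); auto. intros u Hu.
    assert (Hu' : lb <= u <= ub) by (apply Rabs_lt_between in Hu; unfold lb, ub; lra).
    assert (Hr : h lb <= h u <= h ub).
    { destruct (Req_EM_T lb u) as [<-|]; [lra|]. destruct (Req_EM_T u ub) as [->|]; [lra|].
      pose proof (Hinc lb u). pose proof (Hinc u ub). lra. }
    apply Hinj; auto; now apply Hk.
  - assert (He : 0 < Rmin (h x - h lb) (h ub - h x)) by (apply Rmin_pos; lra).
    apply (locally_abs (h x) _ _ He). intros y Hy.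
    pose proof (Rmin_l (h x - h lb) (h ub - h x)). pose proof (Rmin_r (h x - h lb) (h ub - h x)).
    apply Rabs_lt_between in Hy. apply Hk. lra.
Qed.

(** * Germs of diffeomorphisms of the plane *)

Lemma locally_point (P : point -> Prop) (p : point) :
  locally p P <-> locally_2d (fun x y => P (x, y)) (fst p) (snd p).
Proof.
  destruct p as [x y]. rewrite locally_2d_locally. simpl.
  split; apply filter_imp; intros [u v]; auto.
Qed.

Lemma smooth_map_locally H p P : smooth_map H p -> locally (H p) P -> locally p (fun u => P (H u)).
Proof.
  intros [H1 H2] HP. apply locally_point. apply locally_point in HP as [d Hd].
  destruct p as [x y]; simpl in *.
  generalize (locally_2d_and _ _ _ _ (smooth2_continuity _ _ _ H1 d) (smooth2_continuity _ _ _ H2 d)).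
  apply locally_2d_imp. intros u v [A B].
  rewrite (surjective_pairing (H (u, v))). auto.
Qed.

Lemma smooth_curve_locally (c : R -> point) t P : smooth_curve c t -> locally (c t) P ->
  locally t (fun u => P (c u)).
Proof.
  intros [H1 H2] HP. apply locally_point in HP as [d Hd].
  assert (K1 : locally t (fun u => Rabs (fst (c u) - fst (c t)) < d)).
  { apply (smooth1_continuous _ _ H1 (fun y => Rabs (y - fst (c t)) < d)). now exists d. }
  assert (K2 : locally t (fun u => Rabs (snd (c u) - snd (c t)) < d)).
  { apply (smooth1_continuous _ _ H2 (fun y => Rabs (y - snd (c t)) < d)). now exists d. }
  generalize (filter_and _ _ K1 K2). apply filter_imp. intros u [A B].
  rewrite (surjective_pairing (c u)). auto.
Qed.

Lemma smooth_map_comp L H p : smooth_map L (H p) -> smooth_map H p ->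
  smooth_map (fun u => L (H u)) p.
Proof.
  intros [L1 L2] [H1 H2]. destruct p as [x y]; simpl in *.
  assert (E : forall u v, H (u, v) = (fst (H (u, v)), snd (H (u, v)))) by (intros; apply surjective_pairing).
  split; simpl.
  - apply (smooth2_ext (fun u v => fst (L (fst (H (u, v)), snd (H (u, v)))))).
    + apply locally_2d_forall; intros; now rewrite <- E.
    + apply (smooth2_comp (fun x y => fst (L (x, y)))); auto.
  - apply (smooth2_ext (fun u v => snd (L (fst (H (u, v)), snd (H (u, v)))))).
    + apply locally_2d_forall; intros; now rewrite <- E.
    + apply (smooth2_comp (fun x y => snd (L (x, y)))); auto.
Qed.

Lemma diffeo_germ2_comp H L p q r : diffeo_germ2 H p q -> diffeo_germ2 L q r ->
  diffeo_germ2 (fun u => L (H u)) p r.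
Proof.
  intros [H1 [H2 [K [K1 [K2 [K3 K4]]]]]] [L1 [L2 [M [M1 [M2 [M3 M4]]]]]]. subst q r.
  split; [auto|split].
  - now apply smooth_map_comp.
  - exists (fun u => K (M u)). split; [congruence|split; [|split]].
    + apply smooth_map_comp; auto. now rewrite M1.
    + generalize (filter_and _ _ K3 (smooth_map_locally H p _ H2 M3)).
      apply filter_imp. intros u [A B]. now rewrite B.
    + rewrite <- M1 in K4. generalize (filter_and _ _ M4 (smooth_map_locally M _ _ M2 K4)).
      apply filter_imp. intros u [A B]. now rewrite B.
Qed.

Lemma A_equivalent_left (L : point -> point) c x d y :
  diffeo_germ2 L (c x) (L (c x)) -> A_equivalent (fun t => L (c t)) x d y -> A_equivalent c x d y.
Proof.
  intros HL [h [H [Hh [HH HE]]]]. exists h, (fun u => H (L u)). split; [|split]; auto.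
  eapply diffeo_germ2_comp; eauto.
Qed.

Lemma A_equivalent_ext c c' x d y : locally x (fun t => c t = c' t) ->
  A_equivalent c x d y -> A_equivalent c' x d y.
Proof.
  intros Hc [h [H [Hh [HH HE]]]]. exists h, H. split; [|split]; auto.
  - now rewrite <- (locally_singleton _ _ Hc).
  - generalize (filter_and _ _ Hc HE). apply filter_imp. intros t [<- ?]; auto.
Qed.

Lemma smooth1_shift f a x : smooth1 f (x + a) -> smooth1 (fun t => f (t + a)) x.
Proof. intros H. apply (smooth1_comp f); auto with smooth. Qed.

Lemma locally_shift (P : R -> Prop) a x : locally (x + a) P -> locally x (fun t => P (t + a)).
Proof.
  intros H. apply (locally_comp (fun t => t + a)); auto with smooth.
Qed.

Lemma A_equivalent_shift (c : R -> point) t0 d y :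
  A_equivalent (fun t => c (t + t0)) 0 d y -> A_equivalent c t0 d y.
Proof.
  intros [h [H [[Hh1 [Hh2 [k [Hk1 [Hk2 [Hk3 Hk4]]]]]] [HH HE]]]].
  rewrite Rplus_0_l in HH.
  exists (fun t => h (t + - t0)), H.
  assert (E0 : t0 + - t0 = 0) by ring.
  split; [|split]; auto.
  - split; [now rewrite E0|split].
    + apply smooth1_shift. now rewrite E0.
    + exists (fun u => k u + t0). split; [rewrite Hk1; ring|split; [|split]].
      * auto with smooth.
      * rewrite <- E0 in Hk3. apply locally_shift in Hk3. revert Hk3; apply filter_imp.
        intros u ->. R_eq. ring.
      * revert Hk4; apply filter_imp. intros u Hu. rewrite <- Hu at 2. f_equal; ring.
  - rewrite <- E0 in HE. apply locally_shift in HE. revert HE; apply filter_imp.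
    intros t <-. do 2 f_equal; symmetry; now rewrite Rplus_assoc, Rplus_opp_l, Rplus_0_r.
Qed.

Lemma affine_diffeo (L : point -> point) a b c d e f p :
  a * d - b * c <> 0 ->
  (forall q, L q = (a * fst q + b * snd q + e, c * fst q + d * snd q + f)) ->
  diffeo_germ2 L p (L p).
Proof.
  intros HD HL.
  assert (HS : forall a b e u v, smooth2 (fun x y : R => a * x + b * y + e) u v)
    by (intros; auto 10 with smooth).
  split; [reflexivity|split].
  - split; (eapply smooth2_ext; [|apply HS]); apply locally_2d_forall; intros;
      rewrite HL; simpl; reflexivity.
  - set (D := a * d - b * c) in *.
    exists (fun q => (d / D * fst q + - b / D * snd q + (b * f - d * e) / D,
                      - c / D * fst q + a / D * snd q + (c * e - a * f) / D)).
    split; [|split; [|split]].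
    + rewrite HL. destruct p as [x y]; simpl. f_equal; unfold D; field; auto.
    + split; simpl; apply HS.
    + apply filter_forall. intros [x y]. rewrite HL; simpl. f_equal; unfold D; field; auto.
    + apply filter_forall. intros [x y]. rewrite HL; simpl. f_equal; unfold D; field; auto.
Qed.

(** * Normal forms *)

(** tau(t) = t u(t)^(1/p), smooth because u stays positive near 0. *)
Lemma root_param p u : (0 < p)%nat -> smooth1 u 0 -> 0 < u 0 ->
  exists tau, smooth1 tau 0 /\ tau 0 = 0 /\ Derive tau 0 = Rpower (u 0) (/ INR p) /\
    locally 0 (fun t => tau t ^ p = t ^ p * u t).
Proof.
  intros Hp Hu Hpos.
  assert (HS : smooth1 (fun t => Rpower (u t) (/ INR p)) 0).
  { apply (smooth1_comp (fun x => Rpower x (/ INR p))); auto. now apply smooth1_Rpower. }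
  exists (fun t => t * Rpower (u t) (/ INR p)).
  split; [auto with smooth|]. split; [ring|]. split.
  - apply is_derive_unique. evar_last.
    + apply (is_derive_Rmult (fun t => t)); [apply is_derive_Rid|now apply smooth1_is_derive].
    + change (@one R_AbsRing) with 1. cbv beta. ring.
  - generalize (continuity_pt_pos _ _ (smooth1_continuity _ _ Hu) Hpos). apply filter_imp.
    intros t Ht. rewrite Rpow_mult_distr. f_equal. now apply proot_pow.
Qed.

Lemma inverse_factor h k : smooth1 k 0 -> k 0 = 0 -> smooth1 h 0 -> h 0 = 0 ->
  locally 0 (fun t => k (h t) = t) ->
  exists m, smooth1 m 0 /\ m 0 * Derive h 0 = 1 /\ locally 0 (fun t => k t = t * m t).
Proof.
  intros Hk Hk0 Hh Hh0 HE. destruct (hadamard0 k Hk) as [m [Hm1 [Hm2 Hm3]]].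
  exists m; split; [|split]; auto.
  - assert (D : is_derive (fun t => k (h t)) 0 (Derive k 0 * Derive h 0)).
    { apply is_derive_Rcomp; [rewrite Hh0|]; now apply smooth1_is_derive. }
    rewrite Hm2. apply is_derive_unique in D. rewrite <- D.
    rewrite (Derive_ext_loc _ (fun t => t)); [apply Derive_id|auto].
  - revert Hm3; apply filter_imp. intros t ->. rewrite Hk0; ring.
Qed.

Lemma smooth2_1d f x y : smooth1 f x -> smooth2 (fun u _ => f u) x y.
Proof. apply smooth1_smooth2. Qed.
#[export] Hint Resolve smooth2_1d : smooth.

Lemma smooth2_pos F x y : smooth2 F x y -> 0 < F x y -> locally_2d (fun u v => 0 < F u v) x y.
Proof.
  intros HF H0. generalize (smooth2_continuity _ _ _ HF (mkposreal _ H0)).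
  apply locally_2d_imp. simpl. intros u v H.
  apply Rabs_lt_between in H. lra.
Qed.

(** The map K(x, y) = (x, y b + y^2 c + x^2 d) is inverted explicitly. With z = Y - x^2 d, the root
    of c y^2 + b y = z is written 2 z / (b + sqrt(b^2 + 4 c z)), a form that stays smooth where c
    vanishes. *)
Lemma quadratic_diffeo (b c d : R -> R) : smooth1 b 0 -> smooth1 c 0 -> smooth1 d 0 -> 0 < b 0 ->
  exists H, diffeo_germ2 H (0, 0) (0, 0) /\
    locally (0, 0) (fun q : point =>
      H (fst q, snd q * b (fst q) + snd q ^ 2 * c (fst q) + fst q ^ 2 * d (fst q)) = q).
Proof.
  intros Hb Hc Hd Hb0.
  set (z := fun x y => y - x ^ 2 * d x).
  set (D := fun x y => b x ^ 2 + 4 * c x * z x y).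
  set (S := fun x y => b x + sqrt (D x y)).
  assert (Hz : smooth2 z 0 0) by (unfold z; auto 10 with smooth).
  assert (HD : smooth2 D 0 0) by (unfold D; auto 10 with smooth).
  assert (HD0 : 0 < D 0 0).
  { unfold D, z. replace (b 0 ^ 2 + 4 * c 0 * (0 - 0 ^ 2 * d 0)) with (b 0 ^ 2) by ring. now apply pow_lt. }
  assert (HSs : smooth2 S 0 0).
  { unfold S. apply smooth2_plus; auto with smooth. apply (smooth2_comp1 sqrt D); auto. now apply smooth1_sqrt. }
  assert (HS0 : 0 < S 0 0).
  { unfold S. pose proof (sqrt_pos (D 0 0)); lra. }
  set (K := fun q : point => (fst q, snd q * b (fst q) + snd q ^ 2 * c (fst q) + fst q ^ 2 * d (fst q))).
  set (H := fun q : point => (fst q, 2 * z (fst q) (snd q) / S (fst q) (snd q))).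
  assert (HKH : locally (0, 0) (fun q : point => H (K q) = q)).
  { apply locally_point; simpl.
    assert (P1 : locally_2d (fun x y => 0 < b x + 2 * y * c x) 0 0).
    { apply smooth2_pos; [auto 10 with smooth|]. lra. }
    assert (P2 : locally_2d (fun x y => 0 < b x + y * c x) 0 0).
    { apply smooth2_pos; [auto 10 with smooth|]. lra. }
    generalize (locally_2d_and _ _ _ _ P1 P2). apply locally_2d_imp.
    intros x y [E1 E2]. unfold H, K; cbn [fst snd]. f_equal.
    assert (EZ : z x (y * b x + y ^ 2 * c x + x ^ 2 * d x) = y * b x + y ^ 2 * c x) by (unfold z; ring).
    assert (ES : S x (y * b x + y ^ 2 * c x + x ^ 2 * d x) = 2 * (b x + y * c x)).
    { unfold S, D. rewrite EZ.
      replace (b x ^ 2 + 4 * c x * (y * b x + y ^ 2 * c x)) with ((b x + 2 * y * c x) ^ 2) by ring.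
      rewrite sqrt_pow2 by lra. ring. }
    rewrite EZ, ES. field; lra. }
  exists H. split; [|exact HKH].
  assert (Z0 : z 0 0 = 0) by (unfold z; ring).
  assert (HH0 : H (0, 0) = (0, 0)).
  { unfold H; cbn [fst snd]. rewrite Z0. f_equal. unfold Rdiv; ring. }
  split; [auto|split].
  - split; simpl; auto with smooth. apply smooth2_div; auto with smooth. lra.
  - exists K. split; [unfold K; simpl; f_equal; ring|split; [|split; [|exact HKH]]].
    + split; simpl; auto 10 with smooth.
    + apply locally_point; simpl.
      generalize (locally_2d_and _ _ _ _ (smooth2_pos _ _ _ HD HD0) (smooth2_pos _ _ _ HSs HS0)).
      apply locally_2d_imp. intros x y [E1 E2].
      unfold H, K; cbn [fst snd]. f_equal.
      assert (ED : (S x y - b x) ^ 2 = b x ^ 2 + 4 * c x * z x y).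
      { unfold S. replace (b x + sqrt (D x y) - b x) with (sqrt (D x y)) by ring.
        rewrite pow2_sqrt; [reflexivity|lra]. }
      assert (EE : 2 * z x y / S x y * b x + (2 * z x y / S x y) ^ 2 * c x = z x y).
      { apply Rmult_eq_reg_r with (S x y ^ 2); [|apply pow_nonzero; lra].
        replace ((2 * z x y / S x y * b x + (2 * z x y / S x y) ^ 2 * c x) * S x y ^ 2)
          with (z x y * (2 * b x * S x y + 4 * c x * z x y)) by (field; lra).
        f_equal. lra. }
      rewrite EE. unfold z; ring.
Qed.

(** In the parameter tau = t u^(1/p) one has t = tau m(tau), so t^(p+1) w acquires the factor W =
    m^(p+1) w(k), where k is the inverse of tau. The last identity expresses W without fractional
    powers, ready to be differentiated at 0. *)
Lemma root_reparametrization p u w : (0 < p)%nat -> smooth1 u 0 -> smooth1 w 0 -> 0 < u 0 -> 0 < w 0 ->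
  exists tau W, diffeo_germ1 tau 0 0 /\ smooth1 tau 0 /\ tau 0 = 0 /\ 0 < Derive tau 0 /\
    smooth1 W 0 /\ 0 < W 0 /\
    locally 0 (fun t => tau t ^ p = t ^ p * u t /\ t ^ S p * w t = tau t ^ S p * W (tau t) /\
      W (tau t) ^ p * u t ^ S p = w t ^ p).
Proof.
  intros Hp Hu Hw Hu0 Hw0.
  destruct (root_param p u) as [tau [T1 [T2 [T3 T4]]]]; auto.
  assert (HD : 0 < Derive tau 0) by (rewrite T3; apply exp_pos).
  pose proof (diffeo_germ1_of_derivative tau 0 T1 HD) as Hdiff. rewrite T2 in Hdiff.
  pose proof Hdiff as [_ [_ [k [K1 [K2 [K3 K4]]]]]].
  destruct (inverse_factor tau k) as [m [M1 [M2 M3]]]; auto.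
  exists tau, (fun s => m s ^ S p * w (k s)).
  assert (Hm0 : 0 < m 0) by nra.
  split; [|split; [|split; [|split; [|split; [|split]]]]]; auto.
  - apply smooth1_mult; auto with smooth. apply (smooth1_comp w); auto. now rewrite K1.
  - rewrite K1. apply Rmult_lt_0_compat; auto. now apply pow_lt.
  - assert (L1 : locally 0 (fun t => k (tau t) = tau t * m (tau t))).
    { apply (locally_comp tau 0 (fun s => k s = s * m s)); auto. now rewrite T2. }
    generalize (filter_and _ _ L1 (filter_and _ _ T4 K3)). apply filter_imp.
    intros t [E1 [E4 E5]]. rewrite E5 in E1 |- *.
    (* Away from 0 this is tau^p = t^p u divided by t^p; at 0 it is read off m(0) tau'(0) = 1 and
       tau'(0)^p = u(0). *)
    assert (HM : m (tau t) ^ p * u t = 1).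
    { destruct (Req_EM_T t 0) as [->|Ht].
      - rewrite T2. pose proof (proot_pow p Hp (u 0) Hu0) as HP.
        unfold proot in HP. rewrite <- T3 in HP. rewrite <- HP, <- Rpow_mult_distr, M2. apply pow1.
      - apply Rmult_eq_reg_r with (t ^ p); [|now apply pow_nonzero].
        rewrite Rmult_1_l. transitivity ((tau t * m (tau t)) ^ p).
        + rewrite Rpow_mult_distr, E4. ring.
        + now rewrite <- E1. }
    split; [exact E4|split].
    + rewrite <- Rmult_assoc, <- Rpow_mult_distr, <- E1. reflexivity.
    + rewrite Rpow_mult_distr, <- pow_mult, Nat.mul_comm, pow_mult.
      transitivity ((m (tau t) ^ p * u t) ^ S p * w t ^ p); [rewrite Rpow_mult_distr; ring|].
      rewrite HM, pow1. ring.
Qed.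

Lemma cusp_normal_form u w : smooth1 u 0 -> smooth1 w 0 -> 0 < u 0 -> 0 < w 0 ->
  A_equivalent (fun t => (t ^ 2 * u t, t ^ 3 * w t)) 0 (fun t => (t ^ 2, t ^ 3)) 0.
Proof.
  intros Hu Hw Hu0 Hw0.
  destruct (root_reparametrization 2 u w) as [tau [W [Hdiff [T1 [T2 [HD [HWs [HW0 HE]]]]]]]]; auto.
  destruct (whitney2 W HWs) as [W0 [W1 [S0 [S1 HWE]]]].
  assert (HW00 : 0 < W0 0).
  { pose proof (locally_singleton _ _ HWE) as E. cbv beta in E.
    rewrite pow_i, Rmult_0_l, Rplus_0_r in E by lia. now rewrite <- E. }
  (* With x = tau^2 and y = tau^3, the second component tau^3 W is y W0(x) + x^2 W1(x). *)
  destruct (quadratic_diffeo W0 (fun _ => 0) W1) as [H [HH1 HH2]]; auto with smooth.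
  exists tau, H. rewrite !pow_i, !Rmult_0_l by lia.
  split; [exact Hdiff|split; [exact HH1|]].
  assert (L2 := locally_comp tau 0 (fun s => W s = W0 (s ^ 2) + s * W1 (s ^ 2)) T1 ltac:(now rewrite T2)).
  assert (L4 : locally 0 (fun t => H (tau t ^ 2, tau t ^ 3 * W0 (tau t ^ 2) + (tau t ^ 3) ^ 2 * 0
     + (tau t ^ 2) ^ 2 * W1 (tau t ^ 2)) = (tau t ^ 2, tau t ^ 3))).
  { apply (smooth_curve_locally (fun t => (tau t ^ 2, tau t ^ 3)) 0 (fun q : point =>
      H (fst q, snd q * W0 (fst q) + snd q ^ 2 * 0 + fst q ^ 2 * W1 (fst q)) = q)).
    - split; simpl; auto 10 with smooth.
    - rewrite T2, !pow_i by lia. exact HH2. }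
  generalize (filter_and _ _ L2 (filter_and _ _ L4 HE)).
  apply filter_imp. intros t [E2 [E6 [E4 [E5 _]]]]. rewrite <- E6, <- E4, E5, E2. do 2 f_equal. ring.
Qed.

(** The monomial t^5 is the only obstruction, being no product of powers of t^3 and t^4. The
    condition on u', w' makes its coefficient vanish after the reparametrization that turns the
    first component into a cube. *)
Lemma E6_normal_form u w : smooth1 u 0 -> smooth1 w 0 -> 0 < u 0 -> 0 < w 0 ->
  3 * Derive w 0 * u 0 = 4 * w 0 * Derive u 0 ->
  A_equivalent (fun t => (t ^ 3 * u t, t ^ 4 * w t)) 0 (fun t => (t ^ 3, t ^ 4)) 0.
Proof.
  intros Hu Hw Hu0 Hw0 Huw.
  destruct (root_reparametrization 3 u w) as [tau [W [Hdiff [T1 [T2 [HD [HWs [HW0 HE]]]]]]]]; auto; try lia.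
  (* [W (tau t) = w t / u t ^ (4/3)], whose derivative vanishes at 0 by the hypothesis on u', w' *)
  assert (HW' : Derive W 0 = 0).
  { assert (HWu : locally 0 (fun t => W (tau t) ^ 3 * u t ^ 4 = w t ^ 3)).
    { revert HE; apply filter_imp. intros t [_ [_ E]]; exact E. }
    assert (HWt : is_derive (fun t => W (tau t)) 0 (Derive W 0 * Derive tau 0)).
    { apply is_derive_Rcomp; [rewrite T2|]; now apply smooth1_is_derive. }
    assert (D1 : is_derive (fun t => W (tau t) ^ 3 * u t ^ 4) 0
      (INR 3 * (Derive W 0 * Derive tau 0) * W (tau 0) ^ 2 * u 0 ^ 4
        + W (tau 0) ^ 3 * (INR 4 * Derive u 0 * u 0 ^ 3))).
    { exact (is_derive_Rmult _ _ _ _ _ (is_derive_pow _ 3 _ _ HWt)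
      (is_derive_pow _ 4 _ _ (smooth1_is_derive _ _ Hu))). }
    assert (D2 : is_derive (fun t => w t ^ 3) 0 (INR 3 * Derive w 0 * w 0 ^ 2)).
    { exact (is_derive_pow _ 3 _ _ (smooth1_is_derive _ _ Hw)). }
    apply is_derive_unique in D1. apply is_derive_unique in D2.
    assert (DE : Derive (fun t => W (tau t) ^ 3 * u t ^ 4) 0 = Derive (fun t => w t ^ 3) 0)
      by (apply Derive_ext_loc; exact HWu).
    pose proof (eq_trans (eq_sym D1) (eq_trans DE D2)) as DF. clear D1. rename DF into D1.
    pose proof (locally_singleton _ _ HWu) as E0. cbv beta in E0. rewrite T2 in D1, E0.
    simpl INR in D1.
    (* The differentiated identity multiplied by u(0), with W^3 u^4 replaced by w^3; what is left is
       w^2 (3 w' u - 4 w u'), zero by hypothesis. *)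
    assert (HK : 3 * (W 0 ^ 2 * u 0 ^ 5 * Derive tau 0) * Derive W 0 = 0).
    { replace (3 * (W 0 ^ 2 * u 0 ^ 5 * Derive tau 0) * Derive W 0) with
        (w 0 ^ 2 * (3 * Derive w 0 * u 0) - 4 * (W 0 ^ 3 * u 0 ^ 4) * Derive u 0) by (apply (Rmult_eq_compat_l (u 0)) in D1; lra).
      rewrite Huw, E0. ring. }
    apply Rmult_integral in HK as [HK|]; auto. exfalso.
    assert (0 < 3 * (W 0 ^ 2 * u 0 ^ 5 * Derive tau 0)); [|lra].
    pose proof (pow_lt _ 2 HW0). pose proof (pow_lt _ 5 Hu0).
    assert (0 < W 0 ^ 2 * u 0 ^ 5) by now apply Rmult_lt_0_compat. nra. }
  destruct (whitney3 W HWs) as [W0 [W1 [W2 [S0 [HW1 [S2 HWE]]]]]].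
  assert (HW00 : 0 < W0 0).
  { pose proof (locally_singleton _ _ HWE) as E. cbv beta in E.
    rewrite !pow_i, !Rmult_0_l, !Rplus_0_r in E by lia. now rewrite <- E. }
  assert (HW10 : W1 0 = 0).
  { assert (E : Derive W 0 = W1 0); [|congruence].
    rewrite (Derive_ext_loc _ _ _ HWE). apply is_derive_unique.
    evar_last.
    - apply (is_derive_Rplus
        (fun t => W0 (t ^ 3) + t * W1 (t ^ 3)) (fun t => t ^ 2 * W2 (t ^ 3))).
      + apply (is_derive_Rplus
          (fun t => W0 (t ^ 3)) (fun t => t * W1 (t ^ 3))).
        * apply (is_derive_Rcomp W0 (fun t => t ^ 3)).
          -- rewrite pow_i by lia. now apply smooth1_is_derive.
          -- apply (is_derive_pow (fun u => u)), is_derive_Rid.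
        * apply (is_derive_Rmult (fun t => t) (fun t => W1 (t ^ 3))).
          -- apply is_derive_Rid.
          -- apply smooth1_is_derive. apply smooth1_comp_pow; auto; lia.
      + apply (is_derive_Rmult (fun t => t ^ 2) (fun t => W2 (t ^ 3))).
        * apply (is_derive_pow (fun u => u)), is_derive_Rid.
        * apply smooth1_is_derive. apply smooth1_comp_pow; auto; lia.
    - change (@one R_AbsRing) with 1. unfold plus; simpl. rewrite !Rmult_0_l.
      rewrite !Rmult_0_r. ring_simplify. reflexivity. }
  (* Since W1(0) = 0, W1(x) = x V1(x), and tau^5 W1(x) becomes tau^8 V1(x) = y^2 V1(x). *)
  destruct (hadamard0 W1 HW1) as [V1 [HV1 [_ HVE]]]. rewrite HW10 in HVE.
  destruct (quadratic_diffeo W0 V1 W2) as [H [HH1 HH2]]; auto.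
  exists tau, H. rewrite !pow_i, !Rmult_0_l by lia.
  split; [exact Hdiff|split; [exact HH1|]].
  assert (L2 := locally_comp tau 0 (fun s => W s = W0 (s ^ 3) + s * W1 (s ^ 3) + s ^ 2 * W2 (s ^ 3))
    T1 ltac:(now rewrite T2)).
  assert (L3 : locally 0 (fun t => W1 (tau t ^ 3) = 0 + tau t ^ 3 * V1 (tau t ^ 3))).
  { apply (locally_comp (fun t => tau t ^ 3) 0 (fun x => W1 x = 0 + x * V1 x)); auto with smooth.
    now rewrite T2, pow_i by lia. }
  assert (L4 : locally 0 (fun t => H (tau t ^ 3, tau t ^ 4 * W0 (tau t ^ 3) + (tau t ^ 4) ^ 2 * V1 (tau t ^ 3)
     + (tau t ^ 3) ^ 2 * W2 (tau t ^ 3)) = (tau t ^ 3, tau t ^ 4))).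
  { apply (smooth_curve_locally (fun t => (tau t ^ 3, tau t ^ 4)) 0 (fun q : point =>
      H (fst q, snd q * W0 (fst q) + snd q ^ 2 * V1 (fst q) + fst q ^ 2 * W2 (fst q)) = q)).
    - split; simpl; auto 10 with smooth.
    - rewrite T2, !pow_i by lia. exact HH2. }
  generalize (filter_and _ _ L2 (filter_and _ _ L3 (filter_and _ _ L4 HE))).
  apply filter_imp. intros t [E2 [E3 [E6 [E4 [E5 _]]]]]. rewrite <- E6, <- E4, E5, E2, E3. do 2 f_equal. ring.
Qed.

(** * Singular points of fronts *)

Lemma sign_exists x : x <> 0 -> exists s, (s = 1 \/ s = -1) /\ 0 < s * x.
Proof. intros Hx. destruct (Rlt_dec 0 x); [exists 1|exists (-1)]; split; auto; lra. Qed.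

Lemma simple_zero mu : smooth1 mu 0 -> mu 0 = 0 ->
  exists nu, smooth1 nu 0 /\ nu 0 = Derive mu 0 /\ locally 0 (fun t => mu t = t ^ 1 * nu t).
Proof.
  intros Hmu H0. destruct (hadamard0 mu Hmu) as [nu [H1 [H2 H3]]].
  exists nu; split; [|split]; auto. revert H3; apply filter_imp. intros t ->. rewrite H0, pow_1. ring.
Qed.

Lemma double_zero mu : smooth1 mu 0 -> mu 0 = 0 -> Derive mu 0 = 0 ->
  exists nu, smooth1 nu 0 /\ nu 0 = Derive_n mu 2 0 / 2 /\ locally 0 (fun t => mu t = t ^ 2 * nu t).
Proof.
  intros Hmu H0 H1. destruct (taylor_smooth 3 mu Hmu) as [r [Hr1 Hr2]].
  exists (fun t => Derive_n mu 2 0 / 2 + t * r t). split; [auto with smooth|split].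
  - rewrite Rmult_0_l; ring.
  - revert Hr2; apply filter_imp. intros t ->. cbn [psum].
    assert (H1' : Derive_n mu 1 0 = 0) by exact H1. assert (H0' : Derive_n mu 0 0 = 0) by exact H0.
    rewrite H0', H1'. change (INR (fact 2)) with (1 + 1). simpl pow. field. split; apply INR_fact_neq_0.
Qed.

(** Subtracting theta(0) X gains one order: the derivative of Y - theta(0) X is (theta - theta(0))
    mu, divisible by t^(k+1). The weighted Hadamard lemma gives both quotients and their values at
    0. *)
Lemma front_primitives k X Y mu theta nu : smooth1 theta 0 -> smooth1 nu 0 ->
  locally 0 (fun t => is_derive X t (mu t)) ->
  locally 0 (fun t => is_derive Y t (theta t * mu t)) ->
  locally 0 (fun t => mu t = t ^ k * nu t) ->
  exists u w, smooth1 u 0 /\ smooth1 w 0 /\ u 0 = nu 0 / INR (S k) /\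
    w 0 = Derive theta 0 * nu 0 / INR (S (S k)) /\
    locally 0 (fun t => X t - X 0 = t ^ S k * u t /\
      Y t - Y 0 - theta 0 * (X t - X 0) = t ^ S (S k) * w t).
Proof.
  intros Ht Hn HX HY Hmu.
  destruct (hadamard0 theta Ht) as [rho [R1 [R2 R3]]].
  destruct (hadamard k X nu) as [u [U1 [U2 U3]]]; auto.
  { generalize (filter_and _ _ HX Hmu). apply filter_imp. intros t [A B]. now rewrite B in A. }
  destruct (hadamard (S k) (fun t => Y t - theta 0 * X t) (fun t => rho t * nu t)) as [w [W1 [W2 W3]]];
    [auto with smooth| |].
  { generalize (filter_and _ _ (filter_and _ _ HX HY) (filter_and _ _ Hmu R3)).
    apply filter_imp. intros t [[A B] [C D]]. evar_last.
    - apply (is_derive_minus Y (fun t => theta 0 * X t)); [exact B|].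
      apply (is_derive_scal X), A.
    - unfold minus, plus, opp; simpl. rewrite D, C. ring. }
  exists u, w. split; [|split; [|split; [|split]]]; auto.
  - rewrite W2, R2. reflexivity.
  - generalize (filter_and _ _ U3 W3). apply filter_imp. intros t [A B]. split; lra.
Qed.

Lemma front_cusp_0 X Y mu theta : smooth1 mu 0 -> smooth1 theta 0 ->
  locally 0 (fun t => is_derive X t (mu t)) ->
  locally 0 (fun t => is_derive Y t (theta t * mu t)) ->
  mu 0 = 0 -> Derive mu 0 <> 0 -> Derive theta 0 <> 0 ->
  ordinary_cusp (fun t => (X t, Y t)) 0.
Proof.
  intros Hm Ht HX HY H0 H1 Hth.
  destruct (simple_zero mu Hm H0) as [nu [N1 [N2 N3]]].
  destruct (front_primitives 1 X Y mu theta nu) as [u [w [Hu [Hw [Hu0 [Hw0 HE]]]]]]; auto.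
  assert (Hun : u 0 <> 0).
  { rewrite Hu0, N2. apply Rmult_neq_0; auto. apply Rinv_neq_0_compat. simpl; lra. }
  assert (Hwn : w 0 <> 0).
  { rewrite Hw0, N2. apply Rmult_neq_0; auto.
    apply Rinv_neq_0_compat. simpl; lra. }
  (* The normal forms want positive units; reflections of the two axes by the signs s and r provide
     this. *)
  destruct (sign_exists _ Hun) as [s [Hs Hsu]].
  destruct (sign_exists _ Hwn) as [r [Hr Hrw]].
  set (L := fun q : point => (s * fst q + 0 * snd q + - s * X 0,
     - r * theta 0 * fst q + r * snd q + r * (theta 0 * X 0 - Y 0))).
  apply (A_equivalent_left L).
  { eapply affine_diffeo; [|intros; reflexivity]. destruct Hs, Hr; subst; lra. }
  apply (A_equivalent_ext (fun t => (t ^ 2 * (s * u t), t ^ 3 * (r * w t)))).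
  - revert HE; apply filter_imp. intros t [A B]. unfold L; cbn [fst snd]. f_equal.
    + replace (t ^ 2 * (s * u t)) with (s * (t ^ 2 * u t)) by ring. rewrite <- A. ring.
    + replace (t ^ 3 * (r * w t)) with (r * (t ^ 3 * w t)) by ring. rewrite <- B. ring.
  - apply cusp_normal_form; auto with smooth.
Qed.

Lemma front_E6_0 X Y mu theta : smooth1 mu 0 -> smooth1 theta 0 ->
  locally 0 (fun t => is_derive X t (mu t)) ->
  locally 0 (fun t => is_derive Y t (theta t * mu t)) ->
  mu 0 = 0 -> Derive mu 0 = 0 -> Derive_n mu 2 0 <> 0 -> Derive theta 0 <> 0 ->
  E6_singularity (fun t => (X t, Y t)) 0.
Proof.
  intros Hm Ht HX HY H0 H1 H2 Hth.
  destruct (double_zero mu Hm H0 H1) as [nu [N1 [N2 N3]]].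
  destruct (front_primitives 2 X Y mu theta nu) as [u [w [Hu [Hw [Hu0 [Hw0 HE]]]]]]; auto.
  assert (Hn0 : nu 0 <> 0) by (rewrite N2; lra).
  assert (Hun : u 0 <> 0).
  { rewrite Hu0. apply Rmult_neq_0; auto. apply Rinv_neq_0_compat. simpl; lra. }
  assert (Hwn : w 0 <> 0).
  { rewrite Hw0. apply Rmult_neq_0; auto.
    apply Rinv_neq_0_compat. simpl; lra. }
  destruct (sign_exists _ Hun) as [s [Hs Hsu]].
  destruct (sign_exists _ Hwn) as [r [Hr Hrw]].
  assert (Hs0 : s <> 0) by (destruct Hs; lra). assert (Hr0 : r <> 0) by (destruct Hr; lra).
  set (w1 := fun t => r * w t).
  assert (Hw1 : smooth1 w1 0) by (unfold w1; auto with smooth).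
  (* the shear removing the t^5-term of the second component in the parameter of [E6_normal_form] *)
  set (l := (3 * Derive w1 0 * (s * u 0) / (4 * w1 0) - s * Derive u 0) / w1 0).
  set (L := fun q : point => ((s - l * r * theta 0) * fst q + l * r * snd q
       + (- s * X 0 + l * r * (theta 0 * X 0 - Y 0)),
     - r * theta 0 * fst q + r * snd q + r * (theta 0 * X 0 - Y 0))).
  apply (A_equivalent_left L).
  { eapply affine_diffeo; [|intros; reflexivity].
    replace ((s - l * r * theta 0) * r - l * r * (- r * theta 0)) with (s * r) by ring.
    now apply Rmult_neq_0. }
  apply (A_equivalent_ext (fun t => (t ^ 3 * (s * u t + l * (t * w1 t)), t ^ 4 * w1 t))).
  - revert HE; apply filter_imp. intros t [A B]. unfold L, w1; cbn [fst snd]. f_equal.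
    + replace (t ^ 3 * (s * u t + l * (t * (r * w t)))) with (s * (t ^ 3 * u t) + l * r * (t ^ 4 * w t)) by ring.
      rewrite <- A, <- B. ring.
    + replace (t ^ 4 * (r * w t)) with (r * (t ^ 4 * w t)) by ring. rewrite <- B. ring.
  - assert (HD : Derive (fun t => s * u t + l * (t * w1 t)) 0 = s * Derive u 0 + l * w1 0).
    { apply is_derive_unique. evar_last.
      - apply (is_derive_Rplus (fun t => s * u t) (fun t => l * (t * w1 t))).
        + apply (is_derive_scal u), smooth1_is_derive, Hu.
        + apply (is_derive_scal (fun t => t * w1 t)). apply (is_derive_Rmult (fun t => t) w1).
          * apply is_derive_Rid.
          * apply smooth1_is_derive, Hw1.
      - change (@one R_AbsRing) with 1. unfold plus; simpl. ring. }
    apply E6_normal_form; auto with smooth.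
    + rewrite Rmult_0_l, Rmult_0_r, Rplus_0_r. exact Hsu.
    + rewrite HD. unfold l. rewrite Rmult_0_l, Rmult_0_r, Rplus_0_r. field. unfold w1; lra.
Qed.

Section Front.

Variables (X Y mu theta : R -> R) (t0 : R).
Hypothesis Hmu : smooth1 mu t0.
Hypothesis Htheta : smooth1 theta t0.
Hypothesis HX : locally t0 (fun t => is_derive X t (mu t)).
Hypothesis HY : locally t0 (fun t => is_derive Y t (theta t * mu t)).
Hypothesis Hth : Derive theta t0 <> 0.

Lemma is_derive_shift (f : R -> R) a x l : is_derive f (x + a) l -> is_derive (fun t => f (t + a)) x l.
Proof.
  intros H. evar_last. apply (is_derive_Rcomp f (fun t => t + a)); [exact H|].
  auto_derive; auto. simpl; ring.
Qed.

Lemma Derive_n_shift (f : R -> R) a n x : Derive_n (fun t => f (t + a)) n x = Derive_n f n (x + a).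
Proof. apply Derive_n_comp_trans. Qed.

Let Hmu' : smooth1 (fun t => mu (t + t0)) 0.
Proof. apply smooth1_shift. now rewrite Rplus_0_l. Qed.

Let Htheta' : smooth1 (fun t => theta (t + t0)) 0.
Proof. apply smooth1_shift. now rewrite Rplus_0_l. Qed.

Let HX' : locally 0 (fun t => is_derive (fun t => X (t + t0)) t (mu (t + t0))).
Proof.
  rewrite <- (Rplus_0_l t0) in HX at 1. generalize (locally_shift _ _ _ HX). apply filter_imp.
  intros t. apply (is_derive_shift X).
Qed.

Let HY' : locally 0 (fun t => is_derive (fun t => Y (t + t0)) t (theta (t + t0) * mu (t + t0))).
Proof.
  rewrite <- (Rplus_0_l t0) in HY at 1. generalize (locally_shift _ _ _ HY). apply filter_imp.
  intros t. apply (is_derive_shift Y).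
Qed.

Lemma front_cusp : mu t0 = 0 -> Derive mu t0 <> 0 -> ordinary_cusp (fun t => (X t, Y t)) t0.
Proof.
  intros H0 H1. apply A_equivalent_shift.
  apply (front_cusp_0 _ _ (fun t => mu (t + t0)) (fun t => theta (t + t0))); auto.
  - now rewrite Rplus_0_l.
  - change (Derive_n (fun t => mu (t + t0)) 1 0 <> 0). now rewrite Derive_n_shift, Rplus_0_l.
  - change (Derive_n (fun t => theta (t + t0)) 1 0 <> 0). now rewrite Derive_n_shift, Rplus_0_l.
Qed.

Lemma front_E6 : mu t0 = 0 -> Derive mu t0 = 0 -> Derive_n mu 2 t0 <> 0 ->
  E6_singularity (fun t => (X t, Y t)) t0.
Proof.
  intros H0 H1 H2. apply A_equivalent_shift.
  apply (front_E6_0 _ _ (fun t => mu (t + t0)) (fun t => theta (t + t0))); auto.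
  - now rewrite Rplus_0_l.
  - change (Derive_n (fun t => mu (t + t0)) 1 0 = 0). now rewrite Derive_n_shift, Rplus_0_l.
  - now rewrite Derive_n_shift, Rplus_0_l.
  - change (Derive_n (fun t => theta (t + t0)) 1 0 <> 0). now rewrite Derive_n_shift, Rplus_0_l.
Qed.

End Front.

Lemma A_equivalent_vperp c x d y : A_equivalent (fun t => vperp (c t)) x d y -> A_equivalent c x d y.
Proof.
  apply A_equivalent_left. apply (affine_diffeo vperp 0 1 1 0 0 0); [lra|].
  intros [u v]; unfold vperp; simpl. f_equal; ring.
Qed.

(** * Self-intersection of a front with two cusps *)

Lemma is_derive_continuity_pt f x l : is_derive f x l -> continuity_pt f x.
Proof. intros H. apply derivable_continuous_pt. exists l. now apply is_derive_Reals. Qed.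

Lemma derive_pos_lt (f df : R -> R) u v : u < v ->
  (forall t, u <= t <= v -> is_derive f t (df t)) -> (forall t, u < t < v -> 0 < df t) ->
  f u < f v.
Proof.
  intros Huv H1 H2. destruct (MVT_cor2 f df u v Huv) as [c [Hc1 Hc2]].
  - intros c Hc. apply is_derive_Reals; auto.
  - pose proof (H2 c Hc2). nra.
Qed.

Lemma derive_pos_but_one_lt (f df : R -> R) u c v : u < v ->
  (forall t, u <= t <= v -> is_derive f t (df t)) -> (forall t, u < t < v -> t <> c -> 0 < df t) ->
  f u < f v.
Proof.
  intros Huv H1 H2. destruct (Rlt_dec u c) as [Huc|Huc]; [destruct (Rlt_dec c v) as [Hcv|Hcv]|].
  - apply Rlt_trans with (f c); (eapply derive_pos_lt; [lra| |]); intros t Ht;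
      (apply H1 || apply H2); lra.
  - eapply derive_pos_lt; eauto. intros t Ht; apply H2; lra.
  - eapply derive_pos_lt; eauto. intros t Ht; apply H2; lra.
Qed.

(** The inverse must be continuous at the left endpoint X c too, where the intermediate value
    argument for the crossing starts. So X is continued to the left of c with slope 1, which puts X
    c inside the range. *)
Lemma partial_inverse (X : R -> R) c q : c < q ->
  (forall t, c <= t <= q -> continuity_pt X t) ->
  (forall u v, c <= u -> u < v -> v <= q -> X u < X v) ->
  exists k : R -> R, (forall x, X c <= x <= X q -> c <= k x <= q /\ X (k x) = x) /\
    forall x, X c <= x < X q -> continuity_pt k x.
Proof.
  intros Hcq Hc Hinc.
  (* M(t) = max(c, t), in a form whose continuity is immediate. *)
  set (M := fun t => (c + t + Rabs (t - c)) / 2).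
  assert (HM1 : forall t, c <= t -> M t = t) by (intros t Ht; unfold M; rewrite Rabs_pos_eq; lra).
  assert (HM2 : forall t, t <= c -> M t = c) by (intros t Ht; unfold M; rewrite Rabs_left1; lra).
  set (Xe := fun t => X (M t) + (t - M t)).
  assert (HXe1 : forall t, c <= t -> Xe t = X t) by (intros t Ht; unfold Xe; rewrite HM1; lra).
  assert (HXe2 : forall t, t <= c -> Xe t = X c + (t - c)) by (intros t Ht; unfold Xe; rewrite HM2; lra).
  assert (HMc : forall t, continuity_pt M t).
  { intros t. unfold M, Rdiv. apply continuity_pt_mult; [|apply continuity_pt_const; now intros ? ?].
    apply continuity_pt_plus; [apply continuity_pt_plus; [apply continuity_pt_const; now intros ? ?|apply continuity_pt_id]|].
    apply (continuity_pt_comp (fun t => t - c) Rabs); [|apply Rcontinuity_abs].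
    apply continuity_pt_minus; [apply continuity_pt_id|apply continuity_pt_const; now intros ? ?]. }
  assert (HXc : forall t, c - 1 <= t <= q -> continuity_pt Xe t).
  { intros t Ht. unfold Xe. apply continuity_pt_plus.
    - apply (continuity_pt_comp M X); auto. apply Hc.
      destruct (Rle_dec c t); [rewrite HM1|rewrite HM2]; lra.
    - apply continuity_pt_minus; [apply continuity_pt_id|apply HMc]. }
  assert (HXi : forall u v, c - 1 <= u -> u < v -> v <= q -> Xe u < Xe v).
  { intros u v Hu Huv Hv. destruct (Rle_dec c u) as [H1|H1].
    - rewrite !HXe1 by lra. apply Hinc; lra.
    - rewrite (HXe2 u) by lra. destruct (Rle_dec c v) as [H2|H2].
      + rewrite HXe1 by lra. destruct (Req_EM_T c v) as [->|]; [lra|].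
        assert (X c < X v) by (apply Hinc; lra). lra.
      + rewrite HXe2 by lra. lra. }
  destruct (increasing_inverse Xe (c - 1) q) as [k [Hk Hkc]]; auto; [lra|].
  assert (E1 : Xe (c - 1) = X c - 1) by (rewrite HXe2; lra).
  assert (E2 : Xe q = X q) by (apply HXe1; lra).
  rewrite E1, E2 in Hk, Hkc.
  exists k. split.
  - intros x Hx. destruct (Hk x) as [K1 K2]; [lra|].
    destruct (Rle_dec c (k x)) as [H|H].
    + rewrite HXe1 in K2 by lra. split; [lra|auto].
    + rewrite HXe2 in K2 by lra. lra.
  - intros x Hx. apply Hkc; lra.
Qed.

Section Crossing.

Variables (X Y mu theta : R -> R) (l h c1 c2 p q : R).
Hypothesis Hc : l < c1 /\ c1 < c2 /\ c2 < h.
Hypothesis HX : forall t, l < t < h -> is_derive X t (mu t).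
Hypothesis HY : forall t, l < t < h -> is_derive Y t (theta t * mu t).
Hypothesis Hth : forall u v, l < u -> u < v -> v < h -> theta u < theta v.
Hypothesis Hmu1 : forall t, l < t < c1 -> 0 < mu t.
Hypothesis Hmu2 : forall t, c1 < t < c2 -> mu t < 0.
Hypothesis Hmu3 : forall t, c2 < t < h -> 0 < mu t.

Lemma is_derive_tangent_height a t : l < t < h ->
  is_derive (fun t => Y t - a * X t) t ((theta t - a) * mu t).
Proof.
  intros Ht. evar_last.
  - apply (is_derive_minus Y (fun t => a * X t)); [now apply HY|]. now apply (is_derive_scal X), HX.
  - unfold minus, plus, opp; simpl. ring.
Qed.

(* [theta - theta c1] and [mu] change sign together at [c1], so the height above the
   cuspidal tangent is monotone through the cusp. *)
Lemma height_first u v : l < u -> u < v -> v <= c2 ->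
  Y v - theta c1 * X v < Y u - theta c1 * X u.
Proof.
  intros Hu Huv Hv.
  enough (- (Y u - theta c1 * X u) < - (Y v - theta c1 * X v)) by lra.
  apply (derive_pos_but_one_lt (fun t => - (Y t - theta c1 * X t)) (fun t => - ((theta t - theta c1) * mu t)) u c1 v); auto.
  - intros t Ht. apply (is_derive_opp (fun t => Y t - theta c1 * X t)), is_derive_tangent_height. lra.
  - intros t Ht Htc. destruct (Rlt_dec t c1).
    + pose proof (Hmu1 t). pose proof (Hth t c1). nra.
    + pose proof (Hmu2 t). pose proof (Hth c1 t). nra.
Qed.

Lemma height_last u v : c1 <= u -> u < v -> v < h ->
  Y u - theta c2 * X u < Y v - theta c2 * X v.
Proof.
  intros Hu Huv Hv.
  apply (derive_pos_but_one_lt (fun t => Y t - theta c2 * X t) (fun t => (theta t - theta c2) * mu t) u c2 v); auto.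
  - intros t Ht. apply is_derive_tangent_height. lra.
  - intros t Ht Htc. destruct (Rlt_dec t c2).
    + pose proof (Hmu2 t). pose proof (Hth t c2). nra.
    + pose proof (Hmu3 t). pose proof (Hth c2 t). nra.
Qed.

(** If u >= c1, the height over the second cuspidal tangent is strictly increasing from u to v; if v
    <= c2, the height over the first one is strictly decreasing. Both exclude equal points. *)
Lemma crossing_branches u v : l < u -> u < v -> v < h -> X u = X v -> Y u = Y v -> u < c1 /\ c2 < v.
Proof.
  intros Hu Huv Hv EX EY. split; apply Rnot_le_lt; intros H.
  - pose proof (height_last u v H Huv Hv). rewrite EX, EY in *. lra.
  - pose proof (height_first u v Hu Huv H). rewrite EX, EY in *. lra.
Qed.

Lemma first_branch_incr u v : l < u -> u < v -> v <= c1 -> X u < X v.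
Proof.
  intros Hu Huv Hv. apply (derive_pos_lt X mu); auto; intros t Ht; [apply HX|apply Hmu1]; lra.
Qed.

Lemma last_branch_incr u v : c2 <= u -> u < v -> v < h -> X u < X v.
Proof.
  intros Hu Huv Hv. apply (derive_pos_lt X mu); auto; intros t Ht; [apply HX|apply Hmu3]; lra.
Qed.

(** Compare heights over the tangent direction at u'. On the first branch slopes are smaller than
    theta(u'), so the height falls from u to u'; on the last they are larger, so it rises from v to
    v'. The two changes would have to be equal. *)
Lemma crossing_not_before u v u' v' : l < u -> u < u' -> u' < c1 -> c2 < v -> v < h -> c2 < v' -> v' < h ->
  X u = X v -> Y u = Y v -> X u' = X v' -> Y u' = Y v' -> False.
Proof.
  intros Hu Huu Hu' Hv Hvh Hv' Hvh' EX EY EX' EY'.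
  assert (HX1 : X u < X u') by (apply first_branch_incr; lra).
  assert (Hvv : v < v').
  { apply Rnot_le_lt. intros H. destruct (Req_EM_T v v') as [->|]; [lra|].
    assert (X v' < X v) by (apply last_branch_incr; lra). lra. }
  assert (A : - (Y u - theta u' * X u) < - (Y u' - theta u' * X u')).
  { apply (derive_pos_lt (fun t => - (Y t - theta u' * X t)) (fun t => - ((theta t - theta u') * mu t))); auto.
    - intros t Ht. apply (is_derive_opp (fun t => Y t - theta u' * X t)), is_derive_tangent_height. lra.
    - intros t Ht. pose proof (Hmu1 t). pose proof (Hth t u'). nra. }
  assert (B : Y v - theta u' * X v < Y v' - theta u' * X v').
  { apply (derive_pos_lt (fun t => Y t - theta u' * X t) (fun t => (theta t - theta u') * mu t)); auto.
    - intros t Ht. apply is_derive_tangent_height. lra.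
    - intros t Ht. pose proof (Hmu3 t). pose proof (Hth u' t). nra. }
  rewrite EX, EY, EX', EY' in A. lra.
Qed.

Lemma crossing_unique u v u' v' : l < u -> u < v -> v < h -> l < u' -> u' < v' -> v' < h ->
  X u = X v -> Y u = Y v -> X u' = X v' -> Y u' = Y v' -> u = u' /\ v = v'.
Proof.
  intros Hu Huv Hv Hu' Huv' Hv' EX EY EX' EY'.
  destruct (crossing_branches u v) as [A1 A2]; auto.
  destruct (crossing_branches u' v') as [B1 B2]; auto.
  assert (E : u = u').
  { destruct (Rtotal_order u u') as [L|[L|L]]; auto; exfalso.
    - apply (crossing_not_before u v u' v'); auto.
    - apply (crossing_not_before u' v' u v); auto. }
  split; auto. subst u'.
  destruct (Rtotal_order v v') as [L|[L|L]]; auto; exfalso.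
  - assert (X v < X v') by (apply last_branch_incr; lra). lra.
  - assert (X v' < X v) by (apply last_branch_incr; lra). lra.
Qed.

(** D(u) compares the last branch with the first one over the same abscissa. It changes sign between
    the abscissas of the two cusps, and a zero of D is a crossing. *)
Lemma crossing_exists : l < p < c1 -> c2 < q < h -> X p < X c2 -> X c1 < X q ->
  exists t1 t2, l < t1 /\ t1 < c1 /\ c2 < t2 /\ t2 < h /\ X t1 = X t2 /\ Y t1 = Y t2.
Proof.
  intros Hp Hq HXp HXq.
  assert (HC : forall t, l < t < h -> continuity_pt X t)
    by (intros t Ht; eapply is_derive_continuity_pt, HX; auto).
  assert (HCY : forall t, l < t < h -> continuity_pt Y t)
    by (intros t Ht; eapply is_derive_continuity_pt, HY; auto).
  assert (H12 : X c2 < X c1).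
  { enough (- X c1 < - X c2) by lra.
    apply (derive_pos_lt (fun t => - X t) (fun t => - mu t)); [lra| |]; intros t Ht.
    - apply (is_derive_opp X), HX. lra.
    - pose proof (Hmu2 t Ht). lra. }
  (* p' is the point of the first branch lying over the second cusp. *)
  destruct (f_interv_is_interv X p c1 (X c2)) as [p' [Hp1 Hp2]]; [lra|lra|intros; apply HC; lra|].
  assert (Hp'c : p' < c1).
  { apply Rnot_le_lt. intros H. replace p' with c1 in Hp2 by lra. lra. }
  destruct (partial_inverse X c2 q) as [k [Hk1 Hk2]]; [lra|intros; apply HC; lra|intros; apply last_branch_incr; lra|].
  assert (HXu : forall u, p' <= u <= c1 -> X c2 <= X u <= X c1).
  { intros u Hu. split.
    - rewrite <- Hp2. destruct (Req_EM_T p' u) as [->|]; [lra|]. left; apply first_branch_incr; lra.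
    - destruct (Req_EM_T u c1) as [->|]; [lra|]. left; apply first_branch_incr; lra. }
  set (D := fun u => Y (k (X u)) - Y u).
  assert (HD1 : D p' < 0).
  (* Over p' the last branch is at the cusp c2, and p' and c2 have equal X, so [height_first]
     compares their Y directly. *)
  { unfold D. assert (E : k (X p') = c2).
    { destruct (Hk1 (X p')) as [K1 K2]; [rewrite Hp2; lra|].
      destruct (Req_EM_T (k (X p')) c2) as [|Hne]; auto.
      assert (X c2 < X (k (X p'))) by (apply last_branch_incr; lra). lra. }
    rewrite E. pose proof (height_first p' c2). rewrite Hp2 in *. lra. }
  assert (HD2 : 0 < D c1).
  { unfold D. destruct (Hk1 (X c1)) as [K1 K2]; [lra|].
    pose proof (height_last c1 (k (X c1))). rewrite K2 in *.
    destruct (Req_EM_T (k (X c1)) c2) as [E|]; [rewrite E in K2; lra|]. lra. }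
  destruct (IVT_interv D p' c1) as [z [Hz1 Hz2]]; auto.
  { intros u Hu. pose proof (HXu u Hu). unfold D.
    apply continuity_pt_minus; [|apply HCY; lra].
    apply (continuity_pt_comp (fun u => k (X u)) Y).
    - apply (continuity_pt_comp X k); [apply HC; lra|apply Hk2; lra].
    - apply HCY. pose proof (Hk1 (X u)). lra. }
  pose proof (HXu z Hz1) as HXz. destruct (Hk1 (X z)) as [K1 K2]; [lra|].
  assert (EY : Y z = Y (k (X z))) by (unfold D in Hz2; lra).
  destruct (crossing_branches z (k (X z))) as [B1 B2]; auto; try lra.
  exists z, (k (X z)). repeat split; auto; lra.
Qed.

End Crossing.

(** * Curvature, vertices and the zeros of vnum *)

Lemma Derive_mult_zero f g t : smooth1 f t -> smooth1 g t -> f t = 0 ->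
  Derive (fun u => f u * g u) t = Derive f t * g t.
Proof.
  intros Hf Hg H0. apply is_derive_unique. evar_last.
  apply is_derive_Rmult; now apply smooth1_is_derive. rewrite H0. ring.
Qed.

Lemma Derive2_mult_zero f g t : smooth1 f t -> smooth1 g t -> f t = 0 -> Derive f t = 0 ->
  Derive_n (fun u => f u * g u) 2 t = Derive_n f 2 t * g t.
Proof.
  intros Hf Hg H0 H1.
  change (Derive (Derive (fun u => f u * g u)) t = Derive (Derive f) t * g t).
  rewrite (Derive_ext_loc _ (fun u => Derive f u * g u + f u * Derive g u)).
  - apply is_derive_unique. pose proof (smooth1_Derive _ _ Hf). pose proof (smooth1_Derive _ _ Hg).
    evar_last. apply (is_derive_Rplus (fun u => Derive f u * g u) (fun u => f u * Derive g u));
      apply is_derive_Rmult; now apply smooth1_is_derive.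
    rewrite H0, H1. unfold plus; simpl. ring.
  - generalize (filter_and _ _ (smooth1_locally _ _ Hf) (smooth1_locally _ _ Hg)).
    apply filter_imp. intros u [A B]. apply is_derive_unique.
    apply is_derive_Rmult; now apply smooth1_is_derive.
Qed.

(* curvature = knum / |qform|^(3/2), curvature' = vnum / (qform |qform|^(3/2)) and
   evolute' = - (vnum / knum^2) vperp(vel): vertices of the curve are the zeros of [vnum],
   and so are the singular points of the evolute. *)
Definition qform (c : R -> point) (t : R) : R := mink (vel c t) (vel c t).
Definition knum (c : R -> point) (t : R) : R := mink (acc c t) (vperp (vel c t)).
Definition vnum (c : R -> point) (t : R) : R :=
  Derive (knum c) t * qform c t - 3 / 2 * knum c t * Derive (qform c) t.

Section Curve.

Variable c : R -> point.
Variable t : R.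
Hypothesis Hc : smooth_curve c t.

Lemma smooth1_vel1 : smooth1 (fun u => fst (vel c u)) t.
Proof. exact (smooth1_Derive _ _ (proj1 Hc)). Qed.

Lemma smooth1_vel2 : smooth1 (fun u => snd (vel c u)) t.
Proof. exact (smooth1_Derive _ _ (proj2 Hc)). Qed.

Lemma smooth1_acc1 : smooth1 (fun u => fst (acc c u)) t.
Proof. exact (smooth1_Derive _ _ smooth1_vel1). Qed.

Lemma smooth1_acc2 : smooth1 (fun u => snd (acc c u)) t.
Proof. exact (smooth1_Derive _ _ smooth1_vel2). Qed.

Hint Resolve smooth1_vel1 smooth1_vel2 smooth1_acc1 smooth1_acc2 smooth1_Derive : smooth.

Lemma smooth1_qform : smooth1 (qform c) t.
Proof. unfold qform, mink. auto with smooth. Qed.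

Lemma smooth1_knum : smooth1 (knum c) t.
Proof. unfold knum, mink, vperp; simpl. auto with smooth. Qed.

Hint Resolve smooth1_qform smooth1_knum : smooth.

Lemma smooth1_vnum : smooth1 (vnum c) t.
Proof. unfold vnum. auto 10 with smooth. Qed.

Lemma Derive_qform : Derive (qform c) t =
  2 * (- fst (vel c t) * fst (acc c t) + snd (vel c t) * snd (acc c t)).
Proof.
  apply is_derive_unique.
  assert (D1 : is_derive (fun u => fst (vel c u)) t (fst (acc c t))) by exact (smooth1_is_derive _ _ smooth1_vel1).
  assert (D2 : is_derive (fun u => snd (vel c u)) t (snd (acc c t))) by exact (smooth1_is_derive _ _ smooth1_vel2).
  evar_last.
  - apply (is_derive_Rplus (fun u => - (fst (vel c u) * fst (vel c u))) (fun u => snd (vel c u) * snd (vel c u))).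
    + apply (is_derive_opp (fun u => fst (vel c u) * fst (vel c u))). apply is_derive_Rmult; exact D1.
    + apply is_derive_Rmult; exact D2.
  - unfold plus, opp; simpl. change (Derive (fun u => fst (c u)) t) with (fst (vel c t)).
    change (Derive (fun u => snd (c u)) t) with (snd (vel c t)). simpl. ring.
Qed.

Lemma knum_expr : knum c t = - (fst (acc c t) * snd (vel c t)) + snd (acc c t) * fst (vel c t).
Proof. reflexivity. Qed.

Lemma qform_expr : qform c t = - (fst (vel c t) * fst (vel c t)) + snd (vel c t) * snd (vel c t).
Proof. reflexivity. Qed.

End Curve.

#[export] Hint Resolve smooth1_vel1 smooth1_vel2 smooth1_acc1 smooth1_acc2 smooth1_Derive
  smooth1_qform smooth1_knum smooth1_vnum : smooth.

Lemma smooth_curve_locally_smooth c t : smooth_curve c t -> locally t (smooth_curve c).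
Proof.
  intros [H1 H2]. generalize (filter_and _ _ (smooth1_locally _ _ H1) (smooth1_locally _ _ H2)).
  apply filter_imp. intros u [A B]; now split.
Qed.

(** The non-vanishing factor in curvature' = vnum * omega. Once it is split off, the order of a
    vertex is the order of vanishing of vnum. *)
Definition omega (c : R -> point) (t : R) : R :=
  / (qform c t * Rpower (Rabs (qform c t)) (3 / 2)).

Lemma omega_neq_0 c t : qform c t <> 0 -> omega c t <> 0.
Proof.
  intros H. apply Rinv_neq_0_compat, Rmult_neq_0; auto.
  pose proof (exp_pos (3 / 2 * ln (Rabs (qform c t)))). unfold Rpower; lra.
Qed.

Section Nonlightlike.

Variable c : R -> point.
Variable t : R.
Hypothesis Hc : smooth_curve c t.
Hypothesis Hq : qform c t <> 0.

(** Near a non-lightlike point |q| is s q with a constant sign s, which makes the absolute value in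
    the curvature smooth. *)
Lemma qform_sign : exists s, (s = 1 \/ s = -1) /\ locally t (fun u => 0 < s * qform c u /\ Rabs (qform c u) = s * qform c u).
Proof.
  destruct (sign_exists _ Hq) as [s [Hs Hsq]]. exists s; split; auto.
  assert (K : smooth1 (fun u => s * qform c u) t) by auto with smooth.
  generalize (continuity_pt_pos _ _ (smooth1_continuity _ _ K) Hsq). apply filter_imp.
  intros u Hu; split; auto. destruct Hs as [->| ->]; [rewrite Rabs_pos_eq|rewrite Rabs_left]; lra.
Qed.

Lemma smooth1_abs_power : smooth1 (fun u => Rpower (Rabs (qform c u)) (3 / 2)) t.
Proof.
  destruct qform_sign as [s [Hs Hl]].
  apply (smooth1_ext (fun u => Rpower (s * qform c u) (3 / 2))).
  - revert Hl; apply filter_imp. intros u [_ ->]; auto.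
  - apply (smooth1_comp (fun x => Rpower x (3 / 2))); auto with smooth.
    apply smooth1_Rpower. apply locally_singleton in Hl; tauto.
Qed.

Lemma smooth1_omega : smooth1 (omega c) t.
Proof.
  apply (smooth1_comp Rinv).
  - apply smooth1_inv. intros E. apply (omega_neq_0 c t Hq). unfold omega. rewrite E. apply Rinv_0.
  - pose proof smooth1_abs_power. auto with smooth.
Qed.

Lemma is_derive_curvature : is_derive (curvature c) t (vnum c t * omega c t).
Proof.
  destruct qform_sign as [s [Hs Hl]].
  apply (is_derive_ext_loc (fun u => knum c u * / Rpower (s * qform c u) (3 / 2))).
  { revert Hl; apply filter_imp. intros u [_ E]. unfold curvature.
    change (mink (vel c u) (vel c u)) with (qform c u). now rewrite E. }
  pose proof (locally_singleton _ _ Hl) as [Hpos Habs]. cbv beta in *.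
  assert (Dr : is_derive (fun x => Rpower x (3 / 2)) (s * qform c t) (3 / 2 * Rpower (s * qform c t) (3 / 2 - 1))).
  { apply is_derive_Reals, derivable_pt_lim_power; auto. }
  (* All powers are expressed through r = (s q)^(1/2), leaving [field] a rational identity in r. *)
  assert (Er : Rpower (s * qform c t) (3 / 2) = Rpower (s * qform c t) (3 / 2 - 1) * (s * qform c t)).
  { rewrite <- (Rpower_1 (s * qform c t)) at 3 by auto. rewrite <- Rpower_plus. f_equal; ring. }
  set (r := Rpower (s * qform c t) (3 / 2 - 1)) in *.
  assert (Hr : 0 < r) by apply exp_pos.
  evar_last.
  - apply is_derive_Rmult; [apply smooth1_is_derive; auto with smooth|].
    apply (is_derive_inv (fun u => Rpower (s * qform c u) (3 / 2))).
    + apply (is_derive_Rcomp (fun x => Rpower x (3 / 2)) (fun u => s * qform c u)); [exact Dr|].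
      apply (is_derive_scal (qform c)), smooth1_is_derive. auto with smooth.
    + rewrite Er. apply Rmult_neq_0; lra.
  - cbv beta. unfold vnum, omega. rewrite Habs, Er.
    assert (s * s = 1) by (destruct Hs; subst; ring).
    assert (s <> 0) by (destruct Hs; lra).
    field. repeat split; auto; lra.
Qed.

End Nonlightlike.

Lemma locally_regular c t : smooth_curve c t -> qform c t <> 0 ->
  locally t (fun u => smooth_curve c u /\ qform c u <> 0).
Proof.
  intros Hc Hq. apply filter_and; [now apply smooth_curve_locally_smooth|].
  apply smooth1_neq_0; auto with smooth.
Qed.

Lemma Derive_curvature_locally c t : smooth_curve c t -> qform c t <> 0 ->
  locally t (fun u => Derive (curvature c) u = vnum c u * omega c u).
Proof.
  intros Hc Hq. generalize (locally_regular c t Hc Hq). apply filter_imp.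
  intros u [A B]. now apply is_derive_unique, is_derive_curvature.
Qed.

Lemma vertex_vnum c t : smooth_curve c t -> (vertex c t <-> qform c t <> 0 /\ vnum c t = 0).
Proof.
  intros Hc. split.
  - intros [Hq HD]; split; auto. change (qform c t <> 0) in Hq.
    rewrite (locally_singleton _ _ (Derive_curvature_locally c t Hc Hq)) in HD.
    apply Rmult_integral in HD as [|E]; auto. now destruct (omega_neq_0 c t Hq).
  - intros [Hq HG]; split; auto.
    rewrite (locally_singleton _ _ (Derive_curvature_locally c t Hc Hq)), HG. ring.
Qed.

Lemma Derive_n_curvature_2 c t : smooth_curve c t -> qform c t <> 0 -> vnum c t = 0 ->
  Derive_n (curvature c) 2 t = Derive (vnum c) t * omega c t.
Proof.
  intros Hc Hq HG. change (Derive (Derive (curvature c)) t = Derive (vnum c) t * omega c t).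
  rewrite (Derive_ext_loc _ _ _ (Derive_curvature_locally c t Hc Hq)).
  apply Derive_mult_zero; auto using smooth1_omega with smooth.
Qed.

(** By Leibniz' rule, as long as the lower derivatives of vnum vanish, each derivative of vnum *
    omega at t is omega times that of vnum. *)
Lemma vertex_of_order_2_vnum c t : smooth_curve c t -> vertex_of_order 2 c t ->
  qform c t <> 0 /\ vnum c t = 0 /\ Derive (vnum c) t = 0 /\ Derive_n (vnum c) 2 t <> 0.
Proof.
  intros Hc [Hq [H12 H3]]. change (qform c t <> 0) in Hq.
  pose proof (omega_neq_0 c t Hq) as Ho.
  assert (G0 : vnum c t = 0).
  { apply vertex_vnum; auto. split; auto. apply (H12 1%nat); auto. }
  assert (G1 : Derive (vnum c) t = 0).
  { pose proof (H12 2%nat ltac:(auto)) as E. rewrite Derive_n_curvature_2 in E by auto.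
    apply Rmult_integral in E as [|]; auto; contradiction. }
  repeat split; auto. intros G2. apply H3.
  change (Derive_n (curvature c) 3 t) with (Derive (Derive (Derive_n (curvature c) 1)) t).
  rewrite (Derive_ext_loc _ (Derive (fun u => vnum c u * omega c u))).
  - change (Derive_n (fun u => vnum c u * omega c u) 2 t = 0).
    rewrite Derive2_mult_zero; auto using smooth1_omega with smooth. rewrite G2; ring.
  - generalize (locally_locally _ _ (Derive_curvature_locally c t Hc Hq)).
    apply filter_imp. intros u Hu. now apply Derive_ext_loc.
Qed.

Lemma simple_vertex c t : smooth_curve c t -> qform c t <> 0 -> vnum c t = 0 ->
  Derive (vnum c) t <> 0 -> vertex_of_order 1 c t.
Proof.
  intros Hc Hq G0 G1. split; [exact Hq|split].
  - intros i Hi. replace i with 1%nat by lia. apply vertex_vnum; auto.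
  - rewrite Derive_n_curvature_2 by auto. apply Rmult_neq_0; auto.
    now apply omega_neq_0.
Qed.

(** With r = |q|^(3/2), curvature = P / r and at a vertex curvature'' = G' / (q r); the product is P
    q G' / (q^2 r^2). *)
Lemma curvature_curvature2_sign c t : smooth_curve c t -> qform c t <> 0 -> vnum c t = 0 ->
  exists k, 0 < k /\ curvature c t * Derive_n (curvature c) 2 t =
    k * (knum c t * qform c t * Derive (vnum c) t).
Proof.
  intros Hc Hq G0. rewrite Derive_n_curvature_2 by auto. unfold curvature, omega.
  change (mink (vel c t) (vel c t)) with (qform c t). change (mink (acc c t) (vperp (vel c t))) with (knum c t).
  set (r := Rpower (Rabs (qform c t)) (3 / 2)). assert (Hr : 0 < r) by apply exp_pos.
  exists (/ (r ^ 2 * qform c t ^ 2)). split.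
  - apply Rinv_0_lt_compat, Rmult_lt_0_compat; [apply pow_lt; lra|now apply pow2_gt_0].
  - field. split; auto; lra.
Qed.

(** * The evolute *)

(** The sign in the definition of N and the sign in |q| = -q or q compensate each other, so timelike
    and spacelike points share one formula without roots. *)
Lemma evolute_expr c t : qform c t <> 0 -> knum c t <> 0 ->
  evolute c t = (fst (c t) + qform c t / knum c t * snd (vel c t),
                 snd (c t) + qform c t / knum c t * fst (vel c t)).
Proof.
  intros Hq HP. unfold evolute, normal, curvature, mnorm.
  change (mink (vel c t) (vel c t)) with (qform c t). change (mink (acc c t) (vperp (vel c t))) with (knum c t).
  set (q := qform c t) in *. set (P := knum c t) in *.
  assert (Habs : 0 < Rabs q) by now apply Rabs_pos_lt.
  assert (Hr : Rpower (Rabs q) (3 / 2) = Rabs q * sqrt (Rabs q)).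
  { replace (3 / 2) with (1 + / 2) by field. rewrite Rpower_plus, Rpower_1, Rpower_sqrt; auto. }
  rewrite Hr. pose proof (sqrt_lt_R0 _ Habs) as Hs.
  destruct (Rlt_dec q 0) as [Hn|Hn]; unfold vsub, vscal, vperp; cbn [fst snd].
  - rewrite Rabs_left in * by lra. f_equal; field; repeat split; auto; lra.
  - rewrite Rabs_pos_eq in * by lra. f_equal; field; repeat split; auto; lra.
Qed.

Definition coord (b : bool) (p : point) : R := if b then snd p else fst p.

(* The evolute is a front: its coordinates X = [coord b], Y = [coord (negb b)] satisfy
   X' = [front_mu], Y' = [front_slope * front_mu], where [b] is chosen so that the
   denominator of [front_slope] does not vanish. *)
Definition front_mu (c : R -> point) (b : bool) (t : R) : R :=
  vnum c t * (- coord (negb b) (vel c t) / knum c t ^ 2).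

Definition front_slope (c : R -> point) (b : bool) (t : R) : R :=
  coord b (vel c t) / coord (negb b) (vel c t).

(** Here v' is one coordinate of the velocity, v the other, and a is the derivative of v. The
    hypothesis is a coordinate of P v + q a^perp = (q'/2) v^perp for the velocity v and acceleration
    a, which leaves only a multiple of v^perp in the derivative of the evolute. *)
Lemma evolute_algebra v v' a P P' q q' : P <> 0 -> v' * P + q * a = q' / 2 * v ->
  v' + ((q' * P - q * P') / P ^ 2 * v + q / P * a) = (P' * q - 3 / 2 * P * q') * (- v / P ^ 2).
Proof.
  intros HP H. replace v' with ((q' / 2 * v - q * a) / P) by (rewrite <- H; field; auto).
  field; auto.
Qed.

Section Evolute.

Variable c : R -> point.
Variable t : R.
Hypothesis Hc : smooth_curve c t.
Hypothesis Hq : qform c t <> 0.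
Hypothesis HP : knum c t <> 0.

Lemma locally_evolute_expr : locally t (fun u => evolute c u =
   (fst (c u) + qform c u / knum c u * snd (vel c u), snd (c u) + qform c u / knum c u * fst (vel c u))).
Proof.
  assert (H1 : locally t (fun u => qform c u <> 0)) by (apply smooth1_neq_0; auto with smooth).
  assert (H2 : locally t (fun u => knum c u <> 0)) by (apply smooth1_neq_0; auto with smooth).
  generalize (filter_and _ _ H1 H2). apply filter_imp. intros u [A B]. now apply evolute_expr.
Qed.

Lemma smooth_curve_evolute : smooth_curve (evolute c) t.
Proof.
  pose proof (proj1 Hc) as H1. pose proof (proj2 Hc) as H2.
  split.
  - eapply smooth1_ext; [|apply (smooth1_plus (fun u => fst (c u)) (fun u => qform c u / knum c u * snd (vel c u)))]; auto with smooth.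
    generalize locally_evolute_expr. apply filter_imp. intros u ->; reflexivity.
  - eapply smooth1_ext; [|apply (smooth1_plus (fun u => snd (c u)) (fun u => qform c u / knum c u * fst (vel c u)))]; auto with smooth.
    generalize locally_evolute_expr. apply filter_imp. intros u ->; reflexivity.
Qed.

Lemma is_derive_quotient : is_derive (fun u => qform c u / knum c u) t
  ((Derive (qform c) t * knum c t - qform c t * Derive (knum c) t) / knum c t ^ 2).
Proof.
  apply (is_derive_div (qform c) (knum c)); auto; apply smooth1_is_derive; auto with smooth.
Qed.

Lemma is_derive_evolute b : is_derive (fun u => coord b (evolute c u)) t
   (vnum c t * (- coord (negb b) (vel c t) / knum c t ^ 2)).
Proof.
  assert (D1 : is_derive (fun u => fst (c u)) t (fst (vel c t))) by exact (smooth1_is_derive _ _ (proj1 Hc)).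
  assert (D2 : is_derive (fun u => snd (c u)) t (snd (vel c t))) by exact (smooth1_is_derive _ _ (proj2 Hc)).
  assert (D3 : is_derive (fun u => fst (vel c u)) t (fst (acc c t))) by exact (smooth1_is_derive _ _ (smooth1_vel1 c t Hc)).
  assert (D4 : is_derive (fun u => snd (vel c u)) t (snd (acc c t))) by exact (smooth1_is_derive _ _ (smooth1_vel2 c t Hc)).
  pose proof (Derive_qform c t Hc) as Eq.
  pose proof (knum_expr c t) as EP. pose proof (qform_expr c t) as EQ.
  destruct b; cbn [coord negb].
  - apply (is_derive_ext_loc (fun u => snd (c u) + qform c u / knum c u * fst (vel c u))).
    { generalize locally_evolute_expr. apply filter_imp. intros u ->; reflexivity. }
    evar_last.
    + apply (is_derive_Rplus (fun u => snd (c u)) (fun u => qform c u / knum c u * fst (vel c u))); [exact D2|].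
      apply is_derive_Rmult; [apply is_derive_quotient|exact D3].
    + apply evolute_algebra; auto. rewrite Eq, EQ, EP. field.
  - apply (is_derive_ext_loc (fun u => fst (c u) + qform c u / knum c u * snd (vel c u))).
    { generalize locally_evolute_expr. apply filter_imp. intros u ->; reflexivity. }
    evar_last.
    + apply (is_derive_Rplus (fun u => fst (c u)) (fun u => qform c u / knum c u * snd (vel c u))); [exact D1|].
      apply is_derive_Rmult; [apply is_derive_quotient|exact D4].
    + apply evolute_algebra; auto. rewrite Eq, EQ, EP. field.
Qed.

End Evolute.

Lemma nonlightlike_coord c t : qform c t <> 0 -> exists b, coord (negb b) (vel c t) <> 0.
Proof.
  intros Hq. destruct (Req_EM_T (snd (vel c t)) 0) as [E|E]; [|now exists false].
  exists true. simpl. intros E1. apply Hq. rewrite qform_expr. simpl in *. rewrite E, E1. ring.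
Qed.

Section CurveFront.

Variable c : R -> point.
Variable b : bool.
Variable t : R.
Hypothesis Hc : smooth_curve c t.
Hypothesis Hq : qform c t <> 0.
Hypothesis HP : knum c t <> 0.
Hypothesis Hb : coord (negb b) (vel c t) <> 0.

Lemma smooth1_coord_vel b' : smooth1 (fun u => coord b' (vel c u)) t.
Proof. destruct b'; [apply (smooth1_vel2 c t Hc)|apply (smooth1_vel1 c t Hc)]. Qed.

Lemma locally_curve_front : locally t (fun u => smooth_curve c u /\ qform c u <> 0 /\
   knum c u <> 0 /\ coord (negb b) (vel c u) <> 0).
Proof.
  apply filter_and; [|apply filter_and; [|apply filter_and]].
  - now apply smooth_curve_locally_smooth.
  - apply smooth1_neq_0; auto with smooth.
  - apply smooth1_neq_0; auto with smooth.
  - apply (smooth1_neq_0 (fun u => coord (negb b) (vel c u))); auto. apply smooth1_coord_vel.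
Qed.

Lemma smooth1_front_factor : smooth1 (fun u => - coord (negb b) (vel c u) / knum c u ^ 2) t.
Proof.
  pose proof (smooth1_coord_vel (negb b)).
  apply smooth1_div; auto with smooth. now apply pow_nonzero.
Qed.

Lemma smooth1_front_mu : smooth1 (front_mu c b) t.
Proof. apply smooth1_mult; [auto with smooth|apply smooth1_front_factor]. Qed.

Lemma smooth1_front_slope : smooth1 (front_slope c b) t.
Proof. apply smooth1_div; auto using smooth1_coord_vel. Qed.

Lemma front_factor_neq_0 : - coord (negb b) (vel c t) / knum c t ^ 2 <> 0.
Proof.
  apply Rmult_neq_0; [lra|]. now apply Rinv_neq_0_compat, pow_nonzero.
Qed.

Lemma is_derive_evolute_mu : is_derive (fun u => coord b (evolute c u)) t (front_mu c b t).
Proof. now apply is_derive_evolute. Qed.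

Lemma is_derive_evolute_slope :
  is_derive (fun u => coord (negb b) (evolute c u)) t (front_slope c b t * front_mu c b t).
Proof.
  evar_last; [now apply is_derive_evolute|].
  unfold front_slope, front_mu. destruct b; simpl in *; field; auto.
Qed.

(** The tangent direction of the evolute is v^perp, so its slope turns exactly as the velocity does,
    at a rate proportional to P. *)
Lemma Derive_front_slope : Derive (front_slope c b) t =
  (if b then 1 else -1) * knum c t / coord (negb b) (vel c t) ^ 2.
Proof.
  apply is_derive_unique. unfold front_slope. rewrite knum_expr.
  assert (D1 : is_derive (fun u => fst (vel c u)) t (fst (acc c t))) by exact (smooth1_is_derive _ _ (smooth1_vel1 c t Hc)).
  assert (D2 : is_derive (fun u => snd (vel c u)) t (snd (acc c t))) by exact (smooth1_is_derive _ _ (smooth1_vel2 c t Hc)).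
  destruct b; cbn [coord negb] in *.
  - evar_last; [apply (is_derive_div (fun u => snd (vel c u)) (fun u => fst (vel c u))); eauto|].
    cbv beta. field; auto.
  - evar_last; [apply (is_derive_div (fun u => fst (vel c u)) (fun u => snd (vel c u))); eauto|].
    cbv beta. field; auto.
Qed.

Lemma Derive_front_slope_neq_0 : Derive (front_slope c b) t <> 0.
Proof.
  rewrite Derive_front_slope. apply Rmult_neq_0.
  - apply Rmult_neq_0; auto. destruct b; lra.
  - now apply Rinv_neq_0_compat, pow_nonzero.
Qed.

End CurveFront.

Lemma A_equivalent_coord e b x d y :
  A_equivalent (fun t => (coord b (e t), coord (negb b) (e t))) x d y -> A_equivalent e x d y.
Proof.
  intros H. destruct b; [apply A_equivalent_vperp|]; revert H; apply A_equivalent_ext; apply filter_forall;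
    intros t; simpl; [reflexivity|symmetry; apply surjective_pairing].
Qed.

Lemma locally_evolute_front c b t : smooth_curve c t -> qform c t <> 0 -> knum c t <> 0 ->
  coord (negb b) (vel c t) <> 0 ->
  locally t (fun u => is_derive (fun u => coord b (evolute c u)) u (front_mu c b u)) /\
  locally t (fun u => is_derive (fun u => coord (negb b) (evolute c u)) u (front_slope c b u * front_mu c b u)).
Proof.
  intros Hc Hq HP Hb. split; generalize (locally_curve_front c b t Hc Hq HP Hb); apply filter_imp;
    intros u [H1 [H2 [H3 H4]]]; [now apply is_derive_evolute_mu|now apply is_derive_evolute_slope].
Qed.

Lemma evolute_ordinary_cusp c t : smooth_curve c t -> qform c t <> 0 -> knum c t <> 0 ->
  vnum c t = 0 -> Derive (vnum c) t <> 0 -> ordinary_cusp (evolute c) t.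
Proof.
  intros Hc Hq HP G0 G1. destruct (nonlightlike_coord c t Hq) as [b Hb].
  destruct (locally_evolute_front c b t Hc Hq HP Hb) as [HX HY].
  apply (A_equivalent_coord _ b).
  apply (front_cusp _ _ (front_mu c b) (front_slope c b)); auto using smooth1_front_mu, smooth1_front_slope, Derive_front_slope_neq_0.
  - unfold front_mu. rewrite G0. ring.
  - unfold front_mu. rewrite Derive_mult_zero; auto using smooth1_front_factor with smooth.
    apply Rmult_neq_0; auto. now apply front_factor_neq_0.
Qed.

Lemma evolute_E6 c t : smooth_curve c t -> knum c t <> 0 -> vertex_of_order 2 c t ->
  E6_singularity (evolute c) t.
Proof.
  intros Hc HP Hv. destruct (vertex_of_order_2_vnum c t Hc Hv) as [Hq [G0 [G1 G2]]].
  destruct (nonlightlike_coord c t Hq) as [b Hb].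
  destruct (locally_evolute_front c b t Hc Hq HP Hb) as [HX HY].
  apply (A_equivalent_coord _ b).
  apply (front_E6 _ _ (front_mu c b) (front_slope c b)); auto using smooth1_front_mu, smooth1_front_slope, Derive_front_slope_neq_0.
  - unfold front_mu. rewrite G0. ring.
  - unfold front_mu. rewrite Derive_mult_zero; auto using smooth1_front_factor with smooth.
    rewrite G1; ring.
  - unfold front_mu. rewrite Derive2_mult_zero; auto using smooth1_front_factor with smooth.
    apply Rmult_neq_0; auto. now apply front_factor_neq_0.
Qed.

Lemma inflection_knum c t : qform c t <> 0 -> (inflection c t <-> knum c t = 0).
Proof.
  intros Hq. unfold inflection, nonlightlike, curvature.
  change (mink (vel c t) (vel c t)) with (qform c t). change (mink (acc c t) (vperp (vel c t))) with (knum c t).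
  split.
  - intros [_ H]. apply Rmult_integral in H as [|H]; auto.
    exfalso. revert H. apply Rinv_neq_0_compat, Rgt_not_eq, exp_pos.
  - intros ->. split; auto. unfold Rdiv; ring.
Qed.

(** * Zeros of a fold family *)

Section Convex.

Variables (f f1 f2 : R -> R) (l h c1 m c2 : R).
Hypothesis Hf : forall t, l < t < h -> is_derive f t (f1 t).
Hypothesis Hf1 : forall t, l < t < h -> is_derive f1 t (f2 t).
Hypothesis Hf2 : forall t, l < t < h -> 0 < f2 t.

Lemma convex_derivative_incr u v : l < u -> u < v -> v < h -> f1 u < f1 v.
Proof.
  intros Hu Huv Hv. apply (derive_pos_lt f1 f2); auto; intros t Ht; [apply Hf1|apply Hf2]; lra.
Qed.

Lemma convex_mvt u v : l < u -> u < v -> v < h -> exists x, u < x < v /\ f v - f u = f1 x * (v - u).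
Proof.
  intros Hu Huv Hv. destruct (MVT_cor2 f f1 u v Huv) as [x [Hx1 Hx2]].
  - intros t Ht. apply is_derive_Reals, Hf. lra.
  - now exists x.
Qed.

Hypothesis Hc : l < c1 /\ c1 < m /\ m < c2 /\ c2 < h.
Hypothesis Hz1 : f c1 = 0.
Hypothesis Hz2 : f c2 = 0.
Hypothesis Hm : f m < 0.

Lemma convex_left_derivative : f1 c1 < 0.
Proof.
  destruct (convex_mvt c1 m) as [x [Hx1 Hx2]]; try lra.
  assert (f1 x < 0) by nra.
  pose proof (convex_derivative_incr c1 x). lra.
Qed.

Lemma convex_right_derivative : 0 < f1 c2.
Proof.
  destruct (convex_mvt m c2) as [x [Hx1 Hx2]]; try lra.
  assert (0 < f1 x) by nra.
  pose proof (convex_derivative_incr x c2). lra.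
Qed.

Lemma convex_signs t : l < t < h -> (t < c1 -> 0 < f t) /\ (c1 < t < c2 -> f t < 0) /\ (c2 < t -> 0 < f t).
Proof.
  intros Ht. pose proof convex_left_derivative. pose proof convex_right_derivative.
  split; [|split]; intros Htc.
  - destruct (convex_mvt t c1) as [x [Hx1 Hx2]]; try lra.
    pose proof (convex_derivative_incr x c1). nra.
  (* A nonnegative value between the zeros would give a point with f1 >= 0 to the left of one with
     f1 <= 0, against strict increase of f1. *)
  - apply Rnot_le_lt. intros Hn.
    destruct (convex_mvt c1 t) as [x [Hx1 Hx2]]; try lra.
    destruct (convex_mvt t c2) as [y [Hy1 Hy2]]; try lra.
    pose proof (convex_derivative_incr x y).
    assert (0 <= f1 x) by nra. assert (f1 y <= 0) by nra. lra.
  - destruct (convex_mvt c2 t) as [x [Hx1 Hx2]]; try lra.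
    pose proof (convex_derivative_incr c2 x). nra.
Qed.

End Convex.

Section FoldFamily.

Variable F : R -> R -> R.
Variables (t0 e : R).
Hypothesis He : 0 < e.
Hypothesis HF : forall s t, Rabs s < e -> Rabs (t - t0) < e -> smooth2 F s t.

Let Ft s t := Derive (F s) t.

Hypothesis HFtt : forall s t, Rabs s < e -> Rabs (t - t0) < e -> 0 < Derive (Ft s) t.
Variable sg : R.
Hypothesis Hsg : sg = 1 \/ sg = -1.
Hypothesis HFs : forall s t, Rabs s < e -> Rabs (t - t0) < e -> sg * Derive (fun s => F s t) s < 0.
Hypothesis HF0 : F 0 t0 = 0.
Hypothesis HFt0 : Ft 0 t0 = 0.

Let He0 : Rabs 0 < e.
Proof. now rewrite Rabs_R0. Qed.

Let box t : t0 - e < t < t0 + e -> Rabs (t - t0) < e.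
Proof. intros H. apply Rabs_def1; lra. Qed.

Lemma fold_is_derive s : Rabs s < e -> forall t, t0 - e < t < t0 + e -> is_derive (F s) t (Ft s t).
Proof. intros Hs t Ht. apply (smooth2_is_derive_y F); auto. Qed.

Lemma fold_is_derive2 s : Rabs s < e -> forall t, t0 - e < t < t0 + e ->
  is_derive (Ft s) t (Derive (Ft s) t).
Proof.
  intros Hs t Ht. apply (smooth2_is_derive_y Ft). apply (smooth2_partial_y F). auto.
Qed.

Lemma fold_mono s t : Rabs s < e -> t0 - e < t < t0 + e ->
  (0 < sg * s -> F s t < F 0 t) /\ (sg * s < 0 -> F 0 t < F s t).
Proof.
  intros Hs Ht.
  assert (Hb : forall x, Rmin 0 s <= x <= Rmax 0 s -> Rabs x < e).
  { intros x Hx. apply Rabs_lt_between in Hs. apply Rabs_def1;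
    destruct (Rle_dec 0 s); [rewrite Rmin_left, Rmax_right in Hx by lra|rewrite Rmin_right, Rmax_left in Hx by lra
      |rewrite Rmin_left, Rmax_right in Hx by lra|rewrite Rmin_right, Rmax_left in Hx by lra]; lra. }
  destruct (MVT_gen (fun s => F s t) 0 s (fun s => Derive (fun s => F s t) s)) as [x [Hx1 Hx2]].
  - intros x Hx. apply (smooth2_is_derive_x F). apply HF; auto. apply Hb; lra.
  - intros x Hx. eapply is_derive_continuity_pt, (smooth2_is_derive_x F). apply HF; auto.
  - pose proof (HFs x t (Hb x Hx1) (box t Ht)). rewrite Rminus_0_r in Hx2.
    destruct Hsg as [-> | ->]; split; nra.
Qed.

Lemma fold_pos t : t0 - e < t < t0 + e -> t <> t0 -> 0 < F 0 t.
Proof.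
  intros Ht Hne.
  destruct (Rdichotomy _ _ Hne) as [L|L].
  - destruct (convex_mvt (F 0) (Ft 0) (t0 - e) (t0 + e) (fold_is_derive 0 He0) t t0) as [x [Hx1 Hx2]]; try lra.
    assert (Ft 0 x < Ft 0 t0).
    { apply (convex_derivative_incr (Ft 0) (fun t => Derive (Ft 0) t) (t0 - e) (t0 + e)); try lra; auto.
      apply fold_is_derive2; auto. }
    nra.
  - destruct (convex_mvt (F 0) (Ft 0) (t0 - e) (t0 + e) (fold_is_derive 0 He0) t0 t) as [x [Hx1 Hx2]]; try lra.
    assert (Ft 0 t0 < Ft 0 x).
    { apply (convex_derivative_incr (Ft 0) (fun t => Derive (Ft 0) t) (t0 - e) (t0 + e)); try lra; auto.
      apply fold_is_derive2; auto. }
    nra.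
Qed.

(** On this side F s lies above F 0, which by convexity is nonnegative with its only zero at t0. *)
Lemma fold_no_zero s t : Rabs s < e -> sg * s < 0 -> t0 - e < t < t0 + e -> 0 < F s t.
Proof.
  intros Hs Hss Ht. pose proof (proj2 (fold_mono s t Hs Ht) Hss).
  destruct (Req_EM_T t t0) as [->|]; [lra|]. pose proof (fold_pos t Ht). lra.
Qed.

(** For sg * s > 0 the value at t0 drops below 0 while those at t0 - r and t0 + r stay positive by
    continuity in s. This gives one zero on each side, and convexity fixes all signs. *)
Lemma fold_two_zeros rho : 0 < rho -> exists d, 0 < d /\ forall s, Rabs s < d -> 0 < sg * s ->
  exists c1 c2, t0 - rho < c1 /\ c1 < t0 /\ t0 < c2 /\ c2 < t0 + rho /\ F s c1 = 0 /\ F s c2 = 0 /\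
    Ft s c1 < 0 /\ 0 < Ft s c2 /\
    forall t, t0 - e < t < t0 + e ->
      (t < c1 -> 0 < F s t) /\ (c1 < t < c2 -> F s t < 0) /\ (c2 < t -> 0 < F s t).
Proof.
  intros Hr. set (r := Rmin rho e / 2).
  assert (Hr1 : 0 < r /\ r < rho /\ r < e).
  { pose proof (Rmin_l rho e). pose proof (Rmin_r rho e).
    assert (0 < Rmin rho e) by now apply Rmin_pos. unfold r; lra. }
  assert (K : forall t, t0 - e < t < t0 + e -> t <> t0 -> locally 0 (fun s => 0 < F s t)).
  { intros t Ht Hne. apply (continuity_pt_pos (fun s => F s t)); [|now apply fold_pos].
    apply smooth1_continuity, (smooth1_slice_x F), HF; auto. }
  assert (K1 : locally 0 (fun s => 0 < F s (t0 - r))) by (apply K; lra).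
  assert (K2 : locally 0 (fun s => 0 < F s (t0 + r))) by (apply K; lra).
  destruct (filter_and _ _ K1 K2) as [d Hd].
  exists (Rmin d e). split; [apply Rmin_pos; auto; apply cond_pos|].
  intros s Hs Hss.
  assert (Hse : Rabs s < e) by (eapply Rlt_le_trans; [exact Hs|apply Rmin_r]).
  destruct (Hd s) as [P1 P2].
  { change (Rabs (s - 0) < d). rewrite Rminus_0_r. eapply Rlt_le_trans; [exact Hs|apply Rmin_l]. }
  assert (P0 : F s t0 < 0).
  { rewrite <- HF0. apply fold_mono; auto. lra. }
  assert (HC : forall t, t0 - e < t < t0 + e -> continuity_pt (F s) t).
  { intros t Ht. eapply is_derive_continuity_pt, fold_is_derive; auto. }
  destruct (IVT_interv (fun t => - F s t) (t0 - r) t0) as [c1 [A1 A2]]; try lra.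
  { intros t Ht. apply (continuity_pt_opp (F s)), HC; lra. }
  destruct (IVT_interv (F s) t0 (t0 + r)) as [c2 [B1 B2]]; try lra.
  { intros t Ht. apply HC; lra. }
  assert (Hc1 : c1 <> t0) by (intros E; rewrite E in A2; lra).
  assert (Hc2 : c2 <> t0) by (intros E; rewrite E in B2; lra).
  assert (A2' : F s c1 = 0) by lra.
  assert (Hc : t0 - e < c1 /\ c1 < t0 /\ t0 < c2 /\ c2 < t0 + e) by lra.
  pose proof (fold_is_derive s Hse) as D1. pose proof (fold_is_derive2 s Hse) as D2.
  assert (D3 : forall t, t0 - e < t < t0 + e -> 0 < Derive (Ft s) t) by auto.
  exists c1, c2. repeat (split; [lra|]). split; [|split].
  - eapply (convex_left_derivative (F s) (Ft s) (fun t => Derive (Ft s) t)); eauto.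
  - eapply (convex_right_derivative (F s) (Ft s) (fun t => Derive (Ft s) t)); eauto.
  - intros t Ht. eapply (convex_signs (F s) (Ft s) (fun t => Derive (Ft s) t)); eauto.
Qed.

End FoldFamily.

(** * Jointly smooth families of curves *)

Definition smooth_fam (Gam : R -> R -> point) (s t : R) : Prop :=
  smooth2 (fun s' t' => fst (Gam s' t')) s t /\ smooth2 (fun s' t' => snd (Gam s' t')) s t.

Lemma smooth_fam_locally Gam s t : smooth_fam Gam s t -> locally_2d (smooth_fam Gam) s t.
Proof. intros [H1 H2]. apply locally_2d_and; now apply smooth2_locally. Qed.

Lemma smooth_fam_curve Gam s t : smooth_fam Gam s t -> smooth_curve (Gam s) t.
Proof.
  intros [H1 H2]. split.
  - apply (smooth1_slice_y (fun s t => fst (Gam s t))), H1.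
  - apply (smooth1_slice_y (fun s t => snd (Gam s t))), H2.
Qed.

Section SmoothFamily.

Variable Gam : R -> R -> point.
Variables s t : R.
Hypothesis HG : smooth_fam Gam s t.

Lemma smooth2_vel b : smooth2 (fun s t => coord b (vel (Gam s) t)) s t.
Proof. destruct HG; destruct b; apply (smooth2_partial_y (fun s t => _ (Gam s t))); auto. Qed.

Lemma smooth2_acc b : smooth2 (fun s t => coord b (acc (Gam s) t)) s t.
Proof.
  destruct b; [apply (smooth2_partial_y (fun s t => snd (vel (Gam s) t))); apply (smooth2_vel true)
  |apply (smooth2_partial_y (fun s t => fst (vel (Gam s) t))); apply (smooth2_vel false)].
Qed.

Lemma smooth2_qform : smooth2 (fun s t => qform (Gam s) t) s t.
Proof.
  pose proof (smooth2_vel true). pose proof (smooth2_vel false). unfold qform, mink.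
  apply smooth2_plus; [apply smooth2_opp|]; apply smooth2_mult; auto.
Qed.

Lemma smooth2_knum : smooth2 (fun s t => knum (Gam s) t) s t.
Proof.
  pose proof (smooth2_vel true). pose proof (smooth2_vel false).
  pose proof (smooth2_acc true). pose proof (smooth2_acc false). unfold knum, mink.
  apply smooth2_plus; [apply smooth2_opp|]; apply smooth2_mult; auto.
Qed.

Lemma smooth2_vnum : smooth2 (fun s t => vnum (Gam s) t) s t.
Proof.
  pose proof smooth2_knum. pose proof smooth2_qform.
  pose proof (smooth2_partial_y (fun s t => knum (Gam s) t) s t ltac:(auto)).
  pose proof (smooth2_partial_y (fun s t => qform (Gam s) t) s t ltac:(auto)).
  apply smooth2_minus; apply smooth2_mult; auto with smooth.
Qed.

Lemma smooth2_front_factor b : knum (Gam s) t <> 0 ->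
  smooth2 (fun s t => - coord (negb b) (vel (Gam s) t) / knum (Gam s) t ^ 2) s t.
Proof.
  intros HP. pose proof smooth2_knum. pose proof (smooth2_vel (negb b)).
  apply smooth2_div; auto with smooth. now apply pow_nonzero.
Qed.

Lemma smooth2_front_slope b : coord (negb b) (vel (Gam s) t) <> 0 ->
  smooth2 (fun s t => front_slope (Gam s) b t) s t.
Proof.
  intros Hb. apply smooth2_div; auto; apply smooth2_vel.
Qed.

Lemma locally_2d_neq_0 F : smooth2 F s t -> F s t <> 0 -> locally_2d (fun u v => F u v <> 0) s t.
Proof. intros HF H0. apply continuity_2d_pt_neq_0; auto. now apply smooth2_continuity. Qed.

Lemma smooth2_evolute b : qform (Gam s) t <> 0 -> knum (Gam s) t <> 0 ->
  smooth2 (fun s t => coord b (evolute (Gam s) t)) s t.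
Proof.
  intros Hq HP. pose proof smooth2_knum as S1. pose proof smooth2_qform as S2.
  apply (smooth2_ext (fun s t => coord b (Gam s t) + qform (Gam s) t / knum (Gam s) t * coord (negb b) (vel (Gam s) t))).
  - generalize (locally_2d_and _ _ _ _ (locally_2d_neq_0 _ S1 HP) (locally_2d_neq_0 _ S2 Hq)).
    apply locally_2d_imp. intros u v [A B]. rewrite evolute_expr by auto.
    destruct b; reflexivity.
  - pose proof (smooth2_vel (negb b)). destruct HG. destruct b; auto with smooth.
Qed.

End SmoothFamily.

Lemma smooth2_sign F s t : smooth2 F s t -> F s t <> 0 ->
  exists k, (k = 1 \/ k = -1) /\ locally_2d (fun u v => 0 < k * F u v) s t.
Proof.
  intros HF H0. destruct (sign_exists _ H0) as [k [Hk1 Hk2]]. exists k; split; auto.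
  apply (smooth2_pos (fun u v => k * F u v)); auto with smooth.
Qed.

(** * The transition on a square where all signs are constant *)

Section Transition.

Variable Gam : R -> R -> point.
(** The signs normalize the picture: tau makes F = tau * vnum convex in t, sg makes F decrease as sg
    * s grows, kap makes X' a positive multiple of F, and eta makes the slope increasing. The sign
    zet of tau * knum * qform decides which vertex is inward. *)
Variables (t0 e tau sg kap eta zet : R) (b : bool).
Hypothesis He : 0 < e.
Hypothesis Htau : tau = 1 \/ tau = -1.
Hypothesis Hsg : sg = 1 \/ sg = -1.
Hypothesis Hkap : kap = 1 \/ kap = -1.
Hypothesis Heta : eta = 1 \/ eta = -1.
Hypothesis Hzet : zet = 1 \/ zet = -1.

Let G s t := vnum (Gam s) t.
Let F s t := tau * G s t.

Hypothesis Hbox : forall s t, Rabs s < e -> Rabs (t - t0) < e ->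
  smooth_fam Gam s t /\ qform (Gam s) t <> 0 /\ knum (Gam s) t <> 0 /\
  coord (negb b) (vel (Gam s) t) <> 0 /\
  0 < Derive (fun t => Derive (F s) t) t /\ sg * Derive (fun s => F s t) s < 0 /\
  0 < kap * (tau * (- coord (negb b) (vel (Gam s) t) / knum (Gam s) t ^ 2)) /\
  0 < eta * Derive (front_slope (Gam s) b) t /\
  0 < zet * (tau * (knum (Gam s) t * qform (Gam s) t)).
Hypothesis HF0 : F 0 t0 = 0.
Hypothesis HFt0 : Derive (F 0) t0 = 0.

Let X s t := kap * coord b (evolute (Gam s) t).
Let Y s t := kap * eta * coord (negb b) (evolute (Gam s) t).
Let mu s t := kap * front_mu (Gam s) b t.
Let theta s t := eta * front_slope (Gam s) b t.

Let in_box t r : 0 < r <= e -> near t0 r t -> Rabs (t - t0) < e.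
Proof. intros Hr [H1 H2]. apply Rabs_def1; lra. Qed.

Lemma mu_sign s t : Rabs s < e -> Rabs (t - t0) < e -> exists k, 0 < k /\ mu s t = k * F s t.
Proof.
  intros Hs Ht. destruct (Hbox s t Hs Ht) as [_ [_ [_ [_ [_ [_ [H _]]]]]]].
  eexists; split; [exact H|]. unfold mu, front_mu, F, G.
  assert (tau * tau = 1) by (destruct Htau; subst; ring).
  transitivity (kap * ((tau * tau) * (vnum (Gam s) t * (- coord (negb b) (vel (Gam s) t) / knum (Gam s) t ^ 2)))); [rewrite H0|]; ring.
Qed.

Lemma transition_is_derive s t : Rabs s < e -> Rabs (t - t0) < e ->
  is_derive (X s) t (mu s t) /\ is_derive (Y s) t (theta s t * mu s t).
Proof.
  intros Hs Ht. destruct (Hbox s t Hs Ht) as [H1 [H2 [H3 [H4 _]]]].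
  pose proof (smooth_fam_curve _ _ _ H1) as Hc. split.
  - apply (is_derive_scal (fun t => coord b (evolute (Gam s) t))). now apply is_derive_evolute_mu.
  - evar_last. apply (is_derive_scal (fun t => coord (negb b) (evolute (Gam s) t))). now apply is_derive_evolute_slope.
    unfold mu, theta. ring.
Qed.

Lemma theta_incr s u v : Rabs s < e -> t0 - e < u -> u < v -> v < t0 + e -> theta s u < theta s v.
Proof.
  intros Hs Hu Huv Hv.
  assert (B : forall t, u <= t <= v -> Rabs (t - t0) < e) by (intros t Ht; apply Rabs_def1; lra).
  apply (derive_pos_lt (theta s) (fun t => eta * Derive (front_slope (Gam s) b) t)); auto.
  - intros t Ht. destruct (Hbox s t Hs (B t Ht)) as [H1 [H2 [H3 [H4 _]]]].
    apply (is_derive_scal (front_slope (Gam s) b)), smooth1_is_derive, smooth1_front_slope; auto.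
    now apply smooth_fam_curve.
  - intros t Ht. now apply (Hbox s t Hs (B t ltac:(lra))).
Qed.

Lemma evolute_eq_iff s u v : evolute (Gam s) u = evolute (Gam s) v <-> X s u = X s v /\ Y s u = Y s v.
Proof.
  unfold X, Y. split; [intros ->; auto|]. intros [E1 E2].
  assert (K : kap <> 0) by (destruct Hkap; lra). assert (K2 : kap * eta <> 0) by (destruct Hkap, Heta; subst; lra).
  apply Rmult_eq_reg_l in E1; auto. apply Rmult_eq_reg_l in E2; auto.
  rewrite (surjective_pairing (evolute (Gam s) u)), (surjective_pairing (evolute (Gam s) v)).
  destruct b; simpl in *; congruence.
Qed.

Lemma vel_evolute s t : Rabs s < e -> Rabs (t - t0) < e ->
  coord b (vel (evolute (Gam s)) t) = front_mu (Gam s) b t /\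
  coord (negb b) (vel (evolute (Gam s)) t) = front_slope (Gam s) b t * front_mu (Gam s) b t.
Proof.
  intros Hs Ht. destruct (Hbox s t Hs Ht) as [H1 [H2 [H3 [H4 _]]]].
  pose proof (smooth_fam_curve _ _ _ H1) as Hc.
  pose proof (is_derive_evolute_mu _ b _ Hc H2 H3) as D1.
  pose proof (is_derive_evolute_slope _ b _ Hc H2 H3 H4) as D2.
  apply is_derive_unique in D1. apply is_derive_unique in D2.
  destruct b; simpl in *; split; assumption.
Qed.

Lemma evolute_immersed s t : Rabs s < e -> Rabs (t - t0) < e -> F s t <> 0 -> immersed (evolute (Gam s)) t.
Proof.
  intros Hs Ht HF. destruct (Hbox s t Hs Ht) as [H1 [H2 [H3 [H4 _]]]].
  pose proof (smooth_fam_curve _ _ _ H1) as Hc. split.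
  - now apply smooth_curve_evolute.
  - intros E. destruct (vel_evolute s t Hs Ht) as [E1 _]. rewrite E in E1.
    destruct (mu_sign s t Hs Ht) as [k [Hk Ek]]. unfold mu in Ek. rewrite <- E1 in Ek.
    assert (k * F s t = 0) by (rewrite <- Ek; destruct b; simpl; ring).
    apply Rmult_integral in H as [|]; [lra|auto].
Qed.

Lemma transition_F_smooth s t : Rabs s < e -> Rabs (t - t0) < e -> smooth2 F s t.
Proof.
  intros Hs Ht. destruct (Hbox s t Hs Ht) as [H1 _]. pose proof (smooth2_vnum _ _ _ H1).
  apply smooth2_mult; auto with smooth.
Qed.

Lemma Derive_F s t : Derive (F s) t = tau * Derive (vnum (Gam s)) t.
Proof. apply Derive_scal. Qed.

Lemma F_zero s t : F s t = 0 -> vnum (Gam s) t = 0.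
Proof. unfold F, G. intros H. apply Rmult_integral in H as [|]; auto. destruct Htau; lra. Qed.

Lemma F_two_zeros rho : 0 < rho -> exists d, 0 < d /\ forall s, Rabs s < d -> 0 < sg * s ->
  exists c1 c2, t0 - rho < c1 /\ c1 < t0 /\ t0 < c2 /\ c2 < t0 + rho /\ F s c1 = 0 /\ F s c2 = 0 /\
    Derive (F s) c1 < 0 /\ 0 < Derive (F s) c2 /\
    forall t, t0 - e < t < t0 + e ->
      (t < c1 -> 0 < F s t) /\ (c1 < t < c2 -> F s t < 0) /\ (c2 < t -> 0 < F s t).
Proof.
  apply (fold_two_zeros F t0 e He transition_F_smooth); auto.
  all: intros s t Hs Ht; now apply Hbox.
Qed.

Lemma F_no_zero s t : Rabs s < e -> sg * s < 0 -> t0 - e < t < t0 + e -> 0 < F s t.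
Proof.
  apply (fold_no_zero F t0 e He transition_F_smooth); auto.
  all: intros u v Hu Hv; now apply Hbox.
Qed.

Lemma F_pos t : t0 - e < t < t0 + e -> t <> t0 -> 0 < F 0 t.
Proof.
  apply (fold_pos F t0 e He transition_F_smooth); auto.
  intros u v Hu Hv. now apply Hbox.
Qed.

Lemma X0_incr u v : t0 - e < u -> u < v -> v < t0 + e -> X 0 u < X 0 v.
Proof.
  intros Hu Huv Hv. assert (H0 : Rabs 0 < e) by now rewrite Rabs_R0.
  assert (B : forall t, u <= t <= v -> Rabs (t - t0) < e) by (intros t Ht; apply Rabs_def1; lra).
  apply (derive_pos_but_one_lt (X 0) (mu 0) u t0 v Huv).
  - intros t Ht. now apply transition_is_derive; auto.
  - intros t Ht Hne. destruct (mu_sign 0 t H0 (B t ltac:(lra))) as [k [Hk ->]].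
    apply Rmult_lt_0_compat; auto. apply F_pos; auto; lra.
Qed.

Lemma X_smooth s t : Rabs s < e -> Rabs (t - t0) < e -> smooth2 X s t.
Proof.
  intros Hs Ht. destruct (Hbox s t Hs Ht) as [H1 [H2 [H3 _]]].
  pose proof (smooth2_evolute _ _ _ H1 b H2 H3). apply smooth2_mult; auto with smooth.
Qed.

Lemma transition_evolute_defined :
  on_sides sg (fun s r => evolute_defined_near (Gam s) t0 r) (fun s r => evolute_defined_near (Gam s) t0 r).
Proof.
  exists e; split; auto. intros r Hr. exists e; split; auto. intros s Hs.
  assert (K : evolute_defined_near (Gam s) t0 r).
  { intros t Ht. destruct (Hbox s t Hs (in_box t r Hr Ht)) as [H1 [H2 [H3 _]]].
    split; [exact H2|]. now rewrite inflection_knum. }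
  auto.
Qed.

Lemma transition_vertices :
  on_sides sg (fun s r => one_inward_one_outward (Gam s) t0 r) (fun s r => no_vertex (Gam s) t0 r).
Proof.
  exists e; split; auto. intros r Hr.
  destruct (F_two_zeros r) as [d [Hd H]]; [lra|].
  exists (Rmin d e). split; [now apply Rmin_pos|]. intros s Hs.
  assert (Hsd : Rabs s < d) by (eapply Rlt_le_trans; [exact Hs|apply Rmin_l]).
  assert (Hse : Rabs s < e) by (eapply Rlt_le_trans; [exact Hs|apply Rmin_r]).
  split; intros Hss.
  - destruct (H s Hsd Hss) as [c1 [c2 [A1 [A2 [A3 [A4 [Z1 [Z2 [D1 [D2 Hsig]]]]]]]]]].
    assert (N1 : near t0 r c1) by (split; lra). assert (N2 : near t0 r c2) by (split; lra).
    assert (V : forall c, near t0 r c -> F s c = 0 -> Derive (F s) c <> 0 ->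
      vertex_of_order 1 (Gam s) c /\ exists k, 0 < k /\
        curvature (Gam s) c * Derive_n (curvature (Gam s)) 2 c = zet * k * Derive (F s) c).
    { intros c Nc Zc Dc. destruct (Hbox s c Hse (in_box c r Hr Nc)) as [H1 [H2 [H3 [_ [_ [_ [_ [_ H9]]]]]]]].
      pose proof (smooth_fam_curve _ _ _ H1) as Hc. pose proof (F_zero _ _ Zc) as Gc.
      rewrite Derive_F in Dc |- *. split.
      - apply simple_vertex; auto. intros E; apply Dc. rewrite E; ring.
      - destruct (curvature_curvature2_sign _ _ Hc H2 Gc) as [k [Hk ->]].
        exists (k * (zet * (tau * (knum (Gam s) c * qform (Gam s) c)))). split; [now apply Rmult_lt_0_compat|].
        assert (zet * zet = 1) by (destruct Hzet; subst; ring).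
        assert (tau * tau = 1) by (destruct Htau; subst; ring).
        transitivity (k * ((zet * zet) * (tau * tau) * (knum (Gam s) c * qform (Gam s) c)) * Derive (vnum (Gam s)) c);
          [rewrite H0, H4|]; ring. }
    destruct (V c1 N1 Z1) as [V1 [k1 [K1 E1]]]; [lra|].
    destruct (V c2 N2 Z2) as [V2 [k2 [K2 E2]]]; [lra|].
    assert (HU : forall t, near t0 r t -> vertex (Gam s) t -> t = c1 \/ t = c2).
    { intros t Nt Vt. destruct (Hbox s t Hse (in_box t r Hr Nt)) as [H1 _].
      apply vertex_vnum in Vt as [_ Gt]; [|now apply smooth_fam_curve].
      assert (Ft : F s t = 0) by (unfold F, G; rewrite Gt; ring).
      destruct (Hsig t) as [S1 [S2 S3]]; [destruct Nt; lra|].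
      destruct (Rtotal_order t c1) as [L|[L|L]]; auto; [specialize (S1 L); lra|].
      destruct (Rtotal_order t c2) as [L'|[L'|L']]; auto; [specialize (S2 (conj L L')); lra|specialize (S3 L'); lra]. }
    assert (P1 : k1 * Derive (F s) c1 < 0) by nra.
    assert (P2 : 0 < k2 * Derive (F s) c2) by nra.
    (* F has negative derivative at c1 and positive derivative at c2, so zet = 1 makes c2 the inward
       vertex and zet = -1 makes it c1. *)
    destruct Hzet as [Ez|Ez]; rewrite Ez in E1, E2.
    + exists c2, c1. split; [|split; [|split; [|split]]]; auto.
      * split; auto. rewrite E2; lra.
      * split; auto. rewrite E1; lra.
      * intros t Nt Vt. destruct (HU t Nt Vt); auto.
    + exists c1, c2. split; [|split; [|split; [|split]]]; auto.
      * split; auto. rewrite E1; lra.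
      * split; auto. rewrite E2; lra.
  - intros t Nt Vt. destruct (Hbox s t Hse (in_box t r Hr Nt)) as [H1 _].
    apply vertex_vnum in Vt as [_ Gt]; [|now apply smooth_fam_curve].
    pose proof (F_no_zero s t Hse Hss) as K. unfold F, G in K. rewrite Gt in K.
    destruct Nt. lra.
Qed.

Lemma transition_embedded s r : 0 < r <= e -> Rabs s < e -> sg * s < 0 -> embedded_near (evolute (Gam s)) t0 r.
Proof.
  intros Hr Hs Hss.
  (* F s has no zero here, so X s alone is strictly increasing and already separates points. *)
  assert (Hinc : forall u v, near t0 r u -> near t0 r v -> u < v -> X s u < X s v).
  { intros u v [Hu1 Hu2] [Hv1 Hv2] Huv. apply (derive_pos_lt (X s) (mu s)); auto.
    - intros t Ht. apply transition_is_derive; auto. apply (in_box t r Hr). split; lra.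
    - intros t Ht. destruct (mu_sign s t Hs (in_box t r Hr (conj (ltac:(lra) : t0 - r < t) (ltac:(lra) : t < t0 + r)))) as [k [Hk ->]].
      apply Rmult_lt_0_compat; auto. apply F_no_zero; auto; lra. }
  split.
  - intros t Nt. apply evolute_immersed; auto; [now apply (in_box t r)|].
    apply Rgt_not_eq, F_no_zero; auto. destruct Nt; lra.
  - intros u v Nu Nv E. apply evolute_eq_iff in E as [E _].
    destruct (Rtotal_order u v) as [L|[L|L]]; auto; [pose proof (Hinc u v Nu Nv L)|pose proof (Hinc v u Nv Nu L)]; lra.
Qed.

(** The crossing needs X p < X c2 and X c1 < X q for fixed p, q. At s = 0 the function X is strictly
    increasing through t0, and the strict inequalities survive for small s because c1 and c2 tend to
    t0. *)
Lemma transition_crossing r : 0 < r <= e -> exists d, 0 < d /\ forall s, Rabs s < d -> 0 < sg * s ->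
  two_cusps_one_crossing (evolute (Gam s)) t0 r.
Proof.
  intros Hr. assert (H0 : Rabs 0 < e) by now rewrite Rabs_R0.
  set (p := t0 - r / 2). set (q := t0 + r / 2).
  assert (Hp : X 0 p < X 0 t0) by (apply X0_incr; unfold p; lra).
  assert (Hq : X 0 t0 < X 0 q) by (apply X0_incr; unfold q; lra).
  (* Midpoints serving as separators: X s stays below zp at p, above zq at q, and between them near
     t0. *)
  set (zp := (X 0 p + X 0 t0) / 2). set (zq := (X 0 t0 + X 0 q) / 2).
  assert (HXs : forall t z1 z2, Rabs (t - t0) < e -> z1 < X 0 t < z2 ->
    locally_2d (fun u v => z1 < X u v < z2) 0 t).
  { intros t z1 z2 Ht Hz. pose proof (X_smooth 0 t H0 Ht) as SX.
    assert (K1 : locally_2d (fun u v => 0 < X u v - z1) 0 t) by (apply smooth2_pos; auto with smooth; lra).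
    assert (K2 : locally_2d (fun u v => 0 < z2 - X u v) 0 t) by (apply smooth2_pos; auto with smooth; lra).
    generalize (locally_2d_and _ _ _ _ K1 K2). apply locally_2d_imp. intros u v [A B]; lra. }
  destruct (HXs t0 zp zq) as [d0 Hd0]; [rewrite Rminus_diag, Rabs_R0; auto|unfold zp, zq; lra|].
  destruct (HXs p (X 0 p - 1) zp) as [d1 Hd1]; [apply Rabs_def1; unfold p; lra|unfold zp; lra|].
  destruct (HXs q zq (X 0 q + 1)) as [d2 Hd2]; [apply Rabs_def1; unfold q; lra|unfold zq; lra|].
  (* Zeros within d0 of t0 lie where X s is between zp and zq; r / 2 keeps them between p and q. *)
  set (rho := Rmin d0 (r / 2)).
  assert (Hrho : 0 < rho /\ rho <= d0 /\ rho <= r / 2).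
  { split; [apply Rmin_pos; [apply cond_pos|lra]|]. split; [apply Rmin_l|apply Rmin_r]. }
  destruct (F_two_zeros rho) as [d [Hd H]]; [lra|].
  set (D := Rmin (Rmin d e) (Rmin d0 (Rmin d1 d2))).
  assert (HD : 0 < D) by (repeat apply Rmin_pos; auto; apply cond_pos).
  exists D. split; auto. intros s Hs Hss.
  assert (HDs : Rabs s < d /\ Rabs s < e /\ Rabs s < d0 /\ Rabs s < d1 /\ Rabs s < d2).
  { unfold D in Hs. 
    repeat match goal with
    | HH : Rabs s < Rmin ?a ?b |- _ => assert (Rabs s < a) by (eapply Rlt_le_trans; [exact HH|apply Rmin_l]);
        assert (Rabs s < b) by (eapply Rlt_le_trans; [exact HH|apply Rmin_r]); clear HH
    end. auto. }
  destruct HDs as [Hsd [Hse [Hs0 [Hs1 Hs2]]]].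
  destruct (H s Hsd Hss) as [c1 [c2 [A1 [A2 [A3 [A4 [Z1 [Z2 [D1 [D2 Hsig]]]]]]]]]].
  assert (XC : forall c, t0 - rho < c < t0 + rho -> zp < X s c < zq).
  { intros c Hc. apply Hd0; [now rewrite Rminus_0_r|]. apply Rabs_def1; lra. }
  assert (XP : X s p < zp).
  { apply Hd1; [now rewrite Rminus_0_r|]. rewrite Rminus_diag, Rabs_R0. apply cond_pos. }
  assert (XQ : zq < X s q).
  { apply Hd2; [now rewrite Rminus_0_r|]. rewrite Rminus_diag, Rabs_R0. apply cond_pos. }
  assert (XC1 := XC c1 ltac:(lra)). assert (XC2 := XC c2 ltac:(lra)).
  set (l := t0 - r). set (h := t0 + r).
  assert (Hlh : forall t, l < t < h -> Rabs (t - t0) < e) by (intros t Ht; apply (in_box t r Hr); exact Ht).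
  assert (Hcc : l < c1 /\ c1 < c2 /\ c2 < h) by (unfold l, h; lra).
  assert (HX : forall t, l < t < h -> is_derive (X s) t (mu s t)) by (intros; apply transition_is_derive; auto).
  assert (HY : forall t, l < t < h -> is_derive (Y s) t (theta s t * mu s t)) by (intros; apply transition_is_derive; auto).
  assert (Hth : forall u v, l < u -> u < v -> v < h -> theta s u < theta s v).
  { intros u v Hu Huv Hv. unfold l, h in *. apply theta_incr; auto; lra. }
  assert (Hmu1 : forall t, l < t < c1 -> 0 < mu s t).
  { intros t Ht. destruct (mu_sign s t Hse (Hlh t ltac:(lra))) as [k [Hk ->]].
    apply Rmult_lt_0_compat; auto. unfold l, h in *. apply (proj1 (Hsig t ltac:(lra))); lra. }
  assert (Hmu2 : forall t, c1 < t < c2 -> mu s t < 0).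
  { intros t Ht. destruct (mu_sign s t Hse (Hlh t ltac:(lra))) as [k [Hk ->]].
    unfold l, h in *. assert (F s t < 0) by (apply (proj1 (proj2 (Hsig t ltac:(lra)))); lra). nra. }
  assert (Hmu3 : forall t, c2 < t < h -> 0 < mu s t).
  { intros t Ht. destruct (mu_sign s t Hse (Hlh t ltac:(lra))) as [k [Hk ->]].
    apply Rmult_lt_0_compat; auto. unfold l, h in *. apply (proj2 (proj2 (Hsig t ltac:(lra)))); lra. }
  destruct (crossing_exists (X s) (Y s) (mu s) (theta s) l h c1 c2 p q) as [t1 [t2 [B1 [B2 [B3 [B4 [EX EY]]]]]]]; auto;
    try (unfold l, h, p, q in *; lra).
  exists c1, c2, t1, t2.
  assert (Hcusp : forall c, l < c < h -> F s c = 0 -> Derive (F s) c <> 0 -> ordinary_cusp (evolute (Gam s)) c).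
  { intros c Hc Zc Dc. destruct (Hbox s c Hse (Hlh c Hc)) as [H1 [H2 [H3 _]]].
    apply evolute_ordinary_cusp; auto.
    - now apply smooth_fam_curve.
    - now apply F_zero.
    - intros E; apply Dc. rewrite Derive_F, E; ring. }
  split; [split; unfold l, h in *; lra|]. split; [split; unfold l, h in *; lra|].
  split; [auto|split; [lra|split; [auto|]]].
  split; [apply Hcusp; auto; lra|]. split; [apply Hcusp; auto; lra|]. split; [|split; [|split]].
  - intros t Nt N1 N2. apply evolute_immersed; [auto|exact (Hlh t Nt)|].
    destruct (Hsig t) as [S1 [S2 S3]]; [destruct Nt; lra|].
    destruct (Rtotal_order t c1) as [L|[L|L]]; [specialize (S1 L); lra|contradiction|].
    destruct (Rtotal_order t c2) as [L'|[L'|L']]; [specialize (S2 (conj L L')); lra|contradiction|specialize (S3 L'); lra].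
  - apply evolute_eq_iff; auto.
  - assert (I1 : l < t1 < h) by lra. assert (I2 : l < t2 < h) by lra.
    destruct (vel_evolute s t1 Hse (Hlh t1 I1)) as [E1 E2].
    destruct (vel_evolute s t2 Hse (Hlh t2 I2)) as [E3 E4].
    assert (M1 : 0 < mu s t1) by (apply Hmu1; lra). assert (M2 : 0 < mu s t2) by (apply Hmu3; lra).
    assert (T12 : theta s t1 < theta s t2) by (apply Hth; lra).
    unfold mu, theta in M1, M2, T12.
    (* Up to sign this product is the determinant of the two velocities: both branches are immersed
       and their slopes differ. *)
    assert (K : front_mu (Gam s) b t1 * front_mu (Gam s) b t2 * (front_slope (Gam s) b t2 - front_slope (Gam s) b t1) <> 0).
    { apply Rmult_neq_0; [apply Rmult_neq_0|]; intros E;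
        [rewrite E in M1|rewrite E in M2|replace (front_slope (Gam s) b t2) with (front_slope (Gam s) b t1) in T12 by lra]; lra. }
    unfold vdet. intros E. apply K. destruct b; cbn [coord negb] in E1, E2, E3, E4;
      rewrite E1, E2, E3, E4 in E; [apply Ropp_eq_0_compat in E|]; rewrite <- E; ring.
  - intros u v [Nu1 Nu2] [Nv1 Nv2] Huv E. apply evolute_eq_iff in E as [E1 E2].
    apply (crossing_unique (X s) (Y s) (mu s) (theta s) l h c1 c2); auto; lra.
Qed.

Lemma transition_swallowtail : E6_singularity (evolute (Gam 0)) t0 ->
  swallowtail_transition (fun s => evolute (Gam s)) t0 sg.
Proof.
  intros HE. split; auto. exists e; split; auto. intros r Hr.
  destruct (transition_crossing r Hr) as [d [Hd H]].
  exists (Rmin d e). split; [now apply Rmin_pos|]. intros s Hs.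
  assert (Hsd : Rabs s < d) by (eapply Rlt_le_trans; [exact Hs|apply Rmin_l]).
  assert (Hse : Rabs s < e) by (eapply Rlt_le_trans; [exact Hs|apply Rmin_r]).
  split; intros Hss; auto. now apply transition_embedded.
Qed.

End Transition.

(** * Isometries and reparametrizations *)

(** Polarization shows that B = A - A(0) preserves the scalar product. So B p minus the expected
    combination of B(1,0) and B(0,1) is orthogonal to both, and these span the plane, hence it is
    0. *)
Lemma isometry_affine A : isometry A -> exists a b c d e f,
  (forall p, A p = (a * fst p + b * snd p + e, c * fst p + d * snd p + f)) /\
  - a ^ 2 + c ^ 2 = -1 /\ - b ^ 2 + d ^ 2 = 1 /\ - (a * b) + c * d = 0.
Proof.
  intros HA.
  set (B := fun p => vsub (A p) (A (0, 0))).
  assert (H1 : forall p q, - (fst (B p) - fst (B q)) ^ 2 + (snd (B p) - snd (B q)) ^ 2 =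
     - (fst p - fst q) ^ 2 + (snd p - snd q) ^ 2).
  { intros p q. pose proof (HA p q) as H. unfold mink, vsub in H; cbn [fst snd] in H.
    unfold B, vsub; cbn [fst snd]. nra. }
  assert (B0 : B (0, 0) = (0, 0)) by (unfold B, vsub; f_equal; ring).
  assert (H2 : forall p q, - (fst (B p) * fst (B q)) + snd (B p) * snd (B q) = - (fst p * fst q) + snd p * snd q).
  { intros p q. pose proof (H1 p q) as E1. pose proof (H1 p (0, 0)) as E2. pose proof (H1 q (0, 0)) as E3.
    rewrite B0 in E2, E3. cbn [fst snd] in E2, E3. lra. }
  set (u := B (1, 0)). set (v := B (0, 1)).
  pose proof (H2 (1, 0) (1, 0)) as Euu. pose proof (H2 (0, 1) (0, 1)) as Evv. pose proof (H2 (1, 0) (0, 1)) as Euv.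
  fold u v in Euu, Evv, Euv. cbn [fst snd] in Euu, Evv, Euv.
  (* The squared determinant is minus the Gram determinant of u and v, here -((-1) * 1 - 0). *)
  assert (HD : (fst u * snd v - snd u * fst v) ^ 2 = 1).
  { replace ((fst u * snd v - snd u * fst v) ^ 2) with
      ((- (fst u * fst v) + snd u * snd v) ^ 2 - (- (fst u * fst u) + snd u * snd u) * (- (fst v * fst v) + snd v * snd v)) by ring.
    rewrite Euu, Evv, Euv. ring. }
  exists (fst u), (fst v), (snd u), (snd v), (fst (A (0, 0))), (snd (A (0, 0))).
  split; [|split; [|split]]; try lra.
  intros p. pose proof (H2 p (1, 0)) as E1. pose proof (H2 p (0, 1)) as E2.
  fold u v in E1, E2. cbn [fst snd] in E1, E2.
  set (w1 := fst (B p) - (fst u * fst p + fst v * snd p)).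
  set (w2 := snd (B p) - (snd u * fst p + snd v * snd p)).
  assert (W1 : - (w1 * fst u) + w2 * snd u = 0).
  { unfold w1, w2. 
    replace (- ((fst (B p) - (fst u * fst p + fst v * snd p)) * fst u) + (snd (B p) - (snd u * fst p + snd v * snd p)) * snd u)
     with ((- (fst (B p) * fst u) + snd (B p) * snd u) - fst p * (- (fst u * fst u) + snd u * snd u)
       - snd p * (- (fst u * fst v) + snd u * snd v)) by ring.
    rewrite E1, Euu, Euv. ring. }
  assert (W2 : - (w1 * fst v) + w2 * snd v = 0).
  { unfold w1, w2. 
    replace (- ((fst (B p) - (fst u * fst p + fst v * snd p)) * fst v) + (snd (B p) - (snd u * fst p + snd v * snd p)) * snd v)
     with ((- (fst (B p) * fst v) + snd (B p) * snd v) - snd p * (- (fst v * fst v) + snd v * snd v)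
       - fst p * (- (fst u * fst v) + snd u * snd v)) by ring.
    rewrite E2, Evv, Euv. ring. }
  set (D := fst u * snd v - snd u * fst v) in *.
  assert (Z1 : w1 * D ^ 2 = 0).
  { replace (w1 * D ^ 2) with (D * (snd u * (- (w1 * fst v) + w2 * snd v) - snd v * (- (w1 * fst u) + w2 * snd u))) by (unfold D; ring).
    rewrite W1, W2. ring. }
  assert (Z2 : w2 * D ^ 2 = 0).
  { replace (w2 * D ^ 2) with (D * (fst u * (- (w1 * fst v) + w2 * snd v) - fst v * (- (w1 * fst u) + w2 * snd u))) by (unfold D; ring).
    rewrite W1, W2. ring. }
  rewrite HD, Rmult_1_r in Z1, Z2. unfold w1 in Z1. unfold w2 in Z2.
  rewrite (surjective_pairing (A p)). unfold B, vsub in Z1, Z2; cbn [fst snd] in Z1, Z2. f_equal; lra.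
Qed.

Section Reparametrization.

Variables (c m : R -> point) (phi : R -> R) (u0 a b c' d e f : R).
Hypothesis Ho1 : - a ^ 2 + c' ^ 2 = -1.
Hypothesis Ho2 : - b ^ 2 + d ^ 2 = 1.
Hypothesis Ho3 : - (a * b) + c' * d = 0.
Hypothesis Hc : smooth_curve c (phi u0).
Hypothesis Hphi : smooth1 phi u0.
Hypothesis Hm : locally u0 (fun u => m u = (a * fst (c (phi u)) + b * snd (c (phi u)) + e,
   c' * fst (c (phi u)) + d * snd (c (phi u)) + f)).

Let det := a * d - b * c'.

Lemma reparam_locally_smooth : locally u0 (fun u => smooth_curve c (phi u) /\ smooth1 phi u).
Proof.
  apply filter_and; [|now apply smooth1_locally].
  apply (locally_comp phi u0 (smooth_curve c)); auto. now apply smooth_curve_locally_smooth.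
Qed.

Lemma is_derive_lin (x y : R -> R) p q r t dx dy : is_derive x t dx -> is_derive y t dy ->
  is_derive (fun t => p * x t + q * y t + r) t (p * dx + q * dy).
Proof.
  intros Hx Hy. evar_last.
  - apply (is_derive_Rplus (fun t => p * x t + q * y t) (fun _ => r)).
    + apply (is_derive_Rplus (fun t => p * x t) (fun t => q * y t)); [apply (is_derive_scal x), Hx|apply (is_derive_scal y), Hy].
    + apply is_derive_Rconst.
  - unfold plus, zero; simpl. ring.
Qed.

Lemma reparam_vel : locally u0 (fun u => vel m u =
  (Derive phi u * (a * fst (vel c (phi u)) + b * snd (vel c (phi u))),
   Derive phi u * (c' * fst (vel c (phi u)) + d * snd (vel c (phi u))))).
Proof.
  generalize (filter_and _ _ (locally_locally _ _ Hm) reparam_locally_smooth). apply filter_imp.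
  intros u [E [[S1 S2] S3]].
  assert (D1 : is_derive (fun u => fst (c (phi u))) u (fst (vel c (phi u)) * Derive phi u)).
  { apply (is_derive_Rcomp (fun t => fst (c t)) phi); [exact (smooth1_is_derive _ _ S1)|now apply smooth1_is_derive]. }
  assert (D2 : is_derive (fun u => snd (c (phi u))) u (snd (vel c (phi u)) * Derive phi u)).
  { apply (is_derive_Rcomp (fun t => snd (c t)) phi); [exact (smooth1_is_derive _ _ S2)|now apply smooth1_is_derive]. }
  unfold vel at 1. f_equal; apply is_derive_unique.
  - apply (is_derive_ext_loc (fun u => a * fst (c (phi u)) + b * snd (c (phi u)) + e)).
    + revert E; apply filter_imp. intros t ->; reflexivity.
    + evar_last; [apply is_derive_lin; eassumption|]. ring.
  - apply (is_derive_ext_loc (fun u => c' * fst (c (phi u)) + d * snd (c (phi u)) + f)).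
    + revert E; apply filter_imp. intros t ->; reflexivity.
    + evar_last; [apply is_derive_lin; eassumption|]. ring.
Qed.

Lemma reparam_acc : locally u0 (fun u => acc m u =
  (Derive phi u ^ 2 * (a * fst (acc c (phi u)) + b * snd (acc c (phi u)))
     + Derive (Derive phi) u * (a * fst (vel c (phi u)) + b * snd (vel c (phi u))),
   Derive phi u ^ 2 * (c' * fst (acc c (phi u)) + d * snd (acc c (phi u)))
     + Derive (Derive phi) u * (c' * fst (vel c (phi u)) + d * snd (vel c (phi u))))).
Proof.
  generalize (filter_and _ _ (locally_locally _ _ reparam_vel) reparam_locally_smooth). apply filter_imp.
  intros u [E [S S3]].
  assert (D1 : is_derive (fun u => fst (vel c (phi u))) u (fst (acc c (phi u)) * Derive phi u)).
  { apply (is_derive_Rcomp (fun t => fst (vel c t)) phi); [|now apply smooth1_is_derive].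
    exact (smooth1_is_derive _ _ (smooth1_vel1 _ _ S)). }
  assert (D2 : is_derive (fun u => snd (vel c (phi u))) u (snd (acc c (phi u)) * Derive phi u)).
  { apply (is_derive_Rcomp (fun t => snd (vel c t)) phi); [|now apply smooth1_is_derive].
    exact (smooth1_is_derive _ _ (smooth1_vel2 _ _ S)). }
  assert (D3 : is_derive (Derive phi) u (Derive (Derive phi) u)) by now apply smooth1_is_derive, smooth1_Derive.
  unfold acc at 1. unfold vel at 1. f_equal; apply is_derive_unique.
  - apply (is_derive_ext_loc (fun u => Derive phi u * (a * fst (vel c (phi u)) + b * snd (vel c (phi u)) + 0))).
    + revert E; apply filter_imp. intros t ->. rewrite Rplus_0_r. reflexivity.
    + evar_last; [apply is_derive_Rmult; [exact D3|apply is_derive_lin; eassumption]|]. cbv beta. ring.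
  - apply (is_derive_ext_loc (fun u => Derive phi u * (c' * fst (vel c (phi u)) + d * snd (vel c (phi u)) + 0))).
    + revert E; apply filter_imp. intros t ->. rewrite Rplus_0_r. reflexivity.
    + evar_last; [apply is_derive_Rmult; [exact D3|apply is_derive_lin; eassumption]|]. cbv beta. ring.
Qed.

Lemma reparam_qform : locally u0 (fun u => qform m u = Derive phi u ^ 2 * qform c (phi u)).
Proof.
  generalize reparam_vel. apply filter_imp. intros u E. rewrite !qform_expr, E. cbn [fst snd].
  set (x := fst (vel c (phi u))). set (y := snd (vel c (phi u))). set (p := Derive phi u).
  transitivity (p ^ 2 * ((- a ^ 2 + c' ^ 2) * (x * x) + (- b ^ 2 + d ^ 2) * (y * y) + 2 * (- (a * b) + c' * d) * (x * y))); [ring|].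
  rewrite Ho1, Ho2, Ho3. ring.
Qed.

(** The phi'' part of the new acceleration is parallel to the velocity, so it drops out of P. *)
Lemma reparam_knum : locally u0 (fun u => knum m u = det * Derive phi u ^ 3 * knum c (phi u)).
Proof.
  generalize (filter_and _ _ reparam_vel reparam_acc). apply filter_imp. intros u [E1 E2].
  rewrite !knum_expr, E1, E2. cbn [fst snd]. unfold det. ring.
Qed.

(** The coefficient 3/2 makes the phi'' terms cancel: P' q contributes 3 phi'' phi'^4 P q and (3/2)
    P q' contributes the same. The weight is 6 = 3 + 2 + 1, from P, q and one derivative. *)
Lemma reparam_vnum : vnum m u0 = det * Derive phi u0 ^ 6 * vnum c (phi u0).
Proof.
  assert (Dp : is_derive (Derive phi) u0 (Derive (Derive phi) u0)) by now apply smooth1_is_derive, smooth1_Derive.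
  assert (DP : is_derive (fun u => knum c (phi u)) u0 (Derive (knum c) (phi u0) * Derive phi u0)).
  { apply (is_derive_Rcomp (knum c) phi); apply smooth1_is_derive; auto with smooth. }
  assert (DQ : is_derive (fun u => qform c (phi u)) u0 (Derive (qform c) (phi u0) * Derive phi u0)).
  { apply (is_derive_Rcomp (qform c) phi); apply smooth1_is_derive; auto with smooth. }
  unfold vnum. rewrite (locally_singleton _ _ reparam_qform), (locally_singleton _ _ reparam_knum).
  assert (E1 : Derive (knum m) u0 =
    det * (3 * Derive (Derive phi) u0 * Derive phi u0 ^ 2) * knum c (phi u0)
    + det * Derive phi u0 ^ 3 * (Derive (knum c) (phi u0) * Derive phi u0)).
  { rewrite (Derive_ext_loc _ _ _ reparam_knum). apply is_derive_unique. evar_last.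
    - apply is_derive_Rmult; [|exact DP]. apply is_derive_scal, is_derive_pow, Dp.
    - cbn [Init.Nat.pred]. simpl INR. ring. }
  assert (E2 : Derive (qform m) u0 =
    2 * Derive (Derive phi) u0 * Derive phi u0 * qform c (phi u0)
    + Derive phi u0 ^ 2 * (Derive (qform c) (phi u0) * Derive phi u0)).
  { rewrite (Derive_ext_loc _ _ _ reparam_qform). apply is_derive_unique. evar_last.
    - apply is_derive_Rmult; [|exact DQ]. apply is_derive_pow, Dp.
    - cbn [Init.Nat.pred]. simpl INR. ring. }
  rewrite E1, E2. field.
Qed.

End Reparametrization.

Lemma vnum_graph f u : smooth1 f u -> vnum (fun t => (t, f t)) u = - vertex_num f u.
Proof.
  intros Hf. set (m := fun t => (t, f t)).
  assert (Ev : forall t, vel m t = (1, Derive f t)) by (intros t; unfold vel, m; simpl; now rewrite Derive_id).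
  assert (Ea : forall t, acc m t = (0, Derive_n f 2 t)).
  { intros t. unfold acc. unfold vel at 1. f_equal.
    rewrite (Derive_ext _ (fun _ => 1)); [apply Derive_const|]. intros; now rewrite Ev. }
  assert (EP : forall t, knum m t = Derive_n f 2 t) by (intros t; rewrite knum_expr, Ev, Ea; cbn [fst snd]; ring).
  assert (EQ : forall t, qform m t = -1 + Derive f t * Derive f t) by (intros t; rewrite qform_expr, Ev; cbn [fst snd]; ring).
  assert (DQ : Derive (qform m) u = 2 * Derive f u * Derive_n f 2 u).
  { rewrite (Derive_ext _ _ _ EQ). apply is_derive_unique.
    assert (D : is_derive (Derive f) u (Derive_n f 2 u)) by (apply smooth1_is_derive, smooth1_Derive; auto).
    evar_last. apply (is_derive_Rplus (fun _ => -1) (fun t => Derive f t * Derive f t)).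
    apply is_derive_Rconst.
    apply is_derive_Rmult; exact D. unfold plus, zero; simpl. ring. }
  unfold vnum. rewrite DQ, EP, EQ, (Derive_ext _ _ _ EP).
  unfold vertex_num. change (Derive_n f 3 u) with (Derive (Derive_n f 2) u). field.
Qed.

(** Swapping the coordinates changes the sign of both P and q, and G is bilinear in them. The
    spacelike Monge form thus reduces to the timelike one. *)
Lemma vnum_vperp c u : vnum (fun t => vperp (c t)) u = vnum c u.
Proof.
  assert (EP : forall t, knum (fun t => vperp (c t)) t = - knum c t).
  { intros t. rewrite !knum_expr.
    change (vel (fun t => vperp (c t)) t) with (vperp (vel c t)).
    change (acc (fun t => vperp (c t)) t) with (vperp (acc c t)). unfold vperp; cbn [fst snd]. ring. }
  assert (EQ : forall t, qform (fun t => vperp (c t)) t = - qform c t).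
  { intros t. rewrite !qform_expr.
    change (vel (fun t => vperp (c t)) t) with (vperp (vel c t)). unfold vperp; cbn [fst snd]. ring. }
  unfold vnum. rewrite EP, EQ, (Derive_ext _ _ _ EP), (Derive_ext _ _ _ EQ), !Derive_opp. ring.
Qed.

(** * Transversality to the vertex stratum *)

Lemma Derive_n_psum c n j : forall x, Derive_n (psum c (j + n)) j x =
  psum (fun k => INR (fact (k + j)) / INR (fact k) * c (k + j)%nat) n x.
Proof.
  revert c; induction j; intros c x.
  - simpl. apply psum_ext. intros k. rewrite Nat.add_0_r. field. apply INR_fact_neq_0.
  - rewrite <- Derive_n_S. rewrite (Derive_n_ext _ (psum (fun k => INR (S k) * c (S k)) (j + n))).
    + rewrite IHj. apply psum_ext. intros k. rewrite <- plus_n_Sm, fact_simpl, mult_INR.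
      field. apply INR_fact_neq_0.
    + intros t. apply is_derive_unique, is_derive_psum.
Qed.

Lemma jet_poly_psum k a t : jet_poly k a t = psum (fun i => match i with O => 0 | _ => a i end) (S k) t.
Proof.
  induction k.
  - unfold jet_poly. rewrite sum_n_m_zero by lia. change (0 = 0 + 0 * t ^ 0). ring.
  - unfold jet_poly in *. rewrite sum_n_Sm by lia.
    change (sum_n_m (fun i => a i * t ^ i) 1 k + a (S k) * t ^ S k =
      psum (fun i => match i with O => 0 | _ => a i end) (S k) t + a (S k) * t ^ S k).
    now rewrite IHk.
Qed.

Lemma Derive_n_jet_poly_0 k j a : (1 <= j <= k)%nat -> Derive_n (jet_poly k a) j 0 = INR (fact j) * a j.
Proof.
  intros Hj. rewrite (Derive_n_ext _ _ _ _ (jet_poly_psum k a)).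
  replace (S k) with (j + S (k - j))%nat by lia. rewrite Derive_n_psum, psum_0.
  rewrite Nat.add_0_l. destruct j; [lia|]. change (INR (fact 0)) with 1. field.
Qed.

Lemma jet_num_0 k a : (3 <= k)%nat ->
  jet_num k 0 a = 6 * a 3%nat * (1 - a 1%nat ^ 2) + 3 * a 1%nat * (2 * a 2%nat) ^ 2.
Proof.
  intros Hk. unfold jet_num. simpl Derive_n. unfold vertex_num.
  change (Derive (jet_poly k a) 0) with (Derive_n (jet_poly k a) 1 0).
  rewrite !Derive_n_jet_poly_0 by lia.
  replace (INR (fact 3)) with 6 by (simpl; ring). replace (INR (fact 2)) with 2 by (simpl; ring).
  replace (INR (fact 1)) with 1 by (simpl; ring). ring.
Qed.

Lemma locally_2d_comp (P : R -> R -> Prop) G H x y : continuity_2d_pt G x y -> continuity_2d_pt H x y ->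
  locally_2d P (G x y) (H x y) -> locally_2d (fun u v => P (G u v) (H u v)) x y.
Proof.
  intros HG HH [d Hd]. generalize (locally_2d_and _ _ _ _ (HG d) (HH d)).
  apply locally_2d_imp. intros u v [A B]; auto.
Qed.

(** The isometry does not depend on s, so its determinant gives one constant K for the whole family;
    the minus sign in K comes from the graph formula. *)
Lemma monge_vertex_num Gam t0 f : smooth_fam Gam 0 t0 -> qform (Gam 0) t0 <> 0 -> monge_form Gam t0 f ->
  exists (phi : R -> R -> R) (K : R), smooth2 phi 0 0 /\ phi 0 0 = t0 /\
    locally_2d (fun s u => vertex_num (f s) u = K * Derive (phi s) u ^ 6 * vnum (Gam s) (phi s u)) 0 0.
Proof.
  intros HG Hq [_ [_ [Hf [A [phi [HA [Hphi [Hphi0 [_ [Ht Hs]]]]]]]]]].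
  destruct (isometry_affine A HA) as [a [b [c [d [e [f' [EA [O1 [O2 O3]]]]]]]]].
  exists phi, (- (a * d - b * c)). split; [auto|split; [auto|]].
  assert (HGl : locally_2d (fun s u => smooth_fam Gam s (phi s u)) 0 0).
  { apply (locally_2d_comp (smooth_fam Gam) (fun s _ => s) phi).
    - apply continuity_2d_pt_id1.
    - now apply smooth2_continuity.
    - rewrite Hphi0. now apply smooth_fam_locally. }
  assert (Hall : locally_2d (fun s u => smooth_fam Gam s (phi s u) /\ smooth2 f s u /\ smooth2 phi s u) 0 0).
  { apply locally_2d_and; auto. apply locally_2d_and; now apply smooth2_locally. }
  assert (Hrep : forall m : R -> R -> point, (forall s u, smooth1 (f s) u -> vnum (m s) u = - vertex_num (f s) u) ->
    locally_2d (fun s u => A (Gam s (phi s u)) = m s u) 0 0 ->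
    locally_2d (fun s u => vertex_num (f s) u = - (a * d - b * c) * Derive (phi s) u ^ 6 * vnum (Gam s) (phi s u)) 0 0).
  { intros m Hm HE. revert HE. apply locally_2d_impl_strong. revert Hall.
    apply locally_2d_imp. intros s u [S1 [S2 S3]] HE.
    apply locally_2d_1d_const_x in HE.
    rewrite <- (Ropp_involutive (vertex_num (f s) u)), <- Hm by (now apply smooth1_slice_y).
    rewrite (reparam_vnum (Gam s) (m s) (phi s) u a b c d e f'); auto.
    - ring.
    - now apply smooth_fam_curve.
    - now apply smooth1_slice_y.
    - revert HE. apply filter_imp. intros v Hv. rewrite <- Hv. apply EA. }
  destruct (Rdichotomy _ _ Hq) as [L|L].
  - apply (Hrep (fun s u => (u, f s u))); [|exact (Ht L)]. intros; now apply vnum_graph.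
  - apply (Hrep (fun s u => (f s u, u))); [|exact (Hs L)]. intros s u Hsu.
    rewrite <- (vnum_graph (f s) u Hsu). apply (vnum_vperp (fun t => (t, f s t))).
Qed.

Lemma smooth2_Derive_n f i s u : smooth2 f s u -> smooth2 (fun s u => Derive_n (f s) i u) s u.
Proof.
  intros Hf. induction i; [exact Hf|]. exact (smooth2_partial_y (fun s u => Derive_n (f s) i u) s u IHi).
Qed.

(** Stated for three arbitrary functions so that it serves both for t- and for s-derivatives of
    [vertex_num]. At a zero of d1 the quadratic factor contributes nothing. *)
Lemma is_derive_vertex_num (d1 d2 d3 : R -> R) x : smooth1 d1 x -> smooth1 d2 x -> smooth1 d3 x -> d1 x = 0 ->
  is_derive (fun z => d3 z * (1 - d1 z ^ 2) + 3 * d1 z * d2 z ^ 2) x (Derive d3 x + 3 * Derive d1 x * d2 x ^ 2).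
Proof.
  intros H1 H2 H3 H0. apply smooth1_is_derive in H1, H2, H3.
  evar_last.
  - apply (is_derive_Rplus (fun z => d3 z * (1 - d1 z ^ 2)) (fun z => 3 * d1 z * d2 z ^ 2)).
    + apply is_derive_Rmult; [exact H3|].
      apply (is_derive_minus (fun _ => 1) (fun z => d1 z ^ 2)).
      * apply is_derive_Rconst.
      * apply is_derive_pow, H1.
    + apply is_derive_Rmult; [apply is_derive_scal, H1|apply is_derive_pow, H2].
  - cbv beta. rewrite H0. unfold minus, plus, opp, zero; simpl. ring.
Qed.

(* Apply the differential of the equation of V(1) to the decomposition of the jet e_3: the
   tangent part contributes 0, the t- and s-parts contribute the two derivatives of
   [vertex_num], and e_3 contributes 6. *)
Lemma transverse_vertex_num f k : smooth2 f 0 0 -> Derive (f 0) 0 = 0 -> (3 <= k)%nat ->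
  vertex_num (f 0) 0 = 0 -> transverse_to_stratum k 1 (monge_taylor f) 0 0 ->
  Derive (fun u => vertex_num (f 0) u) 0 = 0 -> Derive (fun s => vertex_num (f s) 0) 0 <> 0.
Proof.
  intros Hf Hf1 Hk Hv HT HU HS.
  set (D := fun i s u => Derive_n (f s) i u).
  assert (HD : forall i, smooth2 (D i) 0 0) by (intros; now apply smooth2_Derive_n).
  assert (HDu : forall i, smooth1 (D i 0) 0) by (intros i; apply smooth1_slice_y, HD).
  assert (HDs : forall i, smooth1 (fun s => D i s 0) 0) by (intros i; apply (smooth1_slice_x (D i)), HD).
  pose proof (is_derive_vertex_num (D 1%nat 0) (D 2%nat 0) (D 3%nat 0) 0 (HDu _) (HDu _) (HDu _) Hf1) as EU.
  pose proof (is_derive_vertex_num (fun s => D 1%nat s 0) (fun s => D 2%nat s 0) (fun s => D 3%nat s 0) 0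
    (HDs _) (HDs _) (HDs _) Hf1) as ES.
  apply is_derive_unique in EU. apply is_derive_unique in ES.
  pose proof (eq_trans (eq_sym HU) EU) as EU'. pose proof (eq_trans (eq_sym HS) ES) as ES'. clear EU ES HU HS.
  set (x := D 2%nat 0 0) in *.
  destruct (HT ltac:(
    intros j Hj; replace j with O by lia; rewrite jet_num_0 by lia; unfold monge_taylor;
    change (Derive_n (f 0) 1 0) with (Derive (f 0) 0); rewrite Hf1;
    unfold vertex_num in Hv; rewrite Hf1 in Hv;
    replace (INR (fact 3)) with 6 by (simpl; ring); unfold Rdiv; lra) (fun i => if Nat.eq_dec i 3 then 1 else 0))
    as [p [q [v [HV HW]]]].
  pose proof (HW 1%nat ltac:(lia)) as W1. pose proof (HW 3%nat ltac:(lia)) as W3. simpl Nat.eq_dec in W1, W3. cbv iota in W1, W3.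
  unfold monge_taylor, Rdiv in W1, W3. rewrite !Derive_scal_l in W1, W3.
  replace (INR (fact 3)) with 6 in W3 by (simpl; ring). replace (INR (fact 1)) with 1 in W1 by (simpl; ring).
  specialize (HV O ltac:(lia)).
  set (al := monge_taylor f 0 0) in *.
  assert (a1 : al 1%nat = 0).
  { unfold al, monge_taylor. change (Derive_n (f 0) 1 0) with (Derive (f 0) 0). rewrite Hf1. unfold Rdiv; ring. }
  assert (a2 : al 2%nat = x / 2).
  { unfold al, monge_taylor. replace (INR (fact 2)) with 2 by (simpl; ring). reflexivity. }
  assert (HL : is_derive (fun h => jet_num k 0 (fun i => al i + h * v i)) 0 (6 * v 3%nat + 3 * x ^ 2 * v 1%nat)).
  { apply (is_derive_ext (fun h => 6 * (al 3%nat + h * v 3%nat) * (1 - (al 1%nat + h * v 1%nat) ^ 2)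
      + 3 * (al 1%nat + h * v 1%nat) * (2 * (al 2%nat + h * v 2%nat)) ^ 2)).
    - intros h. now rewrite jet_num_0.
    - rewrite a1, a2. auto_derive; auto. simpl. field. }
  apply is_derive_unique in HL. apply is_derive_unique in HV.
  pose proof (eq_trans (eq_sym HV) HL) as HV'. clear HV HL.
  change (Derive (Derive_n (f 0) 1) 0) with (Derive (D 1%nat 0) 0) in W1.
  change (Derive (fun x : R => Derive_n (f x) 1 0) 0) with (Derive (fun s => D 1%nat s 0) 0) in W1.
  change (Derive (Derive_n (f 0) 3) 0) with (Derive (D 3%nat 0) 0) in W3.
  change (Derive (fun x : R => Derive_n (f x) 3 0) 0) with (Derive (fun s => D 3%nat s 0) 0) in W3.
  set (A := Derive (D 1%nat 0) 0) in *. set (B := Derive (fun s => D 1%nat s 0) 0) in *.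
  set (C := Derive (D 3%nat 0) 0) in *. set (E := Derive (fun s => D 3%nat s 0) 0) in *.
  cbv beta in *.
  (* Six times the a_3-equation plus 3 x^2 times the a_1-equation, where x = f''(0): these are the
     entries of the differential of the equation of V at a_1 = 0, its a_2-entry being 0. *)
  assert (X : 6 = p * (C + 3 * A * x ^ 2) + q * (E + 3 * B * x ^ 2) + (6 * v 3%nat + 3 * x ^ 2 * v 1%nat)).
  { apply (Rmult_eq_compat_l (3 * x ^ 2)) in W1. lra. }
  rewrite <- HV', <- EU', <- ES' in X. lra.
Qed.

Lemma Derive_mult_at_zero (K V : R -> R) x : smooth1 K x -> smooth1 V x -> V x = 0 ->
  Derive (fun z => K z * V z) x = K x * Derive V x.
Proof.
  intros HK HV H0. apply is_derive_unique. evar_last.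
  apply is_derive_Rmult; now apply smooth1_is_derive. rewrite H0. ring.
Qed.

(** If the s-derivative vanished, both partial derivatives of vnum would vanish at (0, t0). By the
    chain rule both derivatives of [vertex_num] would then vanish at (0, 0), which transversality
    excludes. *)
Lemma generic_vnum Gam t0 : smooth_fam Gam 0 t0 -> qform (Gam 0) t0 <> 0 ->
  vnum (Gam 0) t0 = 0 -> Derive (vnum (Gam 0)) t0 = 0 -> generic_family Gam t0 ->
  Derive (fun s => vnum (Gam s) t0) 0 <> 0.
Proof.
  intros HG Hq G0 Gt [f [k [HM [Hk [HT _]]]]] Gs.
  destruct (monge_vertex_num Gam t0 f HG Hq HM) as [phi [c [Hphi [Hphi0 HE]]]].
  destruct HM as [_ [Hf1 [Hf _]]].
  set (K := fun s u => c * Derive (phi s) u ^ 6).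
  set (V := fun s u => vnum (Gam s) (phi s u)).
  assert (HK : smooth2 K 0 0).
  { pose proof (smooth2_partial_y _ _ _ Hphi). unfold K. auto with smooth. }
  pose proof (smooth2_vnum _ _ _ HG) as HN.
  assert (HV : smooth2 V 0 0).
  { apply (smooth2_comp (fun s t => vnum (Gam s) t) (fun s _ => s) phi); auto with smooth. now rewrite Hphi0. }
  assert (V0 : V 0 0 = 0) by (unfold V; now rewrite Hphi0).
  assert (HDx : locally_2d (fun s t => is_derive (fun z => vnum (Gam z) t) s (Derive (fun z => vnum (Gam z) t) s)) 0 t0).
  { generalize (smooth2_locally _ _ _ HN). apply locally_2d_imp.
    intros s t Hst. now apply (smooth2_is_derive_x (fun s t => vnum (Gam s) t)). }
  pose proof (smooth2_is_derive_y _ _ _ HN) as HDy.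
  pose proof (smooth2_continuity _ _ _ (smooth2_partial_x _ _ _ HN)) as HDc.
  assert (Vu : Derive (V 0) 0 = 0).
  { apply is_derive_unique. unfold V. rewrite <- Hphi0 in HDy, Gt.
    evar_last. apply (is_derive_Rcomp (vnum (Gam 0)) (phi 0)); [exact HDy|apply (smooth2_is_derive_y phi), Hphi].
    change (Derive (fun z => vnum (Gam 0) z) (phi 0 0)) with (Derive (vnum (Gam 0)) (phi 0 0)).
    rewrite Gt. ring. }
  assert (Vs : Derive (fun s => V s 0) 0 = 0).
  { apply is_derive_unique. unfold V. rewrite <- Hphi0 in HDx, HDy, HDc, Gt, Gs.
    evar_last.
    - apply (is_derive_comp_2d (fun s t => vnum (Gam s) t) (fun s t => Derive (fun z => vnum (Gam z) t) s)
        (Derive (vnum (Gam 0)) (phi 0 0)) (fun s => s) (fun s => phi s 0));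
        [exact HDx|exact HDy|exact HDc|apply is_derive_Rid|apply (smooth2_is_derive_x phi), Hphi].
    - cbv beta. rewrite Gs.
      change (Derive (fun z => vnum (Gam 0) z) (phi 0 0)) with (Derive (vnum (Gam 0)) (phi 0 0)).
      rewrite Gt. ring. }
  apply (transverse_vertex_num f k); auto; try lia.
  - rewrite (locally_2d_singleton _ _ _ HE), Hphi0, G0. ring.
  - rewrite (Derive_ext_loc _ (fun u => K 0 u * V 0 u)).
    + rewrite Derive_mult_at_zero; auto using smooth1_slice_y. rewrite Vu. ring.
    + exact (locally_2d_1d_const_x _ _ _ HE).
  - rewrite (Derive_ext_loc _ (fun s => K s 0 * V s 0)).
    + rewrite (Derive_mult_at_zero (fun s => K s 0) (fun s => V s 0)); auto; [rewrite Vs; ring| |].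
      * now apply (smooth1_slice_x K).
      * now apply (smooth1_slice_x V).
    + exact (locally_2d_1d_const_y _ _ _ HE).
Qed.

(** * The swallowtail transition *)

Lemma locally_2d_box (P : R -> R -> Prop) x y : locally_2d P x y ->
  exists e, 0 < e /\ forall u v, Rabs (u - x) < e -> Rabs (v - y) < e -> P u v.
Proof. intros [d Hd]. exists d; split; [apply cond_pos|auto]. Qed.

Lemma family_transition Gam t0 : smooth_fam Gam 0 t0 -> knum (Gam 0) t0 <> 0 ->
  vertex_of_order 2 (Gam 0) t0 -> generic_family Gam t0 ->
  exists sg : R, (sg = 1 \/ sg = -1) /\
    on_sides sg (fun s r => evolute_defined_near (Gam s) t0 r)
                (fun s r => evolute_defined_near (Gam s) t0 r) /\
    swallowtail_transition (fun s => evolute (Gam s)) t0 sg /\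
    on_sides sg (fun s r => one_inward_one_outward (Gam s) t0 r)
                (fun s r => no_vertex (Gam s) t0 r).
Proof.
  intros HG HP Hv Hgen. pose proof (smooth_fam_curve _ _ _ HG) as Hc.
  destruct (vertex_of_order_2_vnum _ _ Hc Hv) as [Hq [G0 [G1 G2]]].
  pose proof (generic_vnum Gam t0 HG Hq G0 G1 Hgen) as Gs.
  destruct (nonlightlike_coord _ _ Hq) as [b Hb].
  destruct (sign_exists _ G2) as [tau [Htau Htau2]].
  assert (Htau0 : tau <> 0) by (destruct Htau; lra).
  pose proof (smooth2_vnum _ _ _ HG) as SV.
  set (F := fun s t => tau * vnum (Gam s) t).
  assert (SF : smooth2 F 0 t0) by (unfold F; auto with smooth).
  assert (SFtt : smooth2 (fun s t => Derive (fun t => Derive (F s) t) t) 0 t0).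
  { apply (smooth2_partial_y (fun s t => Derive (F s) t)). now apply (smooth2_partial_y F). }
  assert (Ftt : 0 < Derive (fun t => Derive (F 0) t) t0).
  { rewrite (Derive_ext _ (fun t => tau * Derive (vnum (Gam 0)) t)) by (intros; apply Derive_scal).
    rewrite Derive_scal. exact Htau2. }
  assert (SFs : smooth2 (fun s t => Derive (fun s => F s t) s) 0 t0) by now apply (smooth2_partial_x F).
  assert (Fs : Derive (fun s => F s t0) 0 <> 0).
  { unfold F. rewrite Derive_scal. now apply Rmult_neq_0. }
  destruct (smooth2_sign _ _ _ SFs Fs) as [ms [Hms Lms]].
  (* The two zeros appear on the side towards which F decreases, hence the minus sign. *)
  set (sg := - ms). assert (Hsg : sg = 1 \/ sg = -1) by (unfold sg; destruct Hms; lra).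
  assert (SK : smooth2 (fun s t => tau * (- coord (negb b) (vel (Gam s) t) / knum (Gam s) t ^ 2)) 0 t0).
  { pose proof (smooth2_front_factor _ _ _ HG b HP). auto with smooth. }
  destruct (smooth2_sign _ _ _ SK) as [kap [Hkap Lkap]].
  { apply Rmult_neq_0; auto. now apply front_factor_neq_0. }
  assert (SE : smooth2 (fun s t => Derive (front_slope (Gam s) b) t) 0 t0).
  { apply (smooth2_partial_y (fun s t => front_slope (Gam s) b t)). now apply smooth2_front_slope. }
  destruct (smooth2_sign _ _ _ SE) as [eta [Heta Leta]].
  { now apply Derive_front_slope_neq_0. }
  pose proof (smooth2_knum _ _ _ HG) as SP. pose proof (smooth2_qform _ _ _ HG) as SQ.
  pose proof (smooth2_vel _ _ _ HG (negb b)) as Svel.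
  assert (SZ : smooth2 (fun s t => tau * (knum (Gam s) t * qform (Gam s) t)) 0 t0) by auto with smooth.
  destruct (smooth2_sign _ _ _ SZ) as [zet [Hzet Lzet]].
  { repeat apply Rmult_neq_0; auto. }
  (* All sign conditions hold at (0, t0) and are open, so a single square serves for all of them. *)
  assert (HL := locally_2d_and _ _ _ _ (smooth_fam_locally _ _ _ HG)
    (locally_2d_and _ _ _ _ (locally_2d_neq_0 _ _ _ SQ Hq)
    (locally_2d_and _ _ _ _ (locally_2d_neq_0 _ _ _ SP HP)
    (locally_2d_and _ _ _ _ (locally_2d_neq_0 _ _ _ Svel Hb)
    (locally_2d_and _ _ _ _ (smooth2_pos _ _ _ SFtt Ftt)
    (locally_2d_and _ _ _ _ Lms
    (locally_2d_and _ _ _ _ Lkap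
    (locally_2d_and _ _ _ _ Leta Lzet)))))))).
  apply locally_2d_box in HL as [e [He HL]].
  assert (Hbox : forall s t, Rabs s < e -> Rabs (t - t0) < e ->
    smooth_fam Gam s t /\ qform (Gam s) t <> 0 /\ knum (Gam s) t <> 0 /\
    coord (negb b) (vel (Gam s) t) <> 0 /\
    0 < Derive (fun t => Derive (F s) t) t /\ sg * Derive (fun s => F s t) s < 0 /\
    0 < kap * (tau * (- coord (negb b) (vel (Gam s) t) / knum (Gam s) t ^ 2)) /\
    0 < eta * Derive (front_slope (Gam s) b) t /\
    0 < zet * (tau * (knum (Gam s) t * qform (Gam s) t))).
  { intros s t Hs Ht. rewrite <- (Rminus_0_r s) in Hs.
    destruct (HL s t Hs Ht) as [B1 [B2 [B3 [B4 [B5 [B6 [B7 [B8 B9]]]]]]]].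
    repeat (split; [assumption|]). split; [unfold sg; lra|]. auto. }
  assert (HF0 : F 0 t0 = 0) by (unfold F; rewrite G0; ring).
  assert (HFt0 : Derive (F 0) t0 = 0) by (unfold F; rewrite Derive_scal, G1; ring).
  exists sg. split; [exact Hsg|split; [|split]].
  - exact (transition_evolute_defined Gam t0 e tau sg kap eta zet b He Hbox).
  - apply (transition_swallowtail Gam t0 e tau sg kap eta zet b); auto. now apply evolute_E6.
  - apply (transition_vertices Gam t0 e tau sg kap eta zet b); auto.
Qed.

Lemma vel_ext_loc c c' t : locally t (fun u => c u = c' u) -> locally t (fun u => vel c u = vel c' u).
Proof.
  intros H. generalize (locally_locally _ _ H). apply filter_imp. intros u Hu.
  unfold vel. f_equal; apply Derive_ext_loc; revert Hu; apply filter_imp; intros v ->; reflexivity.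
Qed.

Lemma curvature_ext_loc c c' t : locally t (fun u => c u = c' u) ->
  locally t (fun u => curvature c u = curvature c' u).
Proof.
  intros H. pose proof (vel_ext_loc _ _ _ H) as H1. pose proof (vel_ext_loc _ _ _ H1) as H2.
  generalize (filter_and _ _ H1 H2). apply filter_imp. intros u [E1 E2].
  unfold curvature, acc. now rewrite E1, E2.
Qed.

(** [Gam 0] and [gam] agree only on the interval (a, b), so the vertex condition is transferred as a
    property of germs. *)
Lemma vertex_of_order_ext_loc k c c' t : locally t (fun u => c u = c' u) ->
  vertex_of_order k c t -> vertex_of_order k c' t.
Proof.
  intros H [H1 [H2 H3]]. pose proof (curvature_ext_loc _ _ _ H) as HK.
  pose proof (locally_singleton _ _ (vel_ext_loc _ _ _ H)) as HV. cbv beta in HV.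
  split; [|split].
  - unfold nonlightlike in *. now rewrite <- HV.
  - intros i Hi. rewrite <- (Derive_n_ext_loc _ _ i t HK). auto.
  - now rewrite <- (Derive_n_ext_loc _ _ (S k) t HK).
Qed.

Theorem proposition6 (gam : R -> point) (a b : Rbar) (t0 : R)
  (ht0 : Rbar_lt a t0 /\ Rbar_lt t0 b)
  (hsmooth : forall t : R, Rbar_lt a t -> Rbar_lt t b -> smooth_curve gam t)
  (hreg : forall t : R, Rbar_lt a t -> Rbar_lt t b -> regular_at gam t)
  (hvertex : vertex_of_order 2 gam t0)
  (hninfl : ~ inflection gam t0) :
  E6_singularity (evolute gam) t0 /\
  forall (Gam : R -> R -> point) (d : R),
    0 < d ->
    smooth_family Gam a b d ->
    (forall t : R, Rbar_lt a t -> Rbar_lt t b -> Gam 0 t = gam t) ->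
    generic_family Gam t0 ->
    exists sg : R, (sg = 1 \/ sg = -1) /\
      on_sides sg (fun s r => evolute_defined_near (Gam s) t0 r)
                  (fun s r => evolute_defined_near (Gam s) t0 r) /\
      swallowtail_transition (fun s => evolute (Gam s)) t0 sg /\
      on_sides sg (fun s r => one_inward_one_outward (Gam s) t0 r)
                  (fun s r => no_vertex (Gam s) t0 r).
Proof.
  destruct ht0 as [Ha Hb].
  (* Stated for any such curve c because it is applied both to [gam] and to [Gam 0]. *)
  assert (Hknum : forall c, vertex_of_order 2 c t0 -> curvature c t0 = curvature gam t0 -> knum c t0 <> 0).
  { intros c [Hq _] E HP. apply hninfl. split; [apply hvertex|]. rewrite <- E.
    now apply (inflection_knum c t0 Hq). }
  split; [apply evolute_E6; auto|].
  intros Gam d Hd Hfam HGam Hgen.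
  assert (Hloc : locally t0 (fun t => gam t = Gam 0 t)).
  { generalize (filter_and _ _ (open_Rbar_gt' t0 a Ha) (open_Rbar_lt' t0 b Hb)).
    apply filter_imp. intros t [A B]. symmetry. now apply HGam. }
  pose proof (vertex_of_order_ext_loc 2 _ _ _ Hloc hvertex) as Hv.
  apply family_transition; auto.
  - apply Hfam; auto. now rewrite Rabs_R0.
  - apply Hknum; auto. symmetry. exact (locally_singleton _ _ (curvature_ext_loc _ _ _ Hloc)).
Qed.
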